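(* Let $w_0\in H^2(0,1)$, let $w$ be the solution of the closed-loop problem and $w_h$ the semidiscrete finite element solution described in the context, with $\alpha$ as in the context, and assume $w(t)\in W^{2,\infty}(0,1)$. Then, with implied constants independent of $h$ and $t$, $$\|(w-w_h)(t)\|_{L^\infty}=O\Big(\frac{h^2}{\sqrt\mu}e^{-\alpha t}\Big)$$ and, for $i=0,1$, $$|v_i(t)-v_{ih}(t)|:=|K_i(w(i,t))-K_i(w_h(i,t))|=O\Big(\frac{h^2}{\sqrt\mu}e^{-\alpha t}\Big).$$
   Context: Constants: $\mu>0$, $\nu>0$, $w_d\ge 0$, $c_0>0$, $c_1>0$ (fixed, as is $w_0$). $\|\cdot\|$ and $(\cdot,\cdot)$ are the norm and inner product of $L^2(0,1)$; $\|\cdot\|_m$ is the $H^m(0,1)$ norm; subscripts $x,t$ denote derivatives. Feedback laws: for $y\in\mathbb R$, $$K_0(y)=\frac1\nu\Big((c_0+1+w_d)y+\frac{2}{9c_0}y^3\Big),\qquad K_1(y)=-\frac1\nu\Big((c_1+1+w_d)y+\frac{2}{9c_1}y^3\Big).$$ Closed-loop problem: $w=w(x,t)$, $x\in(0,1)$, $t>0$, satisfies $$w_t-\mu w_{xxt}-\nu w_{xx}+(1+w_d)w_x+ww_x=0,\qquad w(x,0)=w_0(x),$$ $$w_x(0,t)=v_0(t):=K_0(w(0,t)),\qquad w_x(1,t)=v_1(t):=K_1(w(1,t)).$$ Standing well-posedness assumption: for $w_0\in H^2(0,1)$ there is a unique weak solution with $w(t)\in H^1(0,1)$, $w_t\in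 L^2(L^2)$, $\mu w_t\in L^2(H^1)$, and it satisfies $\|w(t)\|_2^2+\|w_t(t)\|^2+\mu\|w_{xt}(t)\|^2+\int_0^t(\|w_t(s)\|_1^2+\mu\|w_{xxt}(s)\|^2)\,ds\le C$. Finite element space: for a partition $0=x_0<\dots<x_N=1$ with mesh size $h=\max_j(x_j-x_{j-1})$, $V_h$ is the space of continuous functions on $[0,1]$ that are affine on each $(x_{j-1},x_j)$. Semidiscrete solution: $w_h(t)\in V_h$, $t>0$, satisfies $w_h(0)=w_{0h}$ and, for all $\chi\in V_h$, $$(w_{ht},\chi)+\mu(w_{hxt},\chi_x)+\nu(w_{hx},\chi_x)+(1+w_d)(w_{hx},\chi)+(w_hw_{hx},\chi)+\sum_{i=0}^1\Big((1+c_i+w_d)w_h(i,t)+\frac{2}{9c_i}w_h^3(i,t)\Big)\chi(i)+\frac{\mu}{\nu}\sum_{i=0}^1\Big((c_i+1+w_d)w_{ht}(i,t)+\frac{2}{3c_i}w_h^2(i,t)w_{ht}(i,t)\Big)\chi(i)=0.$$ The discrete controls are $v_{ih}(t)=K_i(w_h(i,t))$, $i=0,1$. Here $w_{0h}\in V_h$ is the $H^1$-projection of $w_0$: $(w_{0x}-w_{0hx},\chi_x)+\lambda(w_0-w_{0h},\chi)=0$ for all $\chi\in V_h$, with $\lambda>0$ fixed. The number $\alpha$ is any real with $$0\le\alpha\le\frac12\min\Big\{\frac{\nu}{\mu+1},\ \frac{\nu}{2\mu+\nu},\ \frac{\nu(1+c_i+w_d)}{\nu+(1+c_i+w_d)\mu}\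 (i=0,1)\Big\}.$$ *)

(* Defs.v *)
From HB Require Import structures.
From mathcomp Require Import all_boot all_order all_algebra.
From mathcomp Require Import all_classical all_reals all_analysis.

Set Implicit Arguments.
Unset Strict Implicit.
Unset Printing Implicit Defensive.

Import Order.TTheory GRing.Theory Num.Theory.
Import numFieldNormedType.Exports.

Local Open Scope classical_set_scope.
Local Open Scope ring_scope.

(** Functions on the space interval are total functions [R -> R]; every
    definition below depends only on their values on [[0, 1]]. *)

Definition Lpnorm (R : realType) (p : \bar R) (f : R -> R) : \bar R :=
  'N[lebesgue_measure]_p [EFin \o (f \_ (`[0, 1] : set R))].

Definition memLp (R : realType) (p : \bar R) (f : R -> R) : Prop :=
  measurable_fun (`[0, 1] : set R) f /\ (Lpnorm p f < +oo)%E.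

Definition ip (R : realType) (f g : R -> R) : R :=
  \int[lebesgue_measure]_(x in `[0, 1]) (f x * g x).

(** [W1p p f f']: [f] is the continuous representative of an element of
    W^{1,p}(0, 1), that is, an absolutely continuous function on [[0, 1]], and
    [f'] represents its derivative in L^p.  Point values such as [f 0] and
    [f 1] are therefore the traces. *)
Definition W1p (R : realType) (p : \bar R) (f f' : R -> R) : Prop :=
  memLp p f' /\
  forall x : R, x \in `[0, 1] ->
    f x = f 0 + \int[lebesgue_measure]_(y in `[0, x]) f' y.

Definition W2p (R : realType) (p : \bar R) (f f' f'' : R -> R) : Prop :=
  W1p p f f' /\ W1p p f' f''.

Definition H1 (R : realType) (f f' : R -> R) : Prop := W1p 2%:E f f'.

Definition H2 (R : realType) (f f' f'' : R -> R) : Prop := W2p 2%:E f f' f''.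

Definition sqL2 (R : realType) (f : R -> R) : \bar R := (Lpnorm 2%:E f ^+ 2)%E.

(** The argument [i : 'I_2] is both the index of the control and, through
    [i%:R], the endpoint of [[0, 1]] at which it acts. *)
Definition K (R : realType) (nu wd : R) (c : 'I_2 -> R) (i : 'I_2) (y : R) : R :=
  (-1) ^+ i / nu * ((c i + 1 + wd) * y + 2 / (9 * c i) * y ^+ 3).

Definition alpha_max (R : realType) (mu nu wd : R) (c : 'I_2 -> R) : R :=
  2^-1 * Num.min (nu / (mu + 1))
    (\big[Num.min/(nu / (2 * mu + nu))]_(i < 2)
       (nu * (1 + c i + wd) / (nu + (1 + c i + wd) * mu))).

(** Left-hand side of the variational equation, for [u] with space derivative
    [ux], time derivative [ut] and mixed derivative [uxt], against a test
    function [chi] with derivative [chix].  The boundary sums come from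
    integrating [- mu u_xxt - nu u_xx] by parts and substituting
    [u_x(i, t) = K i (u(i, t))] and its time derivative. *)
Definition weak_form (R : realType) (mu nu wd : R) (c : 'I_2 -> R)
    (u ux ut uxt chi chix : R -> R) : R :=
  ip ut chi + mu * ip uxt chix + nu * ip ux chix + (1 + wd) * ip ux chi
  + ip (fun x => u x * ux x) chi
  + \sum_(i < 2) ((1 + c i + wd) * u i%:R
                  + 2 / (9 * c i) * u i%:R ^+ 3) * chi i%:R
  + mu / nu * \sum_(i < 2) ((c i + 1 + wd) * ut i%:R
                  + 2 / (3 * c i) * u i%:R ^+ 2 * ut i%:R) * chi i%:R.

Definition spacetime_measurable (R : realType) (f : R -> R -> R) : Prop :=
  measurable_fun ((`[0, +oo[ : set R) `*` (`[0, 1] : set R)) (fun p : R * R => f p.1 p.2).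

(** Space-time functions are written [w t x].  The space L^2(0, T; L^2(0, 1))
    is identified with L^2((0, T) x (0, 1)), and [w_t] in L^2(0, T; H^1(0, 1))
    is the derivative of [w] in the Bochner sense: since point evaluation is
    continuous on H^1(0, 1), the identity
    [w(t) = w_0 + \int_0^t w_t(s) ds] is stated pointwise in [x]. *)
Definition weak_solution (R : realType) (mu nu wd : R) (c : 'I_2 -> R)
    (w0 : R -> R) (w wx wt wxt : R -> R -> R) : Prop :=
  [/\ (forall t : R, 0 <= t -> H1 (w t) (wx t)),
      [/\ spacetime_measurable wt, spacetime_measurable wxt,
          {ae lebesgue_measure, forall t : R, 0 < t -> H1 (wt t) (wxt t)} &
          forall T : R, 0 < T ->
            (\int[lebesgue_measure]_(t in `[0%R, T])
               (sqL2 (wt t) + sqL2 (wxt t)) < +oo)%E],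
      (forall t x : R, 0 <= t -> x \in `[0, 1] ->
         w t x = w0 x + \int[lebesgue_measure]_(s in `[0, t]) wt s x) &
      {ae lebesgue_measure, forall t : R, 0 < t ->
         forall chi chix, H1 chi chix ->
           weak_form mu nu wd c (w t) (wx t) (wt t) (wxt t) chi chix = 0}].

(** The regularity and the uniform-in-time bound that the well-posedness theory
    provides for initial data in H^2(0, 1). *)
Definition apriori_bound (R : realType) (mu : R)
    (w wx wxx wt wxt wxxt : R -> R -> R) : Prop :=
  [/\ (forall t : R, 0 <= t -> H2 (w t) (wx t) (wxx t)),
      spacetime_measurable wxxt,
      {ae lebesgue_measure, forall t : R, 0 < t ->
         H2 (wt t) (wxt t) (wxxt t)} &
      exists C : R, {ae lebesgue_measure, forall t : R, 0 < t ->
        (sqL2 (w t) + sqL2 (wx t) + sqL2 (wxx t)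
         + sqL2 (wt t) + mu%:E * sqL2 (wxt t)
         + \int[lebesgue_measure]_(s in `[0%R, t])
             (sqL2 (wt s) + sqL2 (wxt s) + mu%:E * sqL2 (wxxt s))
         <= C%:E)%E}].

Definition closed_loop_solution (R : realType) (mu nu wd : R) (c : 'I_2 -> R)
    (w0 : R -> R) (w : R -> R -> R) : Prop :=
  exists wx wxx wt wxt wxxt : R -> R -> R,
    weak_solution mu nu wd c w0 w wx wt wxt /\
    apriori_bound mu w wx wxx wt wxt wxxt.

(** A partition [0 = x_0 < ... < x_N = 1] is given by [s = [:: x_1; ...; x_N]]
    with [itv_partition 0 1 s], so that [x_j] is [(0 :: s)`_j]. *)
Definition mesh_size (R : realType) (s : seq R) : R :=
  \big[Num.max/0]_(j < size s) ((0 :: s)`_j.+1 - (0 :: s)`_j).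

Definition Vh (R : realType) (s : seq R) (f : R -> R) : Prop :=
  {within `[0, 1], continuous f} /\
  forall j, (j < size s)%N ->
    exists a b : R, forall x : R, x \in `](0 :: s)`_j, (0 :: s)`_j.+1[ ->
      f x = a * x + b.

Definition H1_projection (R : realType) (lambda : R) (s : seq R)
    (u uh : R -> R) : Prop :=
  Vh s uh /\
  exists ux uhx : R -> R, [/\ H1 u ux, H1 uh uhx &
    forall chi chix, Vh s chi -> H1 chi chix ->
      ip (fun x => ux x - uhx x) chix
      + lambda * ip (fun x => u x - uh x) chi = 0].

Definition semidiscrete_solution (R : realType) (mu nu wd : R) (c : 'I_2 -> R)
    (s : seq R) (w0h : R -> R) (wh : R -> R -> R) : Prop :=
  [/\ (forall t : R, 0 <= t -> Vh s (wh t)),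
      (forall x : R, x \in `[0, 1] -> wh 0 x = w0h x),
      (forall x : R, x \in `[0, 1] ->
         {within `[0, +oo[, continuous (fun t => wh t x)}) &
      exists whx wht whxt : R -> R -> R, forall t : R, 0 < t ->
        [/\ (forall x : R, x \in `[0, 1] ->
               is_derive t 1 (fun t' => wh t' x) (wht t x)),
            H1 (wh t) (whx t), H1 (wht t) (whxt t) &
            forall chi chix, Vh s chi -> H1 chi chix ->
              weak_form mu nu wd c
                (wh t) (whx t) (wht t) (whxt t) chi chix = 0]].

(* Main.v *)
(** Let [I_h] be piecewise linear interpolation.  It is exact at the endpoints, and
    the derivative of [w - I_h w] is orthogonal to the derivatives of [V_h], so
    [I_h w] solves the semidiscrete equation up to a residual controlled by the
    sup norms of [w - I_h w] and [w_t - I_h w_t].  Testing the weak form with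
    piecewise linear ramps, whose derivatives are averages over intervals, shows
    that [mu w_t + nu w] is interpolated with error O(h^2), and the equation
    [mu y' + nu y = k] transfers this to [w] and [w_t].

    An energy made of the H^1 norm and a quartic boundary term satisfies a
    differential inequality whose rate is strictly larger than [alpha_max].
    Applied to [I_h w] with [h -> 0] it gives exponential decay of [w], hence of
    the interpolation errors; applied to [theta = w_h - I_h w], whose equation
    linearised at [I_h w] has decaying coefficients, it bounds [theta] in H^1, and
    in one dimension this bounds the sup norm and the boundary values. *)

Require Import Defs.
From mathcomp Require Import all_boot all_order all_algebra.
From mathcomp Require Import all_classical all_reals all_analysis.
From mathcomp Require Import measurable_realfun ess_sup_inf ring lra.

Set Implicit Arguments.
Unset Strict Implicit.
Unset Printing Implicit Defensive.

Import Order.TTheory GRing.Theory Num.Theory.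
Import numFieldNormedType.Exports.

Local Open Scope classical_set_scope.
Local Open Scope ring_scope.

(** * Square-integrable functions and weak derivatives *)

Section SquareIntegrable.
Context {R : realType}.
Implicit Types (f g h : R -> R) (a b x y k : R).
Local Notation leb := (@lebesgue_measure R).
Local Notation I01 := (`[0, 1]%classic : set R).

(** The W^{2,infinity} hypothesis carries no bound uniform in time, so it is used at the single time
    1; all other space regularity is drawn from the equation. The equation itself holds only for
    almost every time. At a fixed time it determines [w_t] from [w], Lipschitz continuously in the
    sup norm on bounded sets, so [w_t] agrees on a dense set of times with a function [G] that is
    Lipschitz in time; estimates are proved on this set and pass to all times by continuity.
    Energies are differentiated only along interpolants, where they are polynomials in finitely many
    nodal values; this is why the decay of [w] goes through [I_h w]. Interpolation bounds and decay
    feed each other: boundedness of [w] gives interpolation errors O(h^2) without decay, these give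
    decay of [w], and decay improves the errors. The residual decays at the same rate as the
    solution, which costs a factor [t] in the Gronwall argument; a rate strictly above [alpha]
    absorbs it. Constants may depend on [mu], and the final one contains [Num.sqrt mu]. *)

Definition L2 f : Prop :=
  measurable_fun I01 f /\ leb.-integrable I01 (EFin \o (fun x => f x ^+ 2)).

Lemma measurable_I01 : @measurable _ (g_sigma_algebraType (R.-ocitv.-measurable)) I01.
Proof. exact: measurable_itv. Qed.
Hint Resolve measurable_I01 : core.

Lemma sqnorm_integral f :
  (Lpnorm 2%:E f `^ 2)%E = (\int[leb]_(x in I01) (f x ^+ 2)%:E)%E.
Proof.
rewrite /Lpnorm poweR_Lnorm// [RHS]integral_mkcond.
apply: eq_integral => x _; rewrite /= !patchE; case: ifPn => _.
  by rewrite (@powR_mulrn R _ 2)// real_normK// num_real.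
by rewrite normr0 (@powR_mulrn R _ 2)// expr0n.
Qed.

Lemma memLp2P f : memLp 2%:E f <-> L2 f.
Proof.
have Lge0 : (0 <= Lpnorm 2%:E f)%E by exact: Lnorm_ge0.
split=> -[mf fin]; split=> //.
  apply/integrableP; split.
    by apply/measurable_EFinP; apply: measurable_funX.
  under eq_integral => x _ do rewrite /= ger0_norm ?sqr_ge0//.
  by rewrite -sqnorm_integral poweR_lty.
move/integrableP : fin => [_].
under eq_integral => x _ do rewrite /= ger0_norm ?sqr_ge0//.
rewrite -sqnorm_integral.
case: (Lpnorm 2 f) Lge0 => [r|//|//] _ H; first exact: ltry.
by move: H; rewrite poweRyr.
Qed.

Lemma L2_mul_integrable f g : L2 f -> L2 g ->
  leb.-integrable I01 (EFin \o (fun x => f x * g x)).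
Proof.
move=> [mf if2] [mg ig2].
have ifg := integrableD measurable_I01 if2 ig2.
apply: (le_integrable measurable_I01 _ _ ifg).
  by apply/measurable_EFinP; apply: measurable_funM.
move=> x _ /=; rewrite lee_fin [leRHS]ger0_norm ?addr_ge0 ?sqr_ge0//.
rewrite ler_norml; apply/andP; split; nra.
Qed.

Lemma ipC f g : ip f g = ip g f.
Proof. by apply: eq_Rintegral => x _; rewrite mulrC. Qed.

Lemma eq_ip f f' g g' : {in I01, f =1 f'} -> {in I01, g =1 g'} ->
  ip f g = ip f' g'.
Proof. by move=> ff' gg'; apply: eq_Rintegral => x xI; rewrite ff' ?gg'. Qed.

Lemma eq_L2 f g : {in I01, f =1 g} -> L2 f -> L2 g.
Proof.
move=> fg [mf if2]; split; first exact: eq_measurable_fun mf.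
by apply: eq_integrable if2 => // x xI /=; rewrite fg.
Qed.

Lemma L2_bounded f k : measurable_fun I01 f ->
  (forall x, x \in `[0, 1] -> `|f x| <= k) -> L2 f.
Proof.
move=> mf fk; split=> //; apply: measurable_bounded_integrable => //.
- by rewrite /= lebesgue_measure_itv/= lte01 -EFinB ltry.
- exact: measurable_funX.
exists (k ^+ 2); split; first by rewrite num_real.
move=> M kM x xI /=; rewrite ger0_norm ?sqr_ge0//; apply: le_trans (ltW kM).
by rewrite -real_normK ?num_real// lerXn2r ?nnegrE// ?fk// (le_trans _ (fk _ xI)).
Qed.

Lemma L2D f g : L2 f -> L2 g -> L2 (fun x => f x + g x).
Proof.
move=> Lf Lg; have [mf if2] := Lf; have [mg ig2] := Lg.
split; first exact: measurable_funD.
have ifg := L2_mul_integrable Lf Lg.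
have := integrableD measurable_I01 (integrableD measurable_I01 if2 ig2)
          (integrableZl measurable_I01 2 ifg).
apply: eq_integrable => //; by move=> x xI /=; rewrite -EFinM -!EFinD; congr EFin; ring.
Qed.

Lemma L2M f g k : measurable_fun I01 g ->
  (forall x, x \in `[0, 1] -> `|g x| <= k) -> L2 f -> L2 (fun x => g x * f x).
Proof.
move=> mg gk [mf if2]; split; first exact: measurable_funM.
apply: (le_integrable measurable_I01 _ _ (integrableZl measurable_I01 (k ^+ 2) if2)).
  by apply/measurable_EFinP; apply: measurable_funX; exact: measurable_funM.
move=> x xI /=; rewrite lee_fin exprMn normrM [leRHS]normrM ler_wpM2r//.
rewrite !ger0_norm ?sqr_ge0// -real_normK ?num_real// lerXn2r ?nnegrE// ?gk//.
by rewrite (le_trans _ (gk _ xI)).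
Qed.

Lemma L2_cst k : L2 (fun=> k).
Proof. by apply: (@L2_bounded _ `|k|). Qed.

Lemma L2Z f k : L2 f -> L2 (fun x => k * f x).
Proof. by apply: (@L2M f (fun=> k) `|k|). Qed.

Lemma L2N f : L2 f -> L2 (fun x => - f x).
Proof.
move=> Lf; apply: eq_L2 (L2Z (-1) Lf) => x _; by rewrite mulN1r.
Qed.

Lemma L2B f g : L2 f -> L2 g -> L2 (fun x => f x - g x).
Proof. by move=> Lf Lg; apply: L2D => //; exact: L2N. Qed.

Lemma ipDl f g h : L2 f -> L2 g -> L2 h ->
  ip (fun x => f x + g x) h = ip f h + ip g h.
Proof.
move=> Lf Lg Lh; rewrite /ip -RintegralD//; [|exact: L2_mul_integrable..].
by apply: eq_Rintegral => x _; rewrite mulrDl.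
Qed.

Lemma ipZl f h k : L2 f -> L2 h -> ip (fun x => k * f x) h = k * ip f h.
Proof.
move=> Lf Lh; rewrite /ip -RintegralZl//; last exact: L2_mul_integrable.
by apply: eq_Rintegral => x _; rewrite mulrA.
Qed.

Lemma ipDr f g h : L2 f -> L2 g -> L2 h ->
  ip h (fun x => f x + g x) = ip h f + ip h g.
Proof. by move=> *; rewrite ipC ipDl// !(ipC h). Qed.

Lemma ipZr f h k : L2 f -> L2 h -> ip h (fun x => k * f x) = k * ip h f.
Proof. by move=> *; rewrite ipC ipZl// ipC. Qed.

Lemma ipNl f h : L2 f -> L2 h -> ip (fun x => - f x) h = - ip f h.
Proof.
move=> Lf Lh; rewrite -mulN1r -ipZl//; apply: eq_ip => // x _.
by rewrite mulN1r.
Qed.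

Lemma ipBl f g h : L2 f -> L2 g -> L2 h ->
  ip (fun x => f x - g x) h = ip f h - ip g h.
Proof. by move=> *; rewrite ipDl ?ipNl//; exact: L2N. Qed.

Lemma ipBr f g h : L2 f -> L2 g -> L2 h ->
  ip h (fun x => f x - g x) = ip h f - ip h g.
Proof. by move=> *; rewrite ipC ipBl// !(ipC h). Qed.

Lemma ip_ge0 f : 0 <= ip f f.
Proof. by apply: Rintegral_ge0 => x _; rewrite -expr2 sqr_ge0. Qed.

Lemma ip_moveM f g h : ip (fun x => f x * g x) h = ip f (fun x => g x * h x).
Proof. by apply: eq_Rintegral => x _; rewrite mulrA. Qed.

Lemma le_ip f g k : L2 f -> L2 g ->
  (forall x, x \in `[0, 1] -> `|f x| <= k * `|g x|) ->
  ip f f <= k ^+ 2 * ip g g.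
Proof.
move=> Lf Lg fg; rewrite /ip -RintegralZl//; last exact: L2_mul_integrable.
apply: le_Rintegral => //; first exact: L2_mul_integrable.
  exact: (integrableZl measurable_I01 (k ^+ 2) (L2_mul_integrable Lg Lg)).
move=> x xI; rewrite -!expr2 -(real_normK (num_real (f x))).
by rewrite -(real_normK (num_real (g x))) -exprMn lerXn2r ?nnegrE ?fg// (le_trans _ (fg _ xI)).
Qed.

Lemma ip11 : ip (fun=> 1 : R) (fun=> 1 : R) = 1.
Proof.
rewrite /ip; under eq_Rintegral do rewrite mul1r.
by rewrite Rintegral_cst//= lebesgue_measure_itv/= lte01 -EFinB/= subr0 mul1r.
Qed.

Lemma ip_sup f k : L2 f -> (forall x, x \in `[0, 1] -> `|f x| <= k) ->
  ip f f <= k ^+ 2.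
Proof.
move=> Lf fk; rewrite -[leRHS]mulr1 -ip11; apply: le_ip => //; first exact: L2_cst.
by move=> x xI; rewrite normr1 mulr1 fk.
Qed.

Lemma young_ip f g k : L2 f -> L2 g ->
  2 * k * ip f g <= k ^+ 2 * ip f f + ip g g.
Proof.
move=> Lf Lg; have Lkf := L2Z k Lf.
have := ip_ge0 (fun x => k * f x - g x).
have LB := L2B Lkf Lg.
rewrite ipBl// !ipBr// !ipZl// !ipZr// (ipC g f); lra.
Qed.

Lemma cauchy_schwarz_ip f g : L2 f -> L2 g ->
  ip f g ^+ 2 <= ip f f * ip g g.
Proof.
move=> Lf Lg; have := young_ip (ip f g) Lf Lg.
have ff := ip_ge0 f; have gg := ip_ge0 g.
have [f0 |f0] := eqVneq (ip f f) 0.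
  rewrite f0 => _; suff -> : ip f g = 0 by rewrite expr0n mul0r.
  apply/eqP; apply: contraT => fg0.
  (* If [ip f f = 0] but [ip f g] were nonzero, this weight would turn the inequality into
     [2 * (ip g g + 1) <= ip g g]. *)
  have := young_ip ((ip g g + 1) / ip f g) Lf Lg; rewrite f0 mulr0 add0r.
  by rewrite -mulrA divfK//; lra.
move=> _; have fp : 0 < ip f f by rewrite lt_neqAle eq_sym f0.
have := young_ip (ip f g / ip f f) Lf Lg.
rewrite -subr_ge0 => H; rewrite -subr_ge0.
suff -> : ip f f * ip g g - ip f g ^+ 2 =
   ip f f * ((ip f g / ip f f) ^+ 2 * ip f f + ip g g - 2 * (ip f g / ip f f) * ip f g).
  by rewrite mulr_ge0.
by field.
Qed.

End SquareIntegrable.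
Hint Resolve measurable_I01 : core.

(** * Calculus of H^1 functions on the unit interval *)

Section WeakDerivative.
Context {R : realType}.
Implicit Types (f g h : R -> R) (a b x y k : R).
Local Notation leb := (@lebesgue_measure R).
Local Notation I01 := (`[0, 1]%classic : set R).

(** Half-open intervals make the indicators of adjacent intervals add up exactly ([indD]), so
    integrals over subintervals become inner products on the whole of [0, 1]. *)
Definition ind a b : R -> R := \1_(`]a, b]%classic : set R).

Lemma indE a b x : ind a b x = if (a < x) && (x <= b) then 1 else 0.
Proof.
rewrite /ind indicE; have -> : (x \in (`]a, b]%classic : set R)) = (a < x <= b).
  by apply/idP/idP => [/set_mem|h]; [rewrite /= in_itv|apply/mem_set; rewrite /= in_itv].
by case: ifP.
Qed.

Lemma measurable_ind a b (D : set R) : measurable_fun D (ind a b).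
Proof. by apply: measurable_indic; exact: measurable_itv. Qed.

Lemma normr_ind_le1 a b x : `|ind a b x| <= 1.
Proof. by rewrite indE; case: ifP; rewrite ?normr1 ?normr0. Qed.

Lemma L2_ind a b : L2 (ind a b).
Proof. by apply: (@L2_bounded _ _ 1) => [|x _]; [exact: measurable_ind|exact: normr_ind_le1]. Qed.
Hint Resolve L2_ind : core.

Lemma indD a b x y : a <= b -> b <= x -> ind a x y = ind a b y + ind b x y.
Proof.
move=> ab bx; rewrite !indE.
have [ay|ay] := ltP a y; have [yb|yb] := leP y b; have [yx|yx] := leP y x => /=; lra.
Qed.

Lemma indM a b x : ind a b x * ind a b x = ind a b x.
Proof. by rewrite indE; case: ifP => _; ring. Qed.

Lemma L2M_ind f a b : L2 f -> L2 (fun x => ind a b x * f x).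
Proof. by apply: (@L2M _ _ _ 1) => [|x _]; [exact: measurable_ind|exact: normr_ind_le1]. Qed.

Lemma Rintegral_ind f b : L2 f -> b \in `[0, 1] ->
  \int[leb]_(y in `[0, b]) f y = ip f (ind 0 b).
Proof.
move=> Lf; rewrite in_itv/= => /andP[b0 b1].
have if0 : leb.-integrable I01 (EFin \o f).
  apply: eq_integrable (L2_mul_integrable Lf (L2_cst 1)) => // x _ /=.
  by rewrite mulr1.
rewrite -Rintegral_itv_obnd_cbnd; last first.
  apply: integrableS if0 => //.
  by move=> x /=; rewrite !in_itv/= => /andP[/ltW -> xb]; rewrite (le_trans xb).
rewrite /ip.
transitivity (\int[leb]_(x in I01 `&` `]0, b]) f x).
  congr Rintegral; apply/seteqP; split=> x /=; rewrite !in_itv/=.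
    move=> /andP[x0 xb]; rewrite x0 xb; split=> //.
    by rewrite (ltW x0) (le_trans xb).
  by case.
rewrite Rintegral_mkcondr; apply: eq_Rintegral => x _.
by rewrite patchE /ind indicE; case: ifP => _; rewrite ?mulr1 ?mulr0.
Qed.

Lemma ip_ind a b : 0 <= a -> a <= b -> b <= 1 -> ip (fun=> 1) (ind a b) = b - a.
Proof.
suff H c : c \in `[0, 1] -> ip (fun=> 1) (ind 0 c) = c.
  move=> a0 ab b1.
  have Hb : b \in `[0, 1] by rewrite in_itv/= b1 andbT (le_trans a0).
  have Ha : a \in `[0, 1] by rewrite in_itv/= a0 (le_trans ab).
  rewrite -[X in _ = X - _](H _ Hb) -[X in _ = _ - X](H _ Ha) -ipBr//; last exact: L2_cst.
  apply: eq_ip => // x _; rewrite (indD x a0 ab); ring.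
move=> cI; rewrite -Rintegral_ind//; last exact: L2_cst.
move: cI; rewrite in_itv/= => /andP[c0 c1].
rewrite Rintegral_cst//= lebesgue_measure_itv/=.
rewrite lte_fin mul1r; case: (ltP 0 c) => [_|c0'] /=; first by rewrite subr0.
by apply/eqP; rewrite eq_le c0 c0'.
Qed.

Lemma H1P f f' : H1 f f' <->
  L2 f' /\ forall x, x \in `[0, 1] -> f x = f 0 + ip f' (ind 0 x).
Proof.
split=> -[Lf' ff']; have := Lf'; move/memLp2P => Lf''; split=> //.
  by move=> x xI; rewrite -Rintegral_ind// ff'.
by move=> x xI; rewrite Rintegral_ind// -ff'.
Qed.

Lemma H1_L2d f f' : H1 f f' -> L2 f'.
Proof. by move=> /H1P[]. Qed.

Lemma H1_incr f f' a b : H1 f f' -> 0 <= a -> a <= b -> b <= 1 ->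
  f b - f a = ip f' (ind a b).
Proof.
move=> /H1P[Lf' ff'] a0 ab b1.
have bI : b \in `[0, 1] by rewrite in_itv/= b1 (le_trans a0).
have aI : a \in `[0, 1] by rewrite in_itv/= a0 (le_trans ab).
rewrite (ff' b)// (ff' a)// [RHS](_ : _ = ip f' (fun x => ind 0 b x - ind 0 a x)).
  by rewrite ipBr//; ring.
by apply: eq_ip => // x _; rewrite (indD x a0 ab); ring.
Qed.

Lemma H1_holder_loc f f' a b x y : H1 f f' -> 0 <= a -> a <= x -> x <= y ->
  y <= b -> b <= 1 ->
  (f y - f x) ^+ 2 <= (y - x) * ip (fun z => ind a b z * f' z) (fun z => ind a b z * f' z).
Proof.
move=> H a0 ax xy yb b1; have Lf' := H1_L2d H.
rewrite (H1_incr H)//; [|by lra..].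
have -> : ip f' (ind x y) = ip (fun z => ind a b z * f' z) (ind x y).
  apply: eq_Rintegral => z _; rewrite !indE.
  case: (ltP x z) => xz /=; last by rewrite !mulr0.
  case: (leP z y) => zy /=; last by rewrite !mulr0.
  by rewrite (le_lt_trans ax xz) (le_trans zy yb)/= mul1r.
apply: le_trans (cauchy_schwarz_ip (L2M_ind a b Lf') (L2_ind x y)) _.
suff -> : ip (ind x y) (ind x y) = y - x by rewrite mulrC.
rewrite -ip_ind//; [|by lra..].
by apply: eq_Rintegral => z _; rewrite indM mul1r.
Qed.

Lemma H1_holder f f' x y : H1 f f' -> 0 <= x -> x <= y -> y <= 1 ->
  (f y - f x) ^+ 2 <= (y - x) * ip f' f'.
Proof.
move=> H x0 xy y1; rewrite (H1_incr H)//.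
apply: le_trans (cauchy_schwarz_ip (H1_L2d H) (L2_ind x y)) _.
suff -> : ip (ind x y) (ind x y) = y - x by rewrite mulrC.
rewrite -ip_ind//.
by apply: eq_Rintegral => z _; rewrite indM mul1r.
Qed.

Definition clamp x : R := Num.max 0 (Num.min x 1).

Lemma clamp_I01 x : clamp x \in `[0, 1].
Proof.
rewrite in_itv/= /clamp maxEle minEle; case: (leP x 1) => ?; rewrite ?ler01 ?lexx//.
by case: (leP 0 x) => h; rewrite ?h ?lexx ?ler01.
Qed.

Lemma clamp_id x : x \in `[0, 1] -> clamp x = x.
Proof. by rewrite in_itv/= /clamp; case: (leP x 1) => ?; case: leP => ?; lra. Qed.

Lemma clamp_lip x y : x <= y -> clamp x <= clamp y /\ clamp y - clamp x <= y - x.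
Proof.
rewrite /clamp !maxEle !minEle.
case: (leP x 1) => ?; case: (leP y 1) => ?; rewrite ?ler01; case: (leP 0 x) => ?;
  case: (leP 0 y) => ? ?; split; lra.
Qed.

(** Precomposing with [clamp] extends the function to the line by its end values, which makes
    continuity global and yields measurability on [0, 1]. The modulus of continuity is Hölder of
    exponent 1/2, by Cauchy-Schwarz. *)
Lemma H1_continuous_clamp f f' : H1 f f' -> continuous (f \o clamp).
Proof.
move=> H x; apply/cvgrPdist_lt => e e0 /=.
have K0 := ip_ge0 f'.
near=> y.
have xy : `|x - y| < e ^+ 2 / (ip f' f' + 1).
  near: y; apply/nbhs_ballP; exists (e ^+ 2 / (ip f' f' + 1)) => //=.
  by rewrite divr_gt0 ?exprn_gt0//; lra.
suff : (f (clamp x) - f (clamp y)) ^+ 2 < e ^+ 2.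
  move=> h; rewrite ltNge; apply/negP => h'.
  have : e ^+ 2 <= `|f (clamp x) - f (clamp y)| ^+ 2 by rewrite lerXn2r ?nnegrE// ltW.
  by rewrite real_normK ?num_real//; lra.
have main u v : u <= v -> v - u < e ^+ 2 / (ip f' f' + 1) ->
    (f (clamp v) - f (clamp u)) ^+ 2 < e ^+ 2.
  move=> uv uve; have [c1 c2] := clamp_lip uv.
  move: (clamp_I01 u) (clamp_I01 v); rewrite !in_itv/= => /andP[? ?] /andP[? ?].
  apply: (le_lt_trans (H1_holder H _ c1 _)) => //.
  move: uve; rewrite ltr_pdivlMr; last by lra.
  move=> uve; have : 0 < e ^+ 2 by rewrite exprn_gt0.
  nra.
have [h|h] := leP x y.
  rewrite -opprB sqrrN; apply: main => //.
  by move: xy; rewrite distrC ger0_norm// subr_ge0.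
by apply: main; [exact: ltW|move: xy; rewrite ger0_norm// subr_ge0 ltW].
Unshelve. all: end_near. Qed.

Lemma H1_measurable f f' : H1 f f' -> measurable_fun I01 f.
Proof.
move=> H; apply: (@eq_measurable_fun _ _ _ _ _ (f \o clamp)).
  by move=> x /set_mem xI; rewrite /= clamp_id.
apply: measurable_funTS; apply: continuous_measurable_fun.
exact: H1_continuous_clamp H.
Qed.

Lemma H1_bounded f f' : H1 f f' -> exists k, forall x, x \in `[0, 1] -> `|f x| <= k.
Proof.
move=> H; exists (`|f 0| + ip f' f' + 1) => x; rewrite in_itv/= => /andP[x0 x1].
have := H1_holder H (lexx 0) x0 x1; rewrite subr0 => h.
have K0 := ip_ge0 f'.
have := ler_normD (f x - f 0) (f 0); rewrite subrK.
suff : `|f x - f 0| <= ip f' f' + 1 by lra.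
rewrite ler_norml; apply/andP; split; nra.
Qed.

Lemma H1_L2 f f' : H1 f f' -> L2 f.
Proof.
by move=> H; have [k fk] := H1_bounded H; apply: L2_bounded fk; exact: H1_measurable H.
Qed.

Lemma H1_mulL2 f f' g : H1 f f' -> L2 g -> L2 (fun x => f x * g x).
Proof.
by move=> H Lg; have [k fk] := H1_bounded H; apply: L2M fk Lg; exact: H1_measurable H.
Qed.

Lemma H1D f f' g g' : H1 f f' -> H1 g g' ->
  H1 (fun x => f x + g x) (fun x => f' x + g' x).
Proof.
move=> /H1P[Lf ff] /H1P[Lg gg]; apply/H1P; split; first exact: L2D.
by move=> x xI; rewrite ipDl// (ff x)// (gg x)//; ring.
Qed.

Lemma H1Z f f' k : H1 f f' -> H1 (fun x => k * f x) (fun x => k * f' x).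
Proof.
move=> /H1P[Lf ff]; apply/H1P; split; first exact: L2Z.
by move=> x xI; rewrite ipZl// (ff x)//; ring.
Qed.

Lemma H1B f f' g g' : H1 f f' -> H1 g g' ->
  H1 (fun x => f x - g x) (fun x => f' x - g' x).
Proof.
move=> /H1P[Lf ff] /H1P[Lg gg]; apply/H1P; split; first exact: L2B.
by move=> x xI; rewrite ipBl// (ff x)// (gg x)//; ring.
Qed.

Lemma H1_cst k : H1 (fun=> k) (fun=> 0).
Proof.
apply/H1P; split; first exact: L2_cst.
move=> x xI; rewrite [ip _ _](_ : _ = 0) ?addr0// -[RHS](mul0r (ip (fun=> 1) (ind 0 x))).
by rewrite -ipZl//; [apply: eq_ip => // y _; rewrite mul0r|exact: L2_cst].
Qed.

Lemma H1_id : H1 (fun x => x) (fun=> 1).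
Proof.
apply/H1P; split; first exact: L2_cst.
by move=> x; rewrite in_itv/= => /andP[x0 x1]; rewrite ip_ind// subr0 add0r.
Qed.

Lemma eq_H1 f f' g : {in I01, f =1 g} -> H1 f f' -> H1 g f'.
Proof.
move=> fg /H1P[Lf ff]; apply/H1P; split=> // x xI.
have fgE y : y \in `[0, 1] -> g y = f y by move=> yI; rewrite fg// inE.
by rewrite !fgE// 1?ff// in_itv/= lexx ler01.
Qed.

(* Telescoping over [n] equal pieces bounds the oscillation of [H] by
   [x * N x / n]. *)
Lemma constant_of_superadditive (H N : R -> R) x : 0 <= x ->
  (forall a b, 0 <= a -> a <= b -> b <= x ->
    `|H b - H a| <= (b - a) * (N b - N a)) -> H x = H 0.
Proof.
move=> x0 HN.
have tel n : `|H x - H 0| <= x / n.+1%:R * (N x - N 0).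
  pose p (i : nat) := i%:R * (x / n.+1%:R) : R.
  have d0 : 0 <= x / n.+1%:R by rewrite divr_ge0.
  have pn : p n.+1 = x by rewrite /p mulrC divfK// pnatr_eq0.
  have p0 : p 0 = 0 by rewrite /p mul0r.
  have pS i : p i.+1 - p i = x / n.+1%:R by rewrite /p -natr1; ring.
  have pge i : 0 <= p i by rewrite /p mulr_ge0.
  have ple i : (i <= n.+1)%N -> p i <= x.
    by move=> ile; rewrite -[leRHS]pn /p ler_wpM2r// ler_nat.
  suff H' i : (i <= n.+1)%N -> `|H (p i) - H 0| <= x / n.+1%:R * (N (p i) - N 0).
    by have := H' n.+1 (leqnn _); rewrite pn.
  elim: i => [_|i IH il]; first by rewrite p0 !subrr normr0 mulr0.
  have := IH (ltnW il).
  have := HN (p i) (p i.+1) (pge i) _ (ple _ il); rewrite pS.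
  have -> : p i <= p i.+1 by rewrite -subr_ge0 pS.
  move=> /(_ isT) h1 h2.
  have := ler_normD (H (p i.+1) - H (p i)) (H (p i) - H 0).
  rewrite addrA subrK => h3; apply: (le_trans h3); apply: (le_trans (lerD h1 h2)).
  by rewrite -mulrDr addrA subrK.
apply/eqP; rewrite -subr_eq0 -normr_eq0 eq_le normr_ge0 andbT.
apply/ler_addgt0Pr => e e0; rewrite add0r.
pose M := x * `|N x - N 0|.
have M0 : 0 <= M by rewrite mulr_ge0.
have := tel (Num.Def.truncn (M / e)).
have := truncnS_gt (M / e); set n := (Num.Def.truncn _).+1 => hn h.
have n0 : 0 < n%:R :> R by rewrite ltr0n.
apply: (le_trans h); rewrite mulrAC ler_pdivrMr//.
move: hn; rewrite ltr_pdivrMr// => hn.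
apply: le_trans (_ : M <= _); first by rewrite /M ler_wpM2l// ler_norm.
by rewrite mulrC ltW// mulrC.
Qed.

(** The derivatives are merely square-integrable, so nothing is differentiated pointwise. Let [H] be
    the product minus the integral of the candidate derivative. By Hölder continuity its increment
    over [a, b] is at most [b - a] times the energy of [f'] and [g'] on that interval; since the
    energy is additive, [H] must be constant. *)
Lemma H1M f f' g g' : H1 f f' -> H1 g g' ->
  H1 (fun x => f x * g x) (fun x => f' x * g x + f x * g' x).
Proof.
move=> Hf Hg; have Lf' := H1_L2d Hf; have Lg' := H1_L2d Hg.
have Lf := H1_L2 Hf; have Lg := H1_L2 Hg.
have Lfg' := H1_mulL2 Hf Lg'.
have Lf'g : L2 (fun x => f' x * g x).
  by apply: eq_L2 (H1_mulL2 Hg Lf') => x _; rewrite mulrC.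
apply/H1P; split; first exact: L2D.
move=> x; rewrite in_itv/= => /andP[x0 x1].
pose h y := f' y * g y + f y * g' y.
have Lh : L2 h by exact: L2D.
pose H y := f y * g y - ip h (ind 0 y).
pose E f y := ip (fun z => ind 0 y z * f z) (fun z => ind 0 y z * f z) : R.
pose El f a b := ip (fun z => ind a b z * f z) (fun z => ind a b z * f z) : R.
have EB u a b : L2 u -> 0 <= a -> a <= b -> E u b - E u a = El u a b.
  move=> Lu a0 ab.
  have ipE c d : El u c d = ip (fun z => u z * ind c d z) u.
    by apply: eq_Rintegral => z _; rewrite mulrACA indM; ring.
  rewrite /E -!/(El u _ _) !ipE -ipBl//.
  - by apply: eq_ip => // z _; rewrite (indD z a0 ab); ring.
  - by apply: eq_L2 (L2M_ind 0 b Lu) => z _; rewrite mulrC.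
  - by apply: eq_L2 (L2M_ind 0 a Lu) => z _; rewrite mulrC.
have El_ge0 u a b : 0 <= El u a b by exact: ip_ge0.
have key u u' v' a b c : H1 u u' -> L2 v' -> 0 <= a -> a <= b -> b <= 1 ->
    a <= c -> c <= b ->
    2 * `|ip (fun z => (u c - u z) * v' z) (ind a b)| <= (b - a) * (El u' a b + El v' a b).
  move=> Hu Lv' a0 ab b1 ac cb.
  pose p z := ind a b z * (u c - u z); pose q z := ind a b z * v' z.
  have Lp : L2 p by apply/L2M_ind/L2B; [exact: L2_cst|exact: H1_L2 Hu].
  have Lq : L2 q by exact: L2M_ind.
  have -> : ip (fun z => (u c - u z) * v' z) (ind a b) = ip p q.
    by apply: eq_Rintegral => z _; rewrite /p /q -{1}indM; ring.
  have pp : ip p p <= (b - a) ^+ 2 * El u' a b.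
    have -> : (b - a) ^+ 2 * El u' a b =
        (Num.sqrt ((b - a) * El u' a b)) ^+ 2 * (b - a).
      by rewrite sqr_sqrtr ?mulr_ge0 ?subr_ge0//; ring.
    rewrite -[X in _ <= _ * X](ip_ind a0 ab b1).
    have -> : ip (fun=> 1) (ind a b) = ip (ind a b) (ind a b).
      by apply: eq_Rintegral => z _; rewrite indM mul1r.
    apply: le_ip => // z _; rewrite /p normrM mulrC indE.
    case: ifP => [/andP[az zb]|_]; last by rewrite normr0 !mulr0.
    rewrite normr1 !mulr1 -ler_sqr ?nnegrE//.
    rewrite sqr_sqrtr ?mulr_ge0 ?subr_ge0// real_normK ?num_real//.
    have [zc|/ltW cz] := leP z c.
      apply: le_trans (H1_holder_loc Hu a0 (ltW az) zc cb b1) _.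
      by rewrite -/(El u' a b) ler_wpM2r// lerB// ltW.
    rewrite -opprB sqrrN; apply: le_trans (H1_holder_loc Hu a0 ac cz zb b1) _.
    by rewrite -/(El u' a b) ler_wpM2r// lerB// ltW.
  rewrite -[leLHS]ger0_norm ?mulr_ge0// -ler_sqr ?nnegrE//; last first.
    by rewrite mulr_ge0 ?subr_ge0 ?addr_ge0.
  rewrite real_normK ?num_real// exprMn real_normK ?num_real//.
  have := cauchy_schwarz_ip Lp Lq; rewrite -/(El v' a b) => cs.
  have := sqr_ge0 (El u' a b - El v' a b); have := El_ge0 v' a b.
  have d2 := sqr_ge0 (b - a).
  move=> v0 d0; apply: (@le_trans _ _ (4 * ((b - a) ^+ 2 * El u' a b * El v' a b))).
    have := ler_wpM2r v0 pp; lra.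
  rewrite [leRHS]exprMn -mulrA mulrCA ler_wpM2l//; nra.
suff : H x = H 0.
  rewrite /H; have -> : ip h (ind 0 0) = 0.
    rewrite -[RHS](mul0r (ip h h)) -ipZl//.
    apply: eq_Rintegral => z _; rewrite indE.
    by have [h1|h1] := ltP 0 z; have [h2|h2] := leP z 0 => /=; lra.
  by rewrite subr0 => /eqP; rewrite subr_eq => /eqP.
apply: (@constant_of_superadditive H (fun y => E f' y + E g' y)) => // a b a0 ab bx.
have b1 : b <= 1 by exact: le_trans bx x1.
have -> : E f' b + E g' b - (E f' a + E g' a) = El f' a b + El g' a b.
  by rewrite -!EB//; ring.
(* Splitting [f b * g b - f a * g a] as [g b * (f b - f a) + f a * (g b - g a)] gives each integrand
   a factor that vanishes at an end of [a, b]. *)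
have -> : H b - H a = ip (fun z => (g b - g z) * f' z) (ind a b)
                     + ip (fun z => (f a - f z) * g' z) (ind a b).
  have L1 : L2 (fun z => (g b - g z) * f' z).
    exact: (H1_mulL2 (H1B (H1_cst _) Hg) Lf').
  have L2' : L2 (fun z => (f a - f z) * g' z).
    exact: (H1_mulL2 (H1B (H1_cst _) Hf) Lg').
  rewrite -ipDl//.
  transitivity (ip (fun z => (g b * f' z + f a * g' z) - h z) (ind a b)).
    rewrite ipBl//; last by apply: L2D; exact: L2Z.
    rewrite ipDl//; [|exact: L2Z..].
    rewrite !ipZl// -(H1_incr Hf)// -(H1_incr Hg)//.
    have -> : ip h (ind a b) = ip h (ind 0 b) - ip h (ind 0 a).
      rewrite -ipBr//; apply: eq_ip => // z _; rewrite (indD z a0 ab); ring.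
    by rewrite /H; ring.
  by apply: eq_ip => // z _; rewrite /h; ring.
have k1 := key _ _ _ _ _ _ Hg Lf' a0 ab b1 ab (lexx b).
have k2 := key _ _ _ _ _ _ Hf Lg' a0 ab b1 (lexx a) ab.
apply: (le_trans (ler_normD _ _)); nra.
Qed.

End WeakDerivative.

Hint Resolve L2_ind : core.

(** * Integration by parts, Poincaré and Sobolev inequalities, ramps *)

Section WeakCalculus.
Context {R : realType}.
Implicit Types (f g h : R -> R) (a b x y k : R).

Lemma I01_0 : 0 \in `[0, 1 : R].
Proof. by rewrite in_itv/= lexx ler01. Qed.

Lemma I01_1 : 1 \in `[0, 1 : R].
Proof. by rewrite in_itv/= lexx ler01. Qed.

Lemma ip_ftc f f' : H1 f f' -> ip f' (fun=> 1) = f 1 - f 0.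
Proof.
move=> [_ ff']; rewrite (ff' 1) ?I01_1// addrC addKr.
by apply: eq_Rintegral => x _; rewrite mulr1.
Qed.

Lemma ip_parts f f' g g' : H1 f f' -> H1 g g' ->
  ip f' g + ip f g' = f 1 * g 1 - f 0 * g 0.
Proof.
move=> Hf Hg; rewrite -(ip_ftc (H1M Hf Hg)).
have Lf'g : L2 (fun x => f' x * g x).
  by apply: eq_L2 (H1_mulL2 Hg (H1_L2d Hf)) => x _; rewrite mulrC.
rewrite ipDl//; [|exact: H1_mulL2 Hf (H1_L2d Hg)|exact: L2_cst].
by congr +%R; apply: eq_Rintegral => x _; rewrite mulr1.
Qed.

(** Integrates the derivative of [(x - k) * f x ^+ 2]; the choice of [k] distributes the weight
    between the two end values. *)
Lemma ip_weighted_square f f' k : H1 f f' ->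
  ip f f + 2 * ip f' (fun x => (x - k) * f x) = (1 - k) * f 1 ^+ 2 + k * f 0 ^+ 2.
Proof.
move=> H; have Hk := H1B H1_id (H1_cst k).
have := ip_parts Hk (H1M H H) => /=.
have Lf := H1_L2 H; have Lf' := H1_L2d H.
have -> : ip (fun=> 1 - 0) (fun x => f x * f x) = ip f f.
  by apply: eq_Rintegral => x _; ring.
have -> : ip (fun x => x - k) (fun x => f' x * f x + f x * f' x) =
          2 * ip f' (fun x => (x - k) * f x).
  rewrite -ipZl//; last exact: H1_mulL2 Hk Lf.
  by apply: eq_Rintegral => x _; ring.
by move=> ->; ring.
Qed.

(** The weight centred at 1/2 is at most 1/2 in absolute value. The resulting constants, 2/3 for the
    end values and 4/3 for the derivative, leave room above [alpha_max]: a coefficient 1 for the end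
    values would be absorbed by [2 * al * (1 + m * k i) <= k i] with nothing to spare. *)
Lemma poincare f f' : H1 f f' ->
  3 * ip f f <= 2 * (f 0 ^+ 2 + f 1 ^+ 2) + 4 * ip f' f'.
Proof.
move=> H; have Lf := H1_L2 H; have Lf' := H1_L2d H.
have := ip_weighted_square 2^-1 H.
set g := fun x => _.
have Lg : L2 g by exact: (H1_mulL2 (H1B H1_id (H1_cst _)) Lf).
have gg : ip g g <= 2^-1 ^+ 2 * ip f f.
  apply: le_ip => // x; rewrite in_itv/= => /andP[x0 x1].
  by rewrite normrM ler_wpM2r// ler_norml; apply/andP; split; lra.
have := young_ip (-1) Lf' Lg; lra.
Qed.

(** The weight with [k = 1] removes the value at 1 and bounds [f 0 ^+ 2] by the H^1 norm;
    [H1_holder] carries the bound from 0 to [x]. *)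
Lemma sobolev f f' x : H1 f f' -> x \in `[0, 1] ->
  f x ^+ 2 <= 4 * (ip f f + ip f' f').
Proof.
move=> H; have Lf := H1_L2 H; have Lf' := H1_L2d H.
have := ip_weighted_square 1 H.
set g := fun x => _.
have Lg : L2 g by exact: (H1_mulL2 (H1B H1_id (H1_cst _)) Lf).
have gg : ip g g <= 1 ^+ 2 * ip f f.
  apply: le_ip => // y; rewrite in_itv/= => /andP[x0 x1].
  by rewrite normrM ler_wpM2r// ler_norml; apply/andP; split; lra.
have h1 := young_ip 1 Lf' Lg => h2.
rewrite in_itv/= => /andP[x0 x1].
have := H1_holder H (lexx 0) x0 x1; rewrite subr0.
have := ler_piMl (ip_ge0 f') x1; have := sqr_ge0 (f x - f 0 - f 0); lra.
Qed.

Definition ramp a b x : R := clamp ((x - a) / (b - a)).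

Definition dramp a b x : R := (b - a)^-1 * ind a b x.

Lemma clamp_le0 x : x <= 0 -> clamp x = 0.
Proof. by rewrite /clamp maxEle minEle; case: (leP x 1) => ? ?; case: leP => ?; lra. Qed.

Lemma clamp_ge1 x : 1 <= x -> clamp x = 1.
Proof. by rewrite /clamp maxEle minEle; case: (leP x 1) => ? ?; case: leP => ?; lra. Qed.

Lemma ramp_le a b x : a < b -> x <= a -> ramp a b x = 0.
Proof. by move=> ab xa; rewrite /ramp clamp_le0// ler_pdivrMr; lra. Qed.

Lemma ramp_ge a b x : a < b -> b <= x -> ramp a b x = 1.
Proof. by move=> ab xa; rewrite /ramp clamp_ge1// ler_pdivlMr; lra. Qed.

Lemma ramp_mid a b x : a < b -> a <= x -> x <= b -> ramp a b x = (x - a) / (b - a).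
Proof.
move=> ab ax xb; rewrite /ramp clamp_id// in_itv/= ler_pdivrMr ?divr_ge0; lra.
Qed.

Lemma continuous_clamp : continuous (@clamp R).
Proof. exact: H1_continuous_clamp (@H1_id R). Qed.

Lemma continuous_ramp a b : continuous (ramp a b).
Proof.
move=> x; apply: (@continuous_comp _ _ _ (fun x => (x - a) / (b - a)) (@clamp R)).
  apply: cvgMl; apply: cvgB; [exact: cvg_id|exact: cvg_cst].
exact: continuous_clamp.
Qed.

Lemma L2_dramp a b : L2 (dramp a b).
Proof. exact: L2Z. Qed.

Lemma H1_ramp a b : 0 <= a -> a < b -> b <= 1 -> H1 (ramp a b) (dramp a b).
Proof.
move=> a0 ab b1; apply/H1P; split; first exact: L2_dramp.
move=> x; rewrite in_itv/= => /andP[x0 x1].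
rewrite (ramp_le ab a0) add0r ipZl//.
have E c : (forall z, ind a b z * ind 0 x z = ind a c z) ->
    ip (ind a b) (ind 0 x) = ip (fun=> 1) (ind a c).
  by move=> h; apply: eq_Rintegral => z _; rewrite h mul1r.
have [xa|ax] := leP x a.
  rewrite (ramp_le ab xa) (E a) ?ip_ind ?subrr ?mulr0//; first lra.
  move=> z; rewrite !indE; have [az|//] := ltP a z; last by rewrite mul0r.
  have -> : (z <= x) = false by apply/negbTE; rewrite -ltNge (le_lt_trans xa).
  by rewrite !andbF mulr0.
have [xb|bx] := leP x b.
  rewrite (ramp_mid ab (ltW ax) xb) (E x) ?ip_ind ?(ltW ax)//; first by rewrite mulrC.
  move=> z; rewrite !indE; have [az|//] := ltP a z; last by rewrite mul0r.
  rewrite (le_lt_trans a0 az) /=; have [zx|//] := leP z x; last by rewrite mulr0.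
  by rewrite (le_trans zx xb) mulr1.
rewrite (ramp_ge ab (ltW bx)) (E b) ?ip_ind ?(ltW ab)//; first by rewrite mulVf//; lra.
move=> z; rewrite !indE; have [az|//] := ltP a z; last by rewrite mul0r.
rewrite (le_lt_trans a0 az) /=; have [zb|//] := leP z b; last by rewrite mul0r.
by rewrite (le_trans zb (ltW bx)) mulr1.
Qed.

Lemma ip_dramp f f' a b : H1 f f' -> 0 <= a -> a < b -> b <= 1 ->
  ip f' (dramp a b) = (f b - f a) / (b - a).
Proof.
move=> H a0 ab b1; rewrite ipZr//; last exact: H1_L2d H.
by rewrite (H1_incr H) ?(ltW ab)// mulrC.
Qed.

Lemma ramp_itv a b x : 0 <= ramp a b x <= 1.
Proof. by have := clamp_I01 ((x - a) / (b - a)); rewrite in_itv. Qed.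

End WeakCalculus.

(** * Piecewise linear interpolation *)

Section Interpolation.
Context {R : realType}.
Implicit Types (f g h : R -> R) (a b x y : R) (s : seq R).

Definition node s (j : nat) : R := nth 0 (0 :: s) j.

(** Ramps weighted by nodal increments replace the usual hat functions: the interpolant and its
    derivative then share their coefficients, and pairing [g'] with one step of [dinterp] is a
    difference quotient of [g]. *)
Definition interp s f x : R :=
  f 0 + \sum_(j < size s) (f (node s j.+1) - f (node s j)) * ramp (node s j) (node s j.+1) x.

Definition dinterp s f x : R :=
  \sum_(j < size s) (f (node s j.+1) - f (node s j)) * dramp (node s j) (node s j.+1) x.

Section Partition.
Variable s : seq R.
Hypothesis sP : itv_partition 0 1 s.

Lemma node_lt j : (j < size s)%N -> node s j < node s j.+1.
Proof. by case: sP => /(pathP 0) h _ js; exact: h. Qed.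

Lemma node_le i j : (i <= j)%N -> (j <= size s)%N -> node s i <= node s j.
Proof.
elim: j => [|j IH]; first by rewrite leqn0 => /eqP ->.
rewrite leq_eqVlt => /predU1P[->//|ij] js.
by rewrite (le_trans (IH _ (ltnW js)))// ltW// node_lt.
Qed.

Lemma node_size : node s (size s) = 1.
Proof.
case: sP => _ /eqP <-; rewrite /node; case: (s) => //= x t.
by rewrite -[LHS]/(nth 0 (x :: t) (size t)) nth_last.
Qed.

Lemma partition_size_gt0 : (0 < size s)%N.
Proof.
rewrite lt0n; apply/eqP => s0; have := node_size; rewrite s0 /node/= => /esym/eqP.
by rewrite oner_eq0.
Qed.

Lemma node_I01 j : (j <= size s)%N -> node s j \in `[0, 1].
Proof.
move=> js; rewrite in_itv/=; apply/andP; split; last by rewrite -node_size node_le.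
by rewrite -[0]/(node s 0) node_le.
Qed.

Lemma node_bounds j : (j < size s)%N ->
  [/\ 0 <= node s j, node s j < node s j.+1 & node s j.+1 <= 1].
Proof.
move=> js; split; last 1 first.
- by have := node_I01 js; rewrite in_itv => /andP[].
- by have := node_I01 (ltnW js); rewrite in_itv => /andP[].
- exact: node_lt.
Qed.

Lemma node_locate x : x \in `[0, 1] ->
  exists2 j, (j < size s)%N & node s j <= x <= node s j.+1.
Proof.
rewrite in_itv/= => /andP[x0 x1].
suff H n : (n <= size s)%N -> x <= node s n -> (0 < n)%N ->
    exists2 j, (j < size s)%N & node s j <= x <= node s j.+1.
  apply: (H (size s)) => //; first by rewrite node_size.
  exact: partition_size_gt0.
elim: n => [//|n IH] ns xn _.
have [xn'|xn'] := leP (node s n) x; first by exists n; rewrite // xn' xn.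
apply: IH => //; [exact: ltnW|exact: ltW|].
rewrite lt0n; apply/eqP => n0; move: xn'; rewrite n0 /node/=; lra.
Qed.

Lemma mesh_ge j : (j < size s)%N -> node s j.+1 - node s j <= mesh_size s.
Proof.
move=> js; rewrite /mesh_size.
exact: (le_bigmax 0 (fun j : 'I_(size s) => node s j.+1 - node s j) (Ordinal js)).
Qed.

Lemma mesh_ge0 : 0 <= mesh_size s.
Proof. by rewrite /mesh_size; apply: bigmax_ge_id. Qed.

Lemma mesh_le1 : mesh_size s <= 1.
Proof.
rewrite /mesh_size; apply: bigmax_le => // j _.
by have [a0 ab b1] := node_bounds (ltn_ord j); rewrite -!/(node s _); lra.
Qed.

Lemma H1_interp f : H1 (interp s f) (dinterp s f).
Proof.
have H n : (n <= size s)%N -> H1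
    (fun x => f 0 + \sum_(j < n) (f (node s j.+1) - f (node s j)) * ramp (node s j) (node s j.+1) x)
    (fun x => \sum_(j < n) (f (node s j.+1) - f (node s j)) * dramp (node s j) (node s j.+1) x).
  elim: n => [_|n IH ns].
    have -> : (fun x : R => \sum_(j < 0) (f (node s j.+1) - f (node s j)) *
        dramp (node s j) (node s j.+1) x) = (fun=> 0).
      by apply/funext => x; rewrite big_ord0.
    by apply: eq_H1 (H1_cst (f 0)) => x _; rewrite big_ord0 addr0.
  have [a0 ab b1] := node_bounds ns.
  have := H1D (IH (ltnW ns)) (H1Z (f (node s n.+1) - f (node s n)) (H1_ramp a0 ab b1)).
  have -> : (fun x : R => \sum_(j < n.+1) (f (node s j.+1) - f (node s j)) *
        dramp (node s j) (node s j.+1) x) =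
      (fun x => (\sum_(j < n) (f (node s j.+1) - f (node s j)) *
        dramp (node s j) (node s j.+1) x) +
        (f (node s n.+1) - f (node s n)) * dramp (node s n) (node s n.+1) x).
    by apply/funext => x; rewrite big_ord_recr.
  by apply: eq_H1 => x _; rewrite big_ord_recr /= addrA.
exact: H.
Qed.

Lemma interp_local f k x : (k < size s)%N -> node s k <= x <= node s k.+1 ->
  interp s f x = f (node s k) + (f (node s k.+1) - f (node s k)) *
    ((x - node s k) / (node s k.+1 - node s k)).
Proof.
move=> ks /andP[kx xk]; rewrite /interp.
set G := fun j : nat => (f (node s j.+1) - f (node s j)) * ramp (node s j) (node s j.+1) x.
rewrite -[\sum_(_ < _) _]/(\sum_(j < size s) G j).
(* Ramps to the left of the cell equal 1 at [x] and their increments telescope; those to the right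
   vanish there. *)
have low n : (n <= k)%N -> f 0 + \sum_(j < n) G j = f (node s n).
  elim: n => [_|n IH nk]; first by rewrite big_ord0 addr0.
  rewrite big_ord_recr/= addrA (IH (ltnW nk)) /G ramp_ge ?mulr1 ?subrKC//.
    by rewrite node_lt// (leq_trans nk)// ltnW.
  by apply: le_trans kx; rewrite node_le// ltnW.
have high n : (k < n)%N -> (n <= size s)%N -> f 0 + \sum_(j < n) G j = f (node s k) + G k.
  elim: n => // n IH; rewrite ltnS leq_eqVlt => /predU1P[<- _|kn ns].
    by rewrite big_ord_recr/= addrA low.
  rewrite big_ord_recr/= addrA (IH kn (ltnW ns)) [X in _ + X = _]/G ramp_le ?mulr0 ?addr0//.
    exact: node_lt.
  by rewrite (le_trans xk)// node_le// ltnW.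
by rewrite high// /G ramp_mid// node_lt.
Qed.

Lemma interp_node f k : (k <= size s)%N -> interp s f (node s k) = f (node s k).
Proof.
case: k => [|k] ks.
  rewrite (@interp_local f 0); first by rewrite -[node s 0]/0 subrr mul0r mulr0 addr0.
    exact: partition_size_gt0.
  by rewrite lexx/= ltW// node_lt// partition_size_gt0.
have [_ ab _] := node_bounds ks.
rewrite (interp_local f ks); first by rewrite divff ?mulr1 ?subrKC//; lra.
by rewrite lexx ltW.
Qed.

Lemma interp0 f : interp s f 0 = f 0.
Proof. by have := @interp_node f 0; apply. Qed.

Lemma interp1 f : interp s f 1 = f 1.
Proof. by have := interp_node f (leqnn (size s)); rewrite node_size. Qed.

Lemma interpB f g x : interp s (fun y => f y - g y) x = interp s f x - interp s g x.
Proof.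
rewrite /interp opprD addrACA -sumrB; congr (_ + _).
by apply: eq_bigr => j _; ring.
Qed.

Lemma dinterpB f g x : dinterp s (fun y => f y - g y) x = dinterp s f x - dinterp s g x.
Proof. by rewrite /dinterp -sumrB; apply: eq_bigr => j _; ring. Qed.

Lemma ip_dinterp f g g' : H1 g g' -> ip g' (dinterp s f) =
  \sum_(j < size s) (f (node s j.+1) - f (node s j)) * (g (node s j.+1) - g (node s j))
    / (node s j.+1 - node s j).
Proof.
move=> H; have Lg := H1_L2d H.
have E n : (n <= size s)%N -> L2 (fun x => \sum_(j < n) (f (node s j.+1) - f (node s j)) *
        dramp (node s j) (node s j.+1) x) /\
   ip g' (fun x => \sum_(j < n) (f (node s j.+1) - f (node s j)) *
        dramp (node s j) (node s j.+1) x) =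
   \sum_(j < n) (f (node s j.+1) - f (node s j)) * (g (node s j.+1) - g (node s j))
    / (node s j.+1 - node s j).
  elim: n => [_|n IH ns].
    have -> : (fun x : R => \sum_(j < 0) (f (node s j.+1) - f (node s j)) *
        dramp (node s j) (node s j.+1) x) = (fun=> 0).
      by apply/funext => x; rewrite big_ord0.
    split; first exact: L2_cst.
    rewrite big_ord0 -[RHS](mul0r (ip g' (fun=> 0))) -ipZr//; last exact: L2_cst.
    by congr ip; apply/funext => x; rewrite mul0r.
  have [L IHn] := IH (ltnW ns).
  have -> : (fun x : R => \sum_(j < n.+1) (f (node s j.+1) - f (node s j)) *
        dramp (node s j) (node s j.+1) x) =
      (fun x => (\sum_(j < n) (f (node s j.+1) - f (node s j)) *
        dramp (node s j) (node s j.+1) x) +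
        (f (node s n.+1) - f (node s n)) * dramp (node s n) (node s n.+1) x).
    by apply/funext => x; rewrite big_ord_recr.
  have [a0 ab b1] := node_bounds ns.
  have Ld := L2_dramp (node s n) (node s n.+1).
  split; first by apply: L2D => //; exact: L2Z.
  rewrite ipDr//; last exact: L2Z.
  by rewrite ipZr// (ip_dramp H)// IHn big_ord_recr/= mulrA.
by have [] := E (size s) (leqnn _).
Qed.

(** A step function sees [g'] only through the nodal increments of [g], which [interp s g] shares.
    This is the orthogonality of the derivative of the interpolation error to the derivatives of
    finite element functions. *)
Lemma ip_dinterp_interp f g g' : H1 g g' ->
  ip g' (dinterp s f) = ip (dinterp s g) (dinterp s f).
Proof.
move=> H; rewrite (ip_dinterp _ H) (ip_dinterp _ (H1_interp g)).
by apply: eq_bigr => j _; rewrite !interp_node// ltnW.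
Qed.

Lemma continuous_interp f : continuous (interp s f).
Proof.
rewrite /interp; elim: (size s) => [|n IH] x.
  under eq_fun do rewrite big_ord0; exact: cvg_cst.
under eq_fun do rewrite big_ord_recr/= addrA.
apply: cvgD; first exact: IH.
by apply: cvgM; [exact: cvg_cst|exact: continuous_ramp].
Qed.

Lemma Vh_interp f : Vh s (interp s f).
Proof.
split; first by apply: continuous_subspaceT; exact: continuous_interp.
move=> j js; pose a := (f (node s j.+1) - f (node s j)) / (node s j.+1 - node s j).
exists a, (f (node s j) - a * node s j) => x; rewrite in_itv/= => /andP[x1 x2].
by rewrite (interp_local f js) ?(ltW x1) ?(ltW x2)// /a; ring.
Qed.

End Partition.
End Interpolation.

(** * Finite element functions depending on time *)

Section TimeDependence.
Context {R : realType}.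
Implicit Types (f g h : R -> R) (a b x y : R) (s : seq R).

Lemma within_continuousP (A : set R) f : {within A, continuous f} <->
  forall x, A x -> forall e : R, 0 < e ->
    exists2 d : R, 0 < d & forall y, A y -> `|x - y| < d -> `|f x - f y| < e.
Proof.
split=> [/subspace_continuousP cf x Ax e e0|H].
  have /cvgrPdist_lt /(_ e e0) := cf x Ax.
  rewrite near_withinE => /nbhs_ballP[d d0 hd]; exists d => // y Ay xy.
  exact: hd.
apply/subspace_continuousP => x Ax; apply/cvgrPdist_lt => e e0.
have [d d0 hd] := H x Ax e e0.
rewrite near_withinE; apply/nbhs_ballP; exists d => // y xy Ay; exact: hd.
Qed.

(** Membership in V_h gives an affine formula on open cells only; continuity carries it to the
    nodes. *)
Lemma Vh_interpE s f x : itv_partition 0 1 s -> Vh s f -> x \in `[0, 1] ->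
  f x = interp s f x.
Proof.
move=> sP [/within_continuousP cf af] xI.
have [k ks kx] := node_locate sP xI.
have [a0 ab b1] := node_bounds sP ks.
have [p [q pq]] := af _ ks.
set a := node s k in a0 ab kx *; set b := node s k.+1 in ab b1 kx *.
have Ic y : y \in `[a, b] -> y \in `[0, 1].
  by rewrite !in_itv/= => /andP[? ?]; apply/andP; split; lra.
have ext c : c \in `[a, b] -> f c = p * c + q.
  rewrite in_itv/= => /andP[ac cb].
  have cI : c \in `[0, 1] by apply: Ic; rewrite in_itv/= ac.
  apply/eqP; rewrite -subr_eq0 -normr_eq0 eq_le normr_ge0 andbT.
  apply/ler_addgt0Pr => e e0; rewrite add0r.
  have e20 : 0 < e / 2 by rewrite divr_gt0.
  have [d d0 hd] := cf c cI _ e20.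
  have p0 : 0 < `|p| + 1 by have := normr_ge0 p; lra.
  pose d' := Num.min d (Num.min (e / (2 * (`|p| + 1))) (b - a)).
  have d'0 : 0 < d'.
    by rewrite !lt_min d0/= divr_gt0 ?mulr_gt0//= subr_gt0.
  have [d'd d'e d'b] : [/\ d' <= d, d' <= e / (2 * (`|p| + 1)) & d' <= b - a].
    by split; rewrite /d' !ge_min lexx ?orbT.
  (* Since [d'] is at most the length of the cell, [c + d' / 3] or [c - d' / 3] lies in its
     interior. *)
  have [y [yab yc]] : exists y, a < y < b /\ `|c - y| < d'.
    have [h|h] := ltP (c + d' / 3) b.
      exists (c + d' / 3); split; first by rewrite h andbT; lra.
      by rewrite opprD addrA subrr add0r normrN gtr0_norm; lra.
    exists (c - d' / 3); split; first by apply/andP; split; lra.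
    by rewrite opprB addrCA subrr addr0 gtr0_norm; lra.
  have yI : y \in `[0, 1] by apply: Ic; rewrite in_itv/=; case/andP: yab => /ltW -> /ltW ->.
  have h1 := hd y yI (lt_le_trans yc d'd).
  have h2 : f y = p * y + q by apply: pq; rewrite in_itv.
  have h3 : `|p * (y - c)| <= e / 2.
    rewrite normrM distrC.
    have : `|c - y| * (2 * (`|p| + 1)) <= e.
      by rewrite -ler_pdivlMr ?mulr_gt0//; apply: le_trans d'e; exact: ltW.
    have := normr_ge0 p; have := normr_ge0 (c - y); nra.
  rewrite (_ : f c - _ = (f c - f y) + p * (y - c)); last by rewrite h2; ring.
  apply: (le_trans (ler_normD _ _)); lra.
rewrite (interp_local sP f ks kx) -/a -/b.
have [ax xb] := andP kx.
rewrite (ext x) ?in_itv/= ?ax ?xb// (ext a) ?in_itv/= ?lexx ?(ltW ab)//.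
rewrite (ext b) ?in_itv/= ?lexx ?(ltW ab)//.
by field; lra.
Qed.

Section Nodal.
Variable s : seq R.
Hypothesis sP : itv_partition 0 1 s.

(** Such functionals depend on finitely many nodal values, so limits and derivatives in time pass
    through them by algebra, without differentiating under an integral. *)
Definition nodal_linear (Phi : (R -> R) -> R) := exists (c0 : R) (c : nat -> R),
  forall f, Phi f = f 0 * c0 + \sum_(j < size s) (f (node s j.+1) - f (node s j)) * c j.

Definition nodal_bilinear (Psi : (R -> R) -> (R -> R) -> R) :=
  exists (P0 : (R -> R) -> R) (P : nat -> (R -> R) -> R),
  [/\ nodal_linear P0, forall j, nodal_linear (P j) & forall f g,
    Psi f g = f 0 * P0 g + \sum_(j < size s) (f (node s j.+1) - f (node s j)) * P j g].

Lemma cvg_sumn (T : Type) (F : set_system T) {FF : Filter F} n (u : nat -> T -> R)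
    (l : nat -> R) : (forall j, (j < n)%N -> u j @ F --> l j) ->
  (fun t => \sum_(j < n) u j t) @ F --> \sum_(j < n) l j.
Proof.
elim: n => [_|n IH H].
  under eq_fun do rewrite big_ord0; rewrite big_ord0; exact: cvg_cst.
under eq_fun do rewrite big_ord_recr/=; rewrite big_ord_recr/=.
by apply: cvgD; [apply: IH => j jn; apply: H; exact: ltnW|exact: H].
Qed.

Lemma is_derive_sumn n (u : nat -> R -> R) (l : nat -> R) (t : R) :
  (forall j, (j < n)%N -> is_derive t 1 (u j) (l j)) ->
  is_derive t 1 (fun t => \sum_(j < n) u j t) (\sum_(j < n) l j).
Proof.
elim: n => [_|n IH H].
  under eq_fun do rewrite big_ord0; rewrite big_ord0; exact: is_derive_cst.
under eq_fun do rewrite big_ord_recr/=; rewrite big_ord_recr/=.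
by apply: is_deriveD; [apply: IH => j jn; apply: H; exact: ltnW|exact: H].
Qed.

Lemma nodal_linear_cvg Phi (T : Type) (F : set_system T) {FF : Filter F}
    (z : T -> R -> R) (z0 : R -> R) : nodal_linear Phi ->
  (forall j, (j <= size s)%N -> (fun t => z t (node s j)) @ F --> z0 (node s j)) ->
  (fun t => Phi (z t)) @ F --> Phi z0.
Proof.
move=> [c0 [c E]] H; under eq_fun do rewrite E; rewrite E.
apply: cvgD; first by apply: cvgMl; exact: (H 0).
apply: (@cvg_sumn _ _ _ _ (fun j t => (z t (node s j.+1) - z t (node s j)) * c j)
  (fun j => (z0 (node s j.+1) - z0 (node s j)) * c j)) => j js.
by apply: cvgMl; apply: cvgB; apply: H => //; exact: ltnW.
Qed.

Lemma nodal_bilinear_cvg Psi (T : Type) (F : set_system T) {FF : Filter F}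
    (z y : T -> R -> R) (z0 y0 : R -> R) : nodal_bilinear Psi ->
  (forall j, (j <= size s)%N -> (fun t => z t (node s j)) @ F --> z0 (node s j)) ->
  (forall j, (j <= size s)%N -> (fun t => y t (node s j)) @ F --> y0 (node s j)) ->
  (fun t => Psi (z t) (y t)) @ F --> Psi z0 y0.
Proof.
move=> [P0 [P [L0 L E]]] Hz Hy; under eq_fun do rewrite E; rewrite E.
apply: cvgD; first by apply: cvgM; [exact: (Hz 0)|exact: nodal_linear_cvg].
apply: (@cvg_sumn _ _ _ _ (fun j t => (z t (node s j.+1) - z t (node s j)) * P j (y t))
  (fun j => (z0 (node s j.+1) - z0 (node s j)) * P j y0)) => j js.
apply: cvgM; last exact: nodal_linear_cvg.
by apply: cvgB; apply: Hz => //; exact: ltnW.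
Qed.

Lemma is_derive_mul (u v : R -> R) (u' v' t : R) : is_derive t 1 u u' -> is_derive t 1 v v' ->
  is_derive t 1 (fun t => u t * v t) (u' * v t + u t * v').
Proof.
by move=> hu hv; have := is_deriveM hu hv; rewrite /GRing.scale/= addrC (mulrC u').
Qed.

Lemma nodal_linear_derive Phi (z : R -> R -> R) (z' : R -> R) (t : R) : nodal_linear Phi ->
  (forall j, (j <= size s)%N -> is_derive t 1 (fun t => z t (node s j)) (z' (node s j))) ->
  is_derive t 1 (fun t => Phi (z t)) (Phi z').
Proof.
move=> [c0 [c E]] H; under eq_fun do rewrite E; rewrite E.
have Hm (u : R -> R) u' k : is_derive t 1 u u' -> is_derive t 1 (fun t => u t * k) (u' * k).
  move=> hu; have := is_deriveZ k hu; rewrite /GRing.scale/= mulrC.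
  by under eq_fun do rewrite mulrC.
apply: is_deriveD; first by apply: Hm; exact: (H 0).
apply: (@is_derive_sumn _ (fun j t => (z t (node s j.+1) - z t (node s j)) * c j)
  (fun j => (z' (node s j.+1) - z' (node s j)) * c j)) => j js.
by apply: Hm; apply: is_deriveB; apply: H => //; exact: ltnW.
Qed.

Lemma nodal_bilinear_derive Psi (z y : R -> R -> R) (z' y' : R -> R) (t : R) : nodal_bilinear Psi ->
  (forall j, (j <= size s)%N -> is_derive t 1 (fun t => z t (node s j)) (z' (node s j))) ->
  (forall j, (j <= size s)%N -> is_derive t 1 (fun t => y t (node s j)) (y' (node s j))) ->
  is_derive t 1 (fun t => Psi (z t) (y t)) (Psi z' (y t) + Psi (z t) y').
Proof.
move=> [P0 [P [L0 L E]]] Hz Hy; under eq_fun do rewrite E; rewrite !E.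
rewrite addrACA -big_split/=.
apply: is_deriveD; first by apply: is_derive_mul; [exact: (Hz 0)|exact: nodal_linear_derive].
apply: (@is_derive_sumn _ (fun j t => (z t (node s j.+1) - z t (node s j)) * P j (y t))
  (fun j => (z' (node s j.+1) - z' (node s j)) * P j (y t) +
            (z t (node s j.+1) - z t (node s j)) * P j y')) => j js.
apply: is_derive_mul; last exact: nodal_linear_derive.
by apply: is_deriveB; apply: Hz => //; exact: ltnW.
Qed.

Lemma L2_interp f : L2 (interp s f).
Proof. exact: H1_L2 (H1_interp sP f). Qed.

Lemma L2_dinterp f : L2 (dinterp s f).
Proof. exact: H1_L2d (H1_interp sP f). Qed.

Lemma ip_suml n (u : nat -> R -> R) (k : nat -> R) h : (forall j, (j < n)%N -> L2 (u j)) ->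
  L2 h -> L2 (fun x => \sum_(j < n) k j * u j x) /\
  ip (fun x => \sum_(j < n) k j * u j x) h = \sum_(j < n) k j * ip (u j) h.
Proof.
move=> + Lh; elim: n => [_|n IH H].
  have -> : (fun x => \sum_(j < 0) k j * u j x) = (fun=> 0).
    by apply/funext => x; rewrite big_ord0.
  split; first exact: L2_cst.
  rewrite big_ord0 -[RHS](mul0r (ip (fun=> 0) h)) -ipZl//; last exact: L2_cst.
  by congr ip; apply/funext => x; rewrite mul0r.
have [L E] := IH (fun j jn => H j (ltnW jn)).
have -> : (fun x => \sum_(j < n.+1) k j * u j x) =
    (fun x => \sum_(j < n) k j * u j x + k n * u n x).
  by apply/funext => x; rewrite big_ord_recr.
have Ln := H n (ltnSn n).
split; first by apply: L2D => //; exact: L2Z.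
by rewrite ipDl// ?ipZl// ?E ?big_ord_recr//; exact: L2Z.
Qed.

Lemma L2_ramp j : (j < size s)%N -> L2 (ramp (node s j) (node s j.+1)).
Proof. by move=> /(node_bounds sP)[a0 ab b1]; exact: H1_L2 (H1_ramp a0 ab b1). Qed.

Lemma ip_interpl f h : L2 h -> ip (interp s f) h = f 0 * ip (fun=> 1) h +
  \sum_(j < size s) (f (node s j.+1) - f (node s j)) * ip (ramp (node s j) (node s j.+1)) h.
Proof.
move=> Lh.
have [L <-] := @ip_suml (size s) (fun j => ramp (node s j) (node s j.+1))
  (fun j => f (node s j.+1) - f (node s j)) h L2_ramp Lh.
rewrite -ipZl//; last exact: L2_cst.
rewrite -ipDl//; first by apply: eq_Rintegral => x _; rewrite mulr1.
exact: L2_cst.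
Qed.

Lemma ip_dinterpl f h : L2 h -> ip (dinterp s f) h =
  \sum_(j < size s) (f (node s j.+1) - f (node s j)) * ip (dramp (node s j) (node s j.+1)) h.
Proof.
move=> Lh.
by have [L <-] := @ip_suml (size s) (fun j => dramp (node s j) (node s j.+1))
  (fun j => f (node s j.+1) - f (node s j)) h (fun j _ => L2_dramp _ _) Lh.
Qed.

Lemma nodal_linear_interp h : L2 h -> nodal_linear (fun f => ip (interp s f) h).
Proof.
move=> Lh; exists (ip (fun=> 1) h), (fun j => ip (ramp (node s j) (node s j.+1)) h) => f.
exact: ip_interpl.
Qed.

Lemma nodal_linear_dinterp h : L2 h -> nodal_linear (fun f => ip (dinterp s f) h).
Proof.
move=> Lh; exists 0, (fun j => ip (dramp (node s j) (node s j.+1)) h) => f.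
by rewrite mulr0 add0r ip_dinterpl.
Qed.

Lemma nodal_bilinear_interp : nodal_bilinear (fun f g => ip (interp s f) (interp s g)).
Proof.
exists (fun g => ip (interp s g) (fun=> 1)).
(* Linearity of the coefficients is required at every index, so the value 0 is taken where there is
   no cell. *)
exists (fun j g => if (j < size s)%N then ip (interp s g) (ramp (node s j) (node s j.+1)) else 0).
split; first exact: nodal_linear_interp (L2_cst 1).
  move=> j; have [js|js] := ltnP j (size s); first by apply: nodal_linear_interp; exact: L2_ramp.
  by exists 0, (fun=> 0) => f; rewrite big1 ?mulr0 ?addr0// => i _; rewrite mulr0.
move=> f g; rewrite ip_interpl; last exact: L2_interp.
by rewrite ipC; congr (_ + _); apply: eq_bigr => j _; rewrite ltn_ord ipC.
Qed.

Lemma nodal_bilinear_dinterp : nodal_bilinear (fun f g => ip (dinterp s f) (dinterp s g)).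
Proof.
exists (fun g => 0), (fun j g => ip (dinterp s g) (dramp (node s j) (node s j.+1))).
split; first by exists 0, (fun=> 0) => f; rewrite big1 ?mulr0 ?addr0// => i _; rewrite mulr0.
  by move=> j; apply: nodal_linear_dinterp; exact: L2_dramp.
move=> f g; rewrite mulr0 add0r ip_dinterpl; last exact: L2_dinterp.
by apply: eq_bigr => j _; rewrite ipC.
Qed.

Lemma nodal_bilinear_convection chi chi' : H1 chi chi' ->
  nodal_bilinear (fun f g => ip (fun x => interp s f x * dinterp s g x) chi).
Proof.
move=> H.
have Lc g : L2 (fun x => dinterp s g x * chi x).
  by apply: eq_L2 (H1_mulL2 H (L2_dinterp g)) => x _; rewrite mulrC.
have Lr j : (j < size s)%N -> L2 (fun x => ramp (node s j) (node s j.+1) x * chi x).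
  by move=> /(node_bounds sP)[a0 ab b1]; exact: H1_mulL2 (H1_ramp a0 ab b1) (H1_L2 H).
exists (fun g => ip (dinterp s g) chi).
exists (fun j g => if (j < size s)%N then
  ip (dinterp s g) (fun x => ramp (node s j) (node s j.+1) x * chi x) else 0).
split; first exact: nodal_linear_dinterp (H1_L2 H).
  move=> j; have [js|js] := ltnP j (size s); first by apply: nodal_linear_dinterp; exact: Lr.
  by exists 0, (fun=> 0) => f; rewrite big1 ?mulr0 ?addr0// => i _; rewrite mulr0.
move=> f g; rewrite ip_moveM ip_interpl//; congr (_ + _).
  by congr (_ * _); apply: eq_Rintegral => x _; rewrite mul1r.
apply: eq_bigr => j _; rewrite ltn_ord; congr (_ * _).
by apply: eq_Rintegral => x _; ring.
Qed.

End Nodal.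
End TimeDependence.

Ltac pos := repeat match goal with
  | |- is_true (0 <= _) => first
    [ assumption | (apply: ltW; assumption) | exact: ler01 | exact: ler0n
    | exact: sqr_ge0 | exact: normr_ge0 | apply: addr_ge0 | apply: mulr_ge0
    | rewrite invr_ge0 | apply: exprn_ge0 ]
  end.

(** * The variational equation at a fixed time *)

Section WeakForm.
Context {R : realType}.
Implicit Types (f g h : R -> R) (a b x y : R).
Variables (mu nu wd : R) (c : 'I_2 -> R).
Hypotheses (mu_gt0 : 0 < mu) (nu_gt0 : 0 < nu) (wd_ge0 : 0 <= wd).
Hypothesis c_gt0 : forall i, 0 < c i.

Let m := mu / nu.
Let k i := 1 + c i + wd.
Let g i := (9 * c i)^-1.

Lemma sum_ord2 (F : 'I_2 -> R) : \sum_(i < 2) F i = F ord0 + F ord_max.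
Proof. by rewrite big_ord_recl big_ord1; congr (_ + F _); exact/val_inj. Qed.

(** This is [nu * u_x + mu * u_xt] at the endpoint [i], taken with the sign of the inward
    derivative, after insertion of the feedback law. *)
Definition boundary_term i (u ut : R) : R :=
  k i * u + 2 * g i * u ^+ 3 + m * (k i * ut + 6 * g i * (u ^+ 2 * ut)).

Lemma weak_formE u ux ut uxt chi chix :
  weak_form mu nu wd c u ux ut uxt chi chix =
  ip ut chi + mu * ip uxt chix + nu * ip ux chix + (1 + wd) * ip ux chi
  + ip (fun x => u x * ux x) chi
  + boundary_term ord0 (u 0) (ut 0) * chi 0
  + boundary_term ord_max (u 1) (ut 1) * chi 1.
Proof.
rewrite /weak_form !sum_ord2/= /boundary_term /k /g /m.
have := c_gt0 ord0; have := c_gt0 ord_max; have := nu_gt0.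
by move=> h1 h2 h3; field; rewrite !lt0r_neq0.
Qed.

(** Moving the derivative of the convection terms onto [chi] leaves only [u] and [u ^+ 2] in them,
    so that sup norms of [u] control them. *)
Lemma weak_formE_parts u ux ut uxt chi chix : H1 u ux -> H1 chi chix ->
  weak_form mu nu wd c u ux ut uxt chi chix =
  ip ut chi + mu * ip uxt chix + nu * ip ux chix
  + (1 + wd) * (u 1 * chi 1 - u 0 * chi 0 - ip u chix)
  + 2^-1 * (u 1 ^+ 2 * chi 1 - u 0 ^+ 2 * chi 0 - ip (fun x => u x ^+ 2) chix)
  + boundary_term ord0 (u 0) (ut 0) * chi 0
  + boundary_term ord_max (u 1) (ut 1) * chi 1.
Proof.
move=> Hu Hc; rewrite weak_formE.
have <- := ip_parts Hu Hc; rewrite addrK.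
have -> : u 1 ^+ 2 * chi 1 - u 0 ^+ 2 * chi 0 - ip (fun x => u x ^+ 2) chix =
    2 * ip (fun x => u x * ux x) chi.
  rewrite !expr2 -(ip_parts (H1M Hu Hu) Hc).
  have -> : ip (fun x => u x ^+ 2) chix = ip (fun x => u x * u x) chix by [].
  rewrite addrK -ipZl//; [|exact: H1_mulL2 Hu (H1_L2d Hu)|exact: H1_L2 Hc].
  by apply: eq_Rintegral => x _; ring.
by field.
Qed.

Lemma le_sqr1D (y : R) : 0 <= y -> y <= (y + 1) ^+ 2.
Proof. by move=> y0; nra. Qed.

Lemma young_le (q p d : R) : 0 < q -> d * p <= q / 2 * p ^+ 2 + d ^+ 2 / (2 * q).
Proof.
move=> q0; rewrite -subr_ge0.
have -> : q / 2 * p ^+ 2 + d ^+ 2 / (2 * q) - d * p = (q * p - d) ^+ 2 / (2 * q).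
  by field; exact: lt0r_neq0.
by rewrite divr_ge0 ?sqr_ge0// mulr_ge0// ltW.
Qed.

Lemma k_gt0 i : 0 < k i.
Proof. by have wd0 := wd_ge0; have := c_gt0 i; rewrite /k; lra. Qed.

Lemma g_gt0 i : 0 < g i.
Proof. by rewrite invr_gt0 mulr_gt0. Qed.

Lemma m_gt0 : 0 < m.
Proof. exact: divr_gt0. Qed.

Lemma normM_le (x y p q : R) : `|x| <= p -> `|y| <= q -> `|x * y| <= p * q.
Proof. by move=> xp yq; rewrite normrM ler_pM. Qed.

(** Substituting [ut = p - m^-1 * (u - v) + vt] turns the linear boundary terms into [m * k i * p];
    the nonlinear term quadratic in [p] has a good sign, and the rest is O(d) times [p]. The factor
    [s] carries the sign of the convective flux at the endpoint. *)
Lemma boundary_diff_bound (M : R) i : exists2 K : R, 0 <= K &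
  forall u ut v vt d p : R, `|u| <= M -> `|v| <= M -> `|vt| <= M ->
  `|u - v| <= d -> p = (ut - vt) + m^-1 * (u - v) ->
  forall s : R, `|s| <= 1 ->
  m * k i * p ^+ 2 - K * d * `|p| <=
    (boundary_term i u ut - boundary_term i v vt
      + s * ((1 + wd) * (u - v) + 2^-1 * (u ^+ 2 - v ^+ 2))) * p.
Proof.
have k0 := k_gt0 i; have g0 := g_gt0 i; have m0 := m_gt0; have wd0 := wd_ge0.
have [M0|M0] := ltP M 0.
  exists 0 => // u ut v vt d p uM; have := normr_ge0 u; lra.
pose K := 2 * g i * (3 * M ^+ 2) + 6 * g i * M ^+ 2 + 6 * m * g i * (2 * M ^+ 2)
  + (1 + wd) + M.
have K0 : 0 <= K.
  by rewrite /K; pos.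
exists K => // u ut v vt d p uM vM vtM uvd pE s s1.
pose e := u - v.
have d0 : 0 <= d by exact: le_trans uvd.
have E2 : `|u ^+ 2 - v ^+ 2| <= 2 * M * d.
  rewrite (_ : _ - _ = (u + v) * e); last by rewrite /e; ring.
  by apply: normM_le => //; have := ler_normD u v; lra.
have E3 : `|u ^+ 3 - v ^+ 3| <= 3 * M ^+ 2 * d.
  rewrite (_ : _ - _ = (u * u + u * v + v * v) * e); last by rewrite /e; ring.
  apply: normM_le => //.
  have h1 := normM_le uM uM; have h2 := normM_le uM vM; have h3 := normM_le vM vM.
  have := ler_normD (u * u + u * v) (v * v); have := ler_normD (u * u) (u * v); lra.
have E4 : `|u ^+ 2 * e| <= M ^+ 2 * d by rewrite expr2; apply: normM_le => //; exact: normM_le.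
have E5 : `|(u ^+ 2 - v ^+ 2) * vt| <= 2 * M * d * M by exact: normM_le.
have E1 : `|s * ((1 + wd) * e + 2^-1 * (u ^+ 2 - v ^+ 2))| <= 1 * ((1 + wd) * d + 2^-1 * (2 * M * d)).
  apply: normM_le => //; apply: (le_trans (ler_normD _ _)); apply: lerD; apply: normM_le => //.
    by rewrite ger0_norm//; lra.
  by rewrite ger0_norm//; lra.
pose t := 2 * g i * (u ^+ 3 - v ^+ 3) - 6 * g i * (u ^+ 2 * e)
   + 6 * m * g i * ((u ^+ 2 - v ^+ 2) * vt) + s * ((1 + wd) * e + 2^-1 * (u ^+ 2 - v ^+ 2)).
have tK : `|t| <= K * d.
  have T1 : `|2 * g i * (u ^+ 3 - v ^+ 3)| <= 2 * g i * (3 * M ^+ 2 * d).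
    by apply: normM_le => //; rewrite ger0_norm// mulr_ge0// ltW.
  have T2 : `|6 * g i * (u ^+ 2 * e)| <= 6 * g i * (M ^+ 2 * d).
    by apply: normM_le => //; rewrite ger0_norm// mulr_ge0// ltW.
  have T3 : `|6 * m * g i * ((u ^+ 2 - v ^+ 2) * vt)| <= 6 * m * g i * (2 * M * d * M).
    by apply: normM_le => //; rewrite ger0_norm//; pos.
  rewrite /t; move: T1 T2 T3 E1.
  set t1 := 2 * _ * _; set t2 := 6 * _ * _; set t3 := 6 * _ * _ * _; set t4 := s * _.
  move=> T1 T2 T3 T4.
  have -> : K * d = 2 * g i * (3 * M ^+ 2 * d) + 6 * g i * (M ^+ 2 * d) +
      6 * m * g i * (2 * M * d * M) + 1 * ((1 + wd) * d + 2^-1 * (2 * M * d)).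
    by rewrite /K; field.
  do 2![apply: (le_trans (ler_normD _ _)); apply: lerD => //].
  by apply: (le_trans (ler_normB _ _)); exact: lerD.
have utE : ut = p - m^-1 * e + vt by rewrite pE /e; ring.
have -> : (boundary_term i u ut - boundary_term i v vt
      + s * ((1 + wd) * (u - v) + 2^-1 * (u ^+ 2 - v ^+ 2))) * p =
   m * k i * p ^+ 2 + 6 * m * g i * (u * p) ^+ 2 + t * p.
  by rewrite /boundary_term utE /t /e; field; exact: lt0r_neq0.
have : 0 <= 6 * m * g i * (u * p) ^+ 2 by pos.
have : - (K * d * `|p|) <= t * p.
  by have := normM_le tK (lexx `|p|); rewrite ler_norml => /andP[].
lra.
Qed.

(** Tested with [p = (ut - vt) + m^-1 * (u - v)], the two second order terms combine into
    [mu * ip px px] and the linear boundary terms into [m * k i * p ^+ 2]. For [p] the equation is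
    thus elliptic, with data of order zero in [u - v]; its H^1 estimate and the Sobolev inequality
    give the sup bound. *)
Lemma stationary_stability (M : R) : exists2 C : R, 0 <= C &
  forall u ux ut uxt v vx vt vxt : R -> R,
    H1 u ux -> H1 ut uxt -> H1 v vx -> H1 vt vxt ->
    (forall chi chix, H1 chi chix -> weak_form mu nu wd c u ux ut uxt chi chix = 0) ->
    (forall chi chix, H1 chi chix -> weak_form mu nu wd c v vx vt vxt chi chix = 0) ->
    (forall x, x \in `[0, 1] -> `|u x| <= M) ->
    (forall x, x \in `[0, 1] -> `|v x| <= M) ->
    (forall x, x \in `[0, 1] -> `|vt x| <= M) ->
    forall d : R, (forall x, x \in `[0, 1] -> `|u x - v x| <= d) ->
    forall x, x \in `[0, 1] -> `|ut x - vt x| <= C * d.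
Proof.
have [K0 K00 HK0] := boundary_diff_bound M ord0.
have [K1 K10 HK1] := boundary_diff_bound M ord_max.
have m0 := m_gt0; have mm0 := lt0r_neq0 m0.
have mu0 := mu_gt0; have nu0 := nu_gt0; have wd0 := wd_ge0.
have q0 := mulr_gt0 m0 (k_gt0 ord0); have q1 := mulr_gt0 m0 (k_gt0 ord_max).
have r0 : 0 < m^-1 by rewrite invr_gt0.
pose r := m^-1; rewrite -/r in r0.
(* Young's inequality spends half of [ip p p], a quarter of [mu * ip px px] on each of the two
   convection terms and half of each boundary square; [C1] collects the resulting multiples of
   [d ^+ 2]. *)
pose C1 := r ^+ 2 / 2 + mu / 4 * (2 * (1 + wd) / mu) ^+ 2 + mu / 4 * (2 * M / mu) ^+ 2
  + K0 ^+ 2 / (2 * (m * k ord0)) + K1 ^+ 2 / (2 * (m * k ord_max)).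
have C10 : 0 <= C1.
  by rewrite /C1; pos.
pose C2 := 4 * (2 * C1 + 2 * C1 / mu).
have C20 : 0 <= C2.
  by rewrite /C2; pos.
exists (C2 + 1 + r); first by rewrite !addr_ge0// ltW.
move=> u ux ut uxt v vx vt vxt Hu Hut Hv Hvt wu wv uM vM vtM d uvd x xI.
have d0 : 0 <= d by exact: le_trans (uvd _ I01_0).
pose p y := (ut y - vt y) + r * (u y - v y).
pose px y := (uxt y - vxt y) + r * (ux y - vx y).
have He : H1 (fun y => u y - v y) (fun y => ux y - vx y) by exact: H1B.
have Hp : H1 p px by apply: H1D; [exact: H1B|exact: H1Z].
have := wu p px Hp; have := wv p px Hp.
rewrite (weak_formE_parts _ _ Hu Hp) (weak_formE_parts _ _ Hv Hp) => Ev Eu.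
have [Lu Lv Lut Lvt] : [/\ L2 u, L2 v, L2 ut & L2 vt].
  by split; [exact: H1_L2 Hu|exact: H1_L2 Hv|exact: H1_L2 Hut|exact: H1_L2 Hvt].
have [Lux Lvx Luxt Lvxt] : [/\ L2 ux, L2 vx, L2 uxt & L2 vxt].
  by split; [exact: H1_L2d Hu|exact: H1_L2d Hv|exact: H1_L2d Hut|exact: H1_L2d Hvt].
have Lp := H1_L2 Hp; have Lpx := H1_L2d Hp.
have Le := L2B Lu Lv; have Lex := L2B Lux Lvx.
have Lu2 : L2 (fun y => u y ^+ 2) := H1_mulL2 Hu Lu.
have Lv2 : L2 (fun y => v y ^+ 2) := H1_mulL2 Hv Lv.
have LE := L2B Lu2 Lv2.
have pp : ip p p = ip ut p - ip vt p + r * ip (fun y => u y - v y) p.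
  rewrite {1}/p ipDl//; [|exact: L2B|exact: L2Z].
  by rewrite ipBl// ipZl.
have pxpx : ip px px = ip uxt px - ip vxt px + r * (ip ux px - ip vx px).
  rewrite {1}/px ipDl//; [|exact: L2B|exact: L2Z].
  by rewrite ipBl// ipZl// ipBl.
have eB : ip (fun y => u y - v y) px = ip u px - ip v px by rewrite ipBl.
have EB : ip (fun y => u y ^+ 2 - v y ^+ 2) px =
  ip (fun y => u y ^+ 2) px - ip (fun y => v y ^+ 2) px by rewrite ipBl.
have ee : ip (fun y => u y - v y) (fun y => u y - v y) <= d ^+ 2 by exact: ip_sup.
have EE : ip (fun y => u y ^+ 2 - v y ^+ 2) (fun y => u y ^+ 2 - v y ^+ 2) <= (2 * M * d) ^+ 2.
  apply: ip_sup => // y yI.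
  rewrite (_ : _ - _ = (u y + v y) * (u y - v y)); last by ring.
  apply: normM_le; last exact: uvd.
  by apply: (le_trans (ler_normD _ _)); rewrite mulr_natl mulr2n lerD ?uM ?vM.
have s0 : `|-1 : R| <= 1 by rewrite normrN normr1.
have s1 : `|1 : R| <= 1 by rewrite normr1.
have B0 := HK0 (u 0) (ut 0) (v 0) (vt 0) d (p 0) (uM _ I01_0) (vM _ I01_0) (vtM _ I01_0)
  (uvd _ I01_0) erefl (-1) s0.
have B1 := HK1 (u 1) (ut 1) (v 1) (vt 1) d (p 1) (uM _ I01_1) (vM _ I01_1) (vtM _ I01_1)
  (uvd _ I01_1) erefl 1 s1.
have Y0 := young_le `|p 0| (K0 * d) q0.
have Y1 := young_le `|p 1| (K1 * d) q1.
rewrite real_normK ?num_real// in Y0; rewrite real_normK ?num_real// in Y1.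
have Y2 := young_ip r Le Lp.
have Y3 := young_ip (2 * (1 + wd) / mu) Le Lpx.
have Y4 := young_ip (1 / mu) LE Lpx.
have mur : mu * r = nu by rewrite /r /m invf_div; field; exact: lt0r_neq0.
have A0 := ip_ge0 p; have D0 := ip_ge0 px.
have main : 2^-1 * ip p p + mu / 2 * ip px px <= C1 * d ^+ 2.
  have Y3' : (1 + wd) * ip (fun y => u y - v y) px <=
      mu / 4 * ((2 * (1 + wd) / mu) ^+ 2 * d ^+ 2 + ip px px).
    have -> : (1 + wd) * ip (fun y => u y - v y) px =
       mu / 4 * (2 * (2 * (1 + wd) / mu) * ip (fun y => u y - v y) px).
      by field; exact: lt0r_neq0.
    rewrite ler_wpM2l ?divr_ge0 ?(ltW mu_gt0)//.
    by apply: (le_trans Y3); rewrite lerD2r ler_wpM2l ?sqr_ge0.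
  have Y4' : 2^-1 * ip (fun y => u y ^+ 2 - v y ^+ 2) px <=
      mu / 4 * ((2 * M / mu) ^+ 2 * d ^+ 2 + ip px px).
    have -> : 2^-1 * ip (fun y => u y ^+ 2 - v y ^+ 2) px =
       mu / 4 * (2 * (1 / mu) * ip (fun y => u y ^+ 2 - v y ^+ 2) px).
      by field; exact: lt0r_neq0.
    rewrite ler_wpM2l ?divr_ge0 ?(ltW mu_gt0)//.
    apply: (le_trans Y4); rewrite lerD2r.
    apply: le_trans (ler_wpM2l (sqr_ge0 _) EE) _.
    by rewrite le_eqVlt; apply/orP; left; apply/eqP; field; exact: lt0r_neq0.
  have Y2' : r * ip (fun y => u y - v y) p <= 2^-1 * (r ^+ 2 * d ^+ 2 + ip p p).
    by move: Y2 (ler_wpM2l (sqr_ge0 r) ee); clear; lra.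
  have X0 : (K0 * d) ^+ 2 / (2 * (m * k ord0)) = K0 ^+ 2 / (2 * (m * k ord0)) * d ^+ 2 by ring.
  have X1 : (K1 * d) ^+ 2 / (2 * (m * k ord_max)) = K1 ^+ 2 / (2 * (m * k ord_max)) * d ^+ 2 by ring.
  have P0 : 0 <= m * k ord0 * p 0 ^+ 2 by rewrite mulr_ge0 ?sqr_ge0// ltW.
  have P1 : 0 <= m * k ord_max * p 1 ^+ 2 by rewrite mulr_ge0 ?sqr_ge0// ltW.
  rewrite X0 in Y0; rewrite X1 in Y1.
  have mpx : mu * ip px px = mu * (ip uxt px - ip vxt px) + nu * (ip ux px - ip vx px).
    by rewrite pxpx mulrDr mulrA mur.
  have KD0 : 0 <= K0 * d * `|p 0| by rewrite !mulr_ge0.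
  clear -Eu Ev pp mpx eB EB B0 B1 Y0 Y1 Y2' Y3' Y4' P0 P1.
  rewrite /C1; clear C1.
  move: Eu Ev pp mpx eB EB B0 B1 Y0 Y1 Y2' Y3' Y4' P0 P1.
  set q1 := K0 ^+ 2 / _; set q2 := K1 ^+ 2 / _; set q3 := (_ / mu) ^+ 2; set q4 := (_ / mu) ^+ 2.
  move: q1 q2 q3 q4 (m * k ord0) (m * k ord_max) => q1 q2 q3 q4 mk0 mk1.
  move: (boundary_term ord0 (u 0) (ut 0)) (boundary_term ord0 (v 0) (vt 0)) => b1 b2.
  move: (boundary_term ord_max (u 1) (ut 1)) (boundary_term ord_max (v 1) (vt 1)) => b3 b4.
  move: (ip p p) (ip px px) (ip ut p) (ip vt p) (ip _ p) (ip uxt px) (ip vxt px) (ip ux px) (ip vx px) => A D i1 i2 i3 i4 i5 i6 i7.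
  move: (ip u px) (ip v px) (ip (fun x => u x ^+ 2) px) (ip (fun x => v x ^+ 2) px) (ip (fun y => u y - v y) px) (ip _ px) => j1 j2 j3 j4 j5 j6.
  move: (p 0) (p 1) (u 0) (u 1) (v 0) (v 1) (d ^+ 2) (`|_|) (`|_|) => p0 p1 u0 u1 v0 v1 D2 n0 n1.
  move=> Eu Ev pp mpx eB EB B0 B1 Y0 Y1 Y2' Y3' Y4' P0 P1.
  rewrite eB in Y3'; lra.
have pC : p x ^+ 2 <= C2 * d ^+ 2.
  apply: (le_trans (sobolev Hp xI)).
  rewrite /C2 -mulrA ler_wpM2l// mulrDl; apply: lerD; first by move: main (mulr_ge0 (ltW mu0) D0); clear; lra.
  by rewrite mulrAC ler_pdivlMr//; move: main A0; clear; lra.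
have pd : `|p x| <= (C2 + 1) * d.
  rewrite -ler_sqr ?nnegrE ?mulr_ge0 ?addr_ge0// real_normK ?num_real//.
  apply: (le_trans pC); rewrite exprMn ler_wpM2r ?sqr_ge0//; exact: le_sqr1D.
have -> : ut x - vt x = p x - r * (u x - v x) by rewrite /p; ring.
apply: (le_trans (ler_normB _ _)); rewrite [leRHS]mulrDl lerD//.
by apply: normM_le; [rewrite ger0_norm// ltW|exact: uvd].
Qed.

End WeakForm.

(** * The energy *)

Section Energy.
Context {R : realType}.
Implicit Types (f g h : R -> R) (a b x y : R).
Variables (mu nu wd : R) (c : 'I_2 -> R).
Hypotheses (mu_gt0 : 0 < mu) (nu_gt0 : 0 < nu) (wd_ge0 : 0 <= wd).
Hypothesis c_gt0 : forall i, 0 < c i.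

Let m := mu / nu.
Let k i := 1 + c i + wd.
Let g i := (9 * c i)^-1.

(** The three bounds compare energy with dissipation for the gradient, the quartic boundary terms
    and the quadratic boundary terms respectively. *)
Lemma alpha_max_spec (al := alpha_max mu nu wd c) :
  [/\ 0 < al, 2 * al * (mu + 1) <= nu, 4 * al * m <= 1 &
      forall i, 2 * al * (1 + m * k i) <= k i].
Proof.
have mu0 := mu_gt0; have nu0 := nu_gt0; have wd0 := wd_ge0.
have k0 i : 0 < k i by have := c_gt0 i; rewrite /k; lra.
have d1 : 0 < mu + 1 by lra.
have d2 : 0 < 2 * mu + nu by lra.
have d3 i : 0 < nu + k i * mu by rewrite addr_gt0// mulr_gt0.
pose B := \big[Num.min/(nu / (2 * mu + nu))]_(i < 2)
       (nu * (1 + c i + wd) / (nu + (1 + c i + wd) * mu)).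
have BE : B = Num.min (nu * k ord0 / (nu + k ord0 * mu))
    (Num.min (nu * k ord_max / (nu + k ord_max * mu)) (nu / (2 * mu + nu))).
  rewrite /B big_ord_recl big_ord_recl big_ord0 /k.
  by have -> : lift ord0 ord0 = ord_max :> 'I_2 by exact/val_inj.
have al2 : 2 * al = Num.min (nu / (mu + 1)) B.
  by rewrite /al /alpha_max -/B mulrA divff ?mul1r.
have [b1 b2 b3 b4] : [/\ 2 * al <= nu / (mu + 1), 2 * al <= nu / (2 * mu + nu),
    2 * al <= nu * k ord0 / (nu + k ord0 * mu) &
    2 * al <= nu * k ord_max / (nu + k ord_max * mu)].
  by rewrite al2 BE; split; rewrite !ge_min lexx ?orbT.
split.
- have : 0 < 2 * al.
    rewrite al2 BE !lt_min; apply/and4P; split; rewrite divr_gt0 ?mulr_gt0//.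
  by rewrite pmulr_rgt0.
- by rewrite -ler_pdivlMr.
- move: b2; rewrite ler_pdivlMr// => b2; rewrite /m mulrA ler_pdivrMr// mul1r.
  have al0 : 0 < 2 * al.
    rewrite al2 BE !lt_min; apply/and4P; split; rewrite divr_gt0 ?mulr_gt0//.
  nra.
- move=> i; have E : 2 * al * (nu + k i * mu) <= nu * k i.
    rewrite -ler_pdivlMr//.
    by case: (unliftP ord0 i) => [j|] ->; rewrite ?(ord1 j)//; have -> : lift ord0 ord0 = ord_max :> 'I_2 by exact/val_inj.
  rewrite -(ler_pM2l nu0) (le_trans _ E)// /m.
  by rewrite le_eqVlt; apply/orP; left; apply/eqP; field; exact: lt0r_neq0.
Qed.

Definition energy_node i (B t : R) : R :=
  k i * t ^+ 2 + g i * (3 * t ^+ 4 + 8 * B * t ^+ 3 + 6 * B ^+ 2 * t ^+ 2).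

Definition denergy_node i (B Bt t tt : R) : R :=
  2 * k i * t * tt + g i * (12 * t ^+ 3 * tt + 8 * Bt * t ^+ 3 + 24 * B * t ^+ 2 * tt
    + 12 * B * Bt * t ^+ 2 + 12 * B ^+ 2 * t * tt).

(** The nonquadratic part of the boundary energy is the one whose time derivative
    absorbs the boundary terms [d/dt (v^3 - B^3) * th], with [v = B + th]. *)
Definition energy (B th thx : R -> R) : R :=
  ip th th + mu * ip thx thx
  + m * (energy_node ord0 (B 0) (th 0) + energy_node ord_max (B 1) (th 1)).

Definition denergy (B Bt th thx tht thtx : R -> R) : R :=
  2 * ip tht th + 2 * mu * ip thtx thx
  + m * (denergy_node ord0 (B 0) (Bt 0) (th 0) (tht 0)
         + denergy_node ord_max (B 1) (Bt 1) (th 1) (tht 1)).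

(** What remains at the endpoint once half of [denergy] is taken out of the boundary terms: the
    feedback, the convective flux with outward sign [s], and a remainder proportional to [Bt], the
    only part of the boundary terms with [m] that is not an exact time derivative. *)
Definition node_loss i (s B Bt t : R) : R :=
  k i * t ^+ 2 + 2 * g i * (t ^+ 4 + 3 * B * t ^+ 3 + 3 * B ^+ 2 * t ^+ 2)
  + s * ((1 + wd) / 2 * t ^+ 2 + t ^+ 3 / 3 + B * t ^+ 2)
  + m * (6 * g i * B * Bt * t ^+ 2 + 2 * g i * Bt * t ^+ 3).

Lemma energy_identity B Bx Bt Btx th thx tht thtx :
  H1 B Bx -> H1 Bt Btx -> H1 th thx -> H1 tht thtx ->
  weak_form mu nu wd c (fun x => B x + th x) (fun x => Bx x + thx x)
    (fun x => Bt x + tht x) (fun x => Btx x + thtx x) th thx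
  - weak_form mu nu wd c B Bx Bt Btx th thx =
  2^-1 * denergy B Bt th thx tht thtx + nu * ip thx thx
  - ip (fun x => B x * th x) thx
  + node_loss ord0 (-1) (B 0) (Bt 0) (th 0)
  + node_loss ord_max 1 (B 1) (Bt 1) (th 1).
Proof.
move=> HB HBt Hth Htht.
have mu0 := mu_gt0; have nu0 := nu_gt0.
rewrite (weak_formE_parts mu wd nu_gt0 c_gt0 _ _ (H1D HB Hth) Hth).
rewrite (weak_formE_parts mu wd nu_gt0 c_gt0 _ _ HB Hth).
have [LB Lth LBt Ltht] : [/\ L2 B, L2 th, L2 Bt & L2 tht].
  by split; [exact: H1_L2 HB|exact: H1_L2 Hth|exact: H1_L2 HBt|exact: H1_L2 Htht].
have [LBx Lthx LBtx Lthtx] : [/\ L2 Bx, L2 thx, L2 Btx & L2 thtx].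
  by split; [exact: H1_L2d HB|exact: H1_L2d Hth|exact: H1_L2d HBt|exact: H1_L2d Htht].
rewrite (ipDl LBt Ltht Lth) (ipDl LBtx Lthtx Lthx) (ipDl LBx Lthx Lthx) (ipDl LB Lth Lthx).
have LBB : L2 (fun x => B x ^+ 2) := H1_mulL2 HB LB.
have Ltt : L2 (fun x => th x ^+ 2) := H1_mulL2 Hth Lth.
have LBt2 : L2 (fun x => B x * th x) := H1_mulL2 HB Lth.
have -> : ip (fun x => (B x + th x) ^+ 2) thx =
    ip (fun x => B x ^+ 2) thx + 2 * ip (fun x => B x * th x) thx + ip (fun x => th x ^+ 2) thx.
  rewrite -ipZl// -ipDl//; last exact: L2Z.
  rewrite -ipDl//; last by apply: L2D => //; exact: L2Z.
  by apply: eq_Rintegral => x _; ring.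
have T1 : ip th thx = 2^-1 * (th 1 ^+ 2 - th 0 ^+ 2).
  by have := ip_parts Hth Hth; rewrite (ipC thx); lra.
have T2 : ip (fun x => th x ^+ 2) thx = 3^-1 * (th 1 ^+ 3 - th 0 ^+ 3).
  have := ip_parts (H1M Hth Hth) Hth.
  have -> : ip (fun x => thx x * th x + th x * thx x) th = 2 * ip (fun x => th x ^+ 2) thx.
    by rewrite -ipZl//; apply: eq_Rintegral => x _; ring.
  have -> : ip (fun x => th x * th x) thx = ip (fun x => th x ^+ 2) thx by [].
  lra.
rewrite T1 T2 /denergy /node_loss /denergy_node /boundary_term -/m -/(k _) -/(g _).
rewrite -!/(k _) -!/(g _).
move: (ip _ _) => i1; move: (ip _ _) => i2.
by field.
Qed.

Lemma k_pos i : 0 < k i.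
Proof. exact: k_gt0. Qed.

Lemma g_pos i : 0 < g i.
Proof. exact: g_gt0. Qed.

Lemma m_pos : 0 < m.
Proof. exact: m_gt0. Qed.

(** [A] and [D] stand for the squared norms of a function and its derivative, [s] and [f] for
    squares and fourth powers of its end values. The gradient and quartic terms consume only part of
    what [alpha_max_spec] provides, and for the squares of the end values the constant 2/3 in the
    Poincaré inequality leaves a third of [al] times each of them. *)
Lemma dissipation_gap (al := alpha_max mu nu wd c) : exists2 d, 0 < d &
  forall A D s0 s1 f0 f1 : R, 0 <= A -> 0 <= D -> 0 <= s0 -> 0 <= s1 -> 0 <= f0 -> 0 <= f1 ->
  3 * A <= 2 * (s0 + s1) + 4 * D ->
  al * (A + mu * D + m * (k ord0 * s0 + 3 * g ord0 * f0 + k ord_max * s1 + 3 * g ord_max * f1))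
    + d * (A + D + s0 + f0 + s1 + f1)
  <= nu * D + 2^-1 * (k ord0 * s0 + k ord_max * s1)
     + 3 / 2 * (g ord0 * f0 + g ord_max * f1).
Proof.
have [al0 al1 al2 al3] := alpha_max_spec; rewrite -/al in al0 al1 al2 al3.
have := m_pos; have := g_pos ord0; have := g_pos ord_max.
have := k_pos ord0; have := k_pos ord_max; have := mu_gt0; have := nu_gt0.
have := al3 ord0; have := al3 ord_max; clear al3.
move: (k ord0) (k ord_max) (g ord0) (g ord_max) m al al0 al1 al2.
move=> k0 k1 g0 g1 m' a a0 a1 a2 a3 a4 nu0 mu0 k10 k00 g10 g00 m0.
pose d := Num.min (nu / 4) (Num.min (a / 8) (Num.min (g0 / 2) (g1 / 2))).
have d0 : 0 < d by rewrite !lt_min !divr_gt0.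
have [d1 d2 d3 d4] : [/\ d <= nu / 4, d <= a / 8, d <= g0 / 2 & d <= g1 / 2].
  by rewrite /d; split; rewrite !ge_min lexx ?orbT.
exists d => // A D s0 s1 f0 f1 A0 D0 s00 s10 f00 f10 P.
have h1 := ler_wpM2r D0 a1.
have h2 := ler_wpM2r s00 a4; have h3 := ler_wpM2r s10 a3.
have h4 := ler_wpM2r (mulr_ge0 (ltW g00) f00) a2.
have h5 := ler_wpM2r (mulr_ge0 (ltW g10) f10) a2.
have h6 := ler_wpM2l (ltW a0) P.
have e1 := ler_wpM2r D0 d1; have e2 := ler_wpM2r A0 d2.
have e3 := ler_wpM2r s00 d2; have e4 := ler_wpM2r s10 d2.
have e5 := ler_wpM2r f00 d3; have e6 := ler_wpM2r f10 d4.
have p1 : 0 <= a * mu * D by rewrite !mulr_ge0// ltW.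
have p2 : 0 <= a * s0 by rewrite mulr_ge0// ltW.
have p3 : 0 <= a * s1 by rewrite mulr_ge0// ltW.
have p4 : 0 <= g0 * f0 by rewrite mulr_ge0// ltW.
have p5 : 0 <= g1 * f1 by rewrite mulr_ge0// ltW.
clear -h1 h2 h3 h4 h5 h6 e1 e2 e3 e4 e5 e6 p1 p2 p3 p4 p5; lra.
Qed.

Lemma cube_le (B b t : R) : `|B| <= b -> `|B * t ^+ 3| <= b * (2^-1 * (t ^+ 2 + t ^+ 4)).
Proof.
move=> Bb; apply: normM_le => //.
have h1 := sqr_ge0 (t * (t - 1)); have h2 := sqr_ge0 (t * (t + 1)).
by rewrite ler_norml; apply/andP; split; lra.
Qed.

(** The difference is a multiple of a square for every [B], so the energy is coercive uniformly in
    the state about which the perturbation is taken. *)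
Lemma energy_node_ge i (B t : R) :
  k i * t ^+ 2 + g i / 3 * t ^+ 4 <= energy_node i B t.
Proof.
rewrite -subr_ge0; have -> : energy_node i B t - (k i * t ^+ 2 + g i / 3 * t ^+ 4) =
   g i * (2 / 3 * (t * (2 * t + 3 * B)) ^+ 2) by rewrite /energy_node; field.
by have := g_pos i => g0; pos.
Qed.

Lemma energy_node_le i (M B b t : R) : `|B| <= b -> b <= M ->
  energy_node i B t <= k i * t ^+ 2 + 3 * g i * t ^+ 4
    + b * (g i * (4 + 6 * M)) * (t ^+ 2 + t ^+ 4).
Proof.
move=> Bb bM; have g0 := g_pos i; have b0 : 0 <= b by exact: le_trans Bb.
have := cube_le t Bb; rewrite ler_norml => /andP[_ h1].
have h2 : B ^+ 2 * t ^+ 2 <= b * M * (t ^+ 2 + t ^+ 4).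
  apply: ler_pM; rewrite ?sqr_ge0//.
    rewrite -(real_normK (num_real B)) expr2; apply: ler_pM => //; exact: le_trans bM.
  by rewrite lerDl exprn_even_ge0.
have h3 := ler_wpM2l (ltW g0) h1; have h4 := ler_wpM2l (ltW g0) h2.
rewrite /energy_node; clear -h3 h4; lra.
Qed.

(** The cubic flux [t ^+ 3 / 3] has no sign, but since [9 * c i * g i = 1], half of [c i * t ^+ 2]
    and a quarter of the quartic damping complete it to a square; the coefficient [2 / (9 * c i)] of
    the feedback law is tuned to this. Half of [(1 + wd) * t ^+ 2] pays for the linear flux, and the
    terms containing [B] or [Bt] are nonnegative or O(b). *)
Lemma node_loss_ge i (s M B Bt b t : R) : s = 1 \/ s = -1 -> `|B| <= b -> `|Bt| <= b -> b <= M ->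
  2^-1 * k i * t ^+ 2 + 3 / 2 * g i * t ^+ 4
    - b * (3 * g i + 1 + m * g i * (6 * M + 1)) * (t ^+ 2 + t ^+ 4)
  <= node_loss i s B Bt t.
Proof.
move=> sE Bb Btb bM; have g0 := g_pos i; have m0 := m_pos; have wd0 := wd_ge0.
have b0 : 0 <= b by exact: le_trans Bb.
have t4 : 0 <= t ^+ 4 by exact: exprn_even_ge0.
have t2 := sqr_ge0 t.
have := cube_le t Bb; rewrite ler_norml => /andP[h1 _].
have := cube_le t Btb; rewrite ler_norml => /andP[h2 _].
have h1' := ler_wpM2l (ltW g0) h1.
have mg0 : 0 <= m * g i by pos.
have h2' := ler_wpM2l mg0 h2.
have h3 : 0 <= g i * (B * t) ^+ 2 by pos.
have h4 : `|B * Bt| <= b * M by apply: normM_le => //; exact: le_trans bM.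
have : `|B * Bt * t ^+ 2| <= b * M * (t ^+ 2 + t ^+ 4).
  by apply: normM_le => //; rewrite ger0_norm// lerDl.
rewrite ler_norml => /andP[h5 _]; have h5' := ler_wpM2l mg0 h5.
have h6 : - (b * (t ^+ 2 + t ^+ 4)) <= s * (B * t ^+ 2).
  have : `|B * t ^+ 2| <= b * (t ^+ 2 + t ^+ 4).
    by apply: normM_le => //; rewrite ger0_norm// lerDl.
  by rewrite ler_norml => /andP[? ?]; case: sE => ->; lra.
have gc : 9 * c i * g i = 1 by rewrite /g mulfV// mulf_neq0// lt0r_neq0.
have h7 : 0 <= c i / 2 * t ^+ 2 + g i / 2 * t ^+ 4 + s * (t ^+ 3 / 3).
  have -> : c i / 2 * t ^+ 2 + g i / 2 * t ^+ 4 + s * (t ^+ 3 / 3) =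
     g i / 2 * (t * (3 * c i + s * t)) ^+ 2.
    have -> : g i / 2 * (t * (3 * c i + s * t)) ^+ 2 =
      (9 * c i * g i) * (c i / 2) * t ^+ 2 + (9 * c i * g i) * s / 3 * t ^+ 3
       + g i / 2 * s ^+ 2 * t ^+ 4 by field.
    by rewrite gc; case: sE => ->; field.
  by pos.
have h8 : - ((1 + wd) / 2 * t ^+ 2) <= s * ((1 + wd) / 2 * t ^+ 2).
  have : 0 <= (1 + wd) / 2 * t ^+ 2 by pos.
  by case: sE => ->; lra.
have bt4 := mulr_ge0 (mulr_ge0 b0 (ltW g0)) t4.
have bt2 := mulr_ge0 (mulr_ge0 b0 (ltW g0)) t2.
rewrite /node_loss /k; clear -h1' h2' h3 h5' h6 h7 h8 bt2 bt4; lra.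
Qed.

Lemma ip_le_of_sqr (x A D e : R) : 0 <= A -> 0 <= D -> 0 <= e -> x ^+ 2 <= e ^+ 2 * (A * D) ->
  x <= e / 2 * (A + D).
Proof.
move=> A0 D0 e0 h; rewrite leNgt; apply/negP => h'.
have q0 : 0 <= e / 2 * (A + D) by pos.
have : (e / 2 * (A + D)) ^+ 2 < x ^+ 2.
  by rewrite ltr_pXn2r// nnegrE//; exact: ltW (le_lt_trans q0 h').
have := mulr_ge0 (sqr_ge0 e) (sqr_ge0 (A - D)); lra.
Qed.

Lemma residual_young (r eta Q d : R) : 0 < d -> 0 <= Q -> r ^+ 2 <= eta ^+ 2 * Q ->
  r <= d * Q + eta ^+ 2 / (4 * d).
Proof.
move=> d0 Q0 h; rewrite leNgt; apply/negP => h'.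
have q0 : 0 <= d * Q + eta ^+ 2 / (4 * d) by pos.
have : (d * Q + eta ^+ 2 / (4 * d)) ^+ 2 < r ^+ 2.
  by rewrite ltr_pXn2r// nnegrE//; exact: ltW (le_lt_trans q0 h').
have := sqr_ge0 (d * Q - eta ^+ 2 / (4 * d)).
have -> : (d * Q - eta ^+ 2 / (4 * d)) ^+ 2 =
  (d * Q + eta ^+ 2 / (4 * d)) ^+ 2 - eta ^+ 2 * Q by field; exact: lt0r_neq0.
lra.
Qed.

Definition energy_norm (th thx : R -> R) : R :=
  ip th th + ip thx thx + (th 0 ^+ 2 + th 0 ^+ 4) + (th 1 ^+ 2 + th 1 ^+ 4).

Lemma energy_norm_le : exists2 C, 0 <= C & forall B th thx,
  energy_norm th thx <= C * energy B th thx.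
Proof.
have m0 := m_pos; have g0 := g_pos; have k0 := k_pos; have mu0 := mu_gt0.
pose C := 1 + mu^-1 + ((m * k ord0)^-1 + (m * k ord_max)^-1)
  + (3 * (m * g ord0)^-1 + 3 * (m * g ord_max)^-1).
have mk i : 0 < m * k i by exact: mulr_gt0.
have mg i : 0 < m * g i by exact: mulr_gt0.
have mk' i : 0 < (m * k i)^-1 by rewrite invr_gt0.
have mg' i : 0 < (m * g i)^-1 by rewrite invr_gt0.
have mu' : 0 < mu^-1 by rewrite invr_gt0.
have C0 : 0 <= C by rewrite /C; have := mk' ord0; have := mk' ord_max; have := mg' ord0; have := mg' ord_max; lra.
exists C => // B th thx.
have sc (x y : R) : 0 < y -> 0 <= x -> y^-1 <= C -> x <= C * (y * x).
  move=> y0 x0 yC; rewrite -{1}[x](mulKf (lt0r_neq0 y0)).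
  by rewrite ler_wpM2r//; pos.
have A0 := ip_ge0 th; have D0 := ip_ge0 thx.
have t4 (t : R) : 0 <= t ^+ 4 by exact: exprn_even_ge0.
have e1 : ip th th <= C * ip th th.
  rewrite ler_peMl// /C; have := mk' ord0; have := mk' ord_max; have := mg' ord0; have := mg' ord_max; lra.
have e2 : ip thx thx <= C * (mu * ip thx thx).
  apply: sc => //; rewrite /C; have := mk' ord0; have := mk' ord_max; have := mg' ord0; have := mg' ord_max; lra.
have e3 : th 0 ^+ 2 <= C * (m * k ord0 * th 0 ^+ 2).
  apply: sc; rewrite ?sqr_ge0// /C; have := mk' ord_max; have := mg' ord0; have := mg' ord_max; lra.
have e4 : th 1 ^+ 2 <= C * (m * k ord_max * th 1 ^+ 2).
  apply: sc; rewrite ?sqr_ge0// /C; have := mk' ord0; have := mg' ord0; have := mg' ord_max; lra.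
have e5 : th 0 ^+ 4 <= C * (m * g ord0 / 3 * th 0 ^+ 4).
  apply: sc; [by rewrite divr_gt0|exact: t4|rewrite invfM invrK mulrC /C].
  have := mk' ord0; have := mk' ord_max; have := mg' ord_max; lra.
have e6 : th 1 ^+ 4 <= C * (m * g ord_max / 3 * th 1 ^+ 4).
  apply: sc; [by rewrite divr_gt0|exact: t4|rewrite invfM invrK mulrC /C].
  have := mk' ord0; have := mk' ord_max; have := mg' ord0; lra.
have l0 := ler_wpM2l C0 (ler_wpM2l (ltW m0) (energy_node_ge ord0 (B 0) (th 0))).
have l1 := ler_wpM2l C0 (ler_wpM2l (ltW m0) (energy_node_ge ord_max (B 1) (th 1))).
rewrite /energy_norm /energy; clear -e1 e2 e3 e4 e5 e6 l0 l1; lra.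
Qed.

Lemma energy_upper (M : R) : 0 <= M -> exists2 C, 0 <= C & forall B th thx,
  `|B 0| <= M -> `|B 1| <= M -> energy B th thx <= C * energy_norm th thx.
Proof.
move=> M0; have m0 := m_pos; have g0 := g_pos; have k0 := k_pos; have mu0 := mu_gt0.
pose C3 i := m * (k i + 3 * g i + M * (g i * (4 + 6 * M))).
have C30 i : 0 <= C3 i by rewrite /C3; have := g0 i; have := k0 i => ? ?; pos.
exists (1 + mu + C3 ord0 + C3 ord_max); first by have := C30 ord0; have := C30 ord_max => ? ?; pos.
move=> B th thx B0 B1.
have A0 := ip_ge0 th; have D0 := ip_ge0 thx.
have t4 (t : R) : 0 <= t ^+ 4 by exact: exprn_even_ge0.
have en i b t : `|b| <= M -> m * energy_node i b t <= C3 i * (t ^+ 2 + t ^+ 4).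
  move=> bM; rewrite /C3 -mulrA ler_wpM2l ?(ltW m0)//.
  apply: (le_trans (energy_node_le i t bM (lexx M))).
  have := mulr_ge0 (ltW (k0 i)) (t4 t); have := mulr_ge0 (ltW (g0 i)) (sqr_ge0 t); lra.
have n0 := en ord0 _ (th 0) B0; have n1 := en ord_max _ (th 1) B1.
pose q0 := th 0 ^+ 2 + th 0 ^+ 4; pose q1 := th 1 ^+ 2 + th 1 ^+ 4.
have q00 : 0 <= q0 by rewrite addr_ge0 ?sqr_ge0.
have q10 : 0 <= q1 by rewrite addr_ge0 ?sqr_ge0.
rewrite /energy_norm /energy -/q0 -/q1; rewrite -/q0 in n0; rewrite -/q1 in n1.
have := C30 ord0; have := C30 ord_max; rewrite mulrDr.
move: (C3 ord0) (C3 ord_max) n0 n1 => c0 c1 n0 n1 c10 c00.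
have := mulr_ge0 c00 A0; have := mulr_ge0 c10 A0; have := mulr_ge0 c00 D0.
have := mulr_ge0 c10 D0; have := mulr_ge0 c00 q10; have := mulr_ge0 c10 q00.
have := mulr_ge0 (ltW mu0) A0; have := mulr_ge0 (ltW mu0) q00; have := mulr_ge0 (ltW mu0) q10.
clear -n0 n1 A0 D0 q00 q10; move: (energy_node _ _ _) (energy_node _ _ _) n0 n1 => e0 e1 *; lra.
Qed.

(** Here [b] measures the reference state and its time derivative at the endpoints, and [eta] the
    residual left when two states are inserted into the weak form and tested with their difference.
    The constant depends on the states only through [M]. *)
Definition dissipation_rate (a : R) := forall M, 0 <= M ->
  exists2 C, 0 <= C & forall B Bx Bt Btx th thx tht thtx (b eta : R),
  H1 B Bx -> H1 Bt Btx -> H1 th thx -> H1 tht thtx -> b <= M ->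
  (forall x, x \in `[0, 1] -> `|B x| <= b) -> `|Bt 0| <= b -> `|Bt 1| <= b ->
  (weak_form mu nu wd c (fun x => B x + th x) (fun x => Bx x + thx x)
    (fun x => Bt x + tht x) (fun x => Btx x + thtx x) th thx
    - weak_form mu nu wd c B Bx Bt Btx th thx) ^+ 2
   <= eta ^+ 2 * (ip th th + ip thx thx) ->
  denergy B Bt th thx tht thtx <=
    - 2 * a * energy B th thx + C * b * energy B th thx + C * eta ^+ 2.

(* The strict gap [al < a] leaves room to absorb the residual and the terms
   caused by [B]. *)
Lemma energy_dissipation (al := alpha_max mu nu wd c) :
  exists a, [/\ al < a, a <= 2 * al & dissipation_rate a].
Proof.
have [al0 _ _ _] := alpha_max_spec; rewrite -/al in al0.
have [d d0 gap] := dissipation_gap; rewrite -/al in gap.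
have m0 := m_pos; have g0 := g_pos; have k0 := k_pos; have mu0 := mu_gt0.
have [C0 C00 upper0] := energy_upper (lexx 0).
(* Raising the rate by [e] costs [e * F0 <= d / 2 * Q], half of the dissipation gap; the other half
   absorbs the residual. The bound [e <= al] keeps the rate below [2 * al], which later yields
   [a * mu < nu]. *)
pose e := Num.min al (d / (2 * (C0 + 1))).
have C1p : 0 < C0 + 1 by lra.
have e0 : 0 < e by rewrite lt_min al0 divr_gt0 ?mulr_gt0.
have [eal ed] : e <= al /\ e * C0 <= d / 2.
  split; first by rewrite /e ge_min lexx.
  have : e <= d / (2 * (C0 + 1)) by rewrite /e ge_min lexx orbT.
  rewrite ler_pdivlMr ?mulr_gt0// => h; have := mulr_ge0 (ltW e0) C00; lra.
exists (al + e); split; [lra|lra|move=> M M0].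
have [C1 C10 lower] := energy_norm_le.
pose L i := 3 * g i + 1 + m * g i * (6 * M + 1).
pose U i := m * (g i * (4 + 6 * M)).
have L0 i : 0 <= L i by rewrite /L; have := g0 i => ?; pos.
have U0 i : 0 <= U i by rewrite /U; have := g0 i => ?; pos.
pose K := 1 + L ord0 + L ord_max + 2 * al * (U ord0 + U ord_max).
have K0 : 0 <= K by rewrite /K; have := L0 ord0; have := L0 ord_max; have := U0 ord0; have := U0 ord_max => *; pos.
exists (2 * (K * C1) + d^-1); first by pos; rewrite ltW// invr_gt0.
move=> B Bx Bt Btx th thx tht thtx b eta HB HBt Hth Htht bM Bb Bt0 Bt1.
rewrite (energy_identity HB HBt Hth Htht) => res.
set rr := _ + node_loss ord_max _ _ _ _ in res.
pose A := ip th th; pose D := ip thx thx.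
have A0 : 0 <= A := ip_ge0 th; have D0 : 0 <= D := ip_ge0 thx.
have b0 : 0 <= b by exact: le_trans (Bb _ I01_0).
pose q0 := th 0 ^+ 2 + th 0 ^+ 4; pose q1 := th 1 ^+ 2 + th 1 ^+ 4.
have t4 (t : R) : 0 <= t ^+ 4 by exact: exprn_even_ge0.
have q00 : 0 <= q0 by rewrite addr_ge0 ?sqr_ge0.
have q10 : 0 <= q1 by rewrite addr_ge0 ?sqr_ge0.
pose Q := A + D + q0 + q1.
have Q0 : 0 <= Q by rewrite /Q; pos.
have [ADQ q0Q q1Q] : [/\ A + D <= Q, q0 <= Q & q1 <= Q].
  by clear -A0 D0 q00 q10; split; rewrite /Q; lra.
have ae0 : 0 <= al + e by rewrite addr_ge0 ?ltW.
have Lth := H1_L2 Hth; have Lthx := H1_L2d Hth.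
have conv : ip (fun x => B x * th x) thx <= b / 2 * (A + D).
  have LBt := H1_mulL2 HB Lth.
  apply: ip_le_of_sqr => //; apply: (le_trans (cauchy_schwarz_ip LBt Lthx)).
  rewrite mulrA ler_wpM2r//; apply: le_ip => // x xI.
  by rewrite normrM ler_wpM2r// Bb.
have rr_le : rr <= d / 2 * Q + eta ^+ 2 / (2 * d).
  have -> : eta ^+ 2 / (2 * d) = eta ^+ 2 / (4 * (d / 2)).
    by congr (_ / _); field.
  apply: residual_young => //; first by rewrite divr_gt0.
  apply: (le_trans res); rewrite ler_wpM2l ?sqr_ge0//.
have n0 := @node_loss_ge ord0 (-1) M (B 0) (Bt 0) b (th 0) (or_intror erefl) (Bb _ I01_0) Bt0 bM.
have n1 := @node_loss_ge ord_max 1 M (B 1) (Bt 1) b (th 1) (or_introl erefl) (Bb _ I01_1) Bt1 bM.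
have P := poincare Hth; rewrite -/A -/D in P.
have G := gap A D (th 0 ^+ 2) (th 1 ^+ 2) (th 0 ^+ 4) (th 1 ^+ 4) A0 D0 (sqr_ge0 _) (sqr_ge0 _)
  (t4 _) (t4 _) P.
have u0 := ler_wpM2l (ltW m0) (energy_node_le ord0 (th 0) (Bb _ I01_0) bM).
have u1 := ler_wpM2l (ltW m0) (energy_node_le ord_max (th 1) (Bb _ I01_1) bM).
(* [F0] is the energy about the zero state: the gap is stated for it, and the passage to the energy
   about [B] costs only terms of order [b * Q]. *)
pose F0 := A + mu * D + m * (k ord0 * th 0 ^+ 2 + 3 * g ord0 * th 0 ^+ 4 +
  k ord_max * th 1 ^+ 2 + 3 * g ord_max * th 1 ^+ 4).
have F00 : F0 <= C0 * Q.
  have := upper0 (fun=> 0) th thx.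
  rewrite normr0 lexx /energy_norm /energy /energy_node => /(_ isT isT).
  by rewrite -/A -/D -/q0 -/q1 -!/(k _) -!/(g _) /F0 /Q; clear; lra.
pose F := energy B th thx.
have FF0 : F <= F0 + b * (U ord0 * q0 + U ord_max * q1).
  rewrite /F /energy /F0 -/A -/D /U /q0 /q1; clear -u0 u1.
  by move: (energy_node _ _ _) (energy_node _ _ _) u0 u1 => *; lra.
have QF : Q <= C1 * F by have := lower B th thx; rewrite /energy_norm -/A -/D -/q0 -/q1 /Q.
have dF : 2^-1 * denergy B Bt th thx tht thtx <=
   - (nu * D + 2^-1 * (k ord0 * th 0 ^+ 2 + k ord_max * th 1 ^+ 2)
     + 3 / 2 * (g ord0 * th 0 ^+ 4 + g ord_max * th 1 ^+ 4))
   + b / 2 * (A + D) + b * (L ord0 * q0 + L ord_max * q1)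
   + (d / 2 * Q + eta ^+ 2 / (2 * d)).
  move: rr_le n0 n1 conv; rewrite /rr -/D /L -/q0 -/q1 -!/(k _) -!/(g _); clear.
  by move: (node_loss _ _ _ _ _) (node_loss _ _ _ _ _) (denergy _ _ _ _ _ _) => *; lra.
have G' : al * F0 + d * Q <= nu * D + 2^-1 * (k ord0 * th 0 ^+ 2 + k ord_max * th 1 ^+ 2)
     + 3 / 2 * (g ord0 * th 0 ^+ 4 + g ord_max * th 1 ^+ 4).
  by move: G; rewrite /F0 /Q /q0 /q1; clear; lra.
have s1 : b / 2 * (A + D) + b * (L ord0 * q0 + L ord_max * q1) +
    (al + e) * (b * (U ord0 * q0 + U ord_max * q1)) <= K * b * Q.
  have -> : K * b * Q = b * (K * Q) by ring.
  have -> : b / 2 * (A + D) + b * (L ord0 * q0 + L ord_max * q1) +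
    (al + e) * (b * (U ord0 * q0 + U ord_max * q1)) =
    b * (2^-1 * (A + D) + (L ord0 * q0 + L ord_max * q1) + (al + e) * (U ord0 * q0 + U ord_max * q1)) by field.
  rewrite ler_wpM2l//.
  have h1 : L ord0 * q0 <= L ord0 * Q by rewrite ler_wpM2l.
  have h2 : L ord_max * q1 <= L ord_max * Q by rewrite ler_wpM2l.
  have h3 : (al + e) * (U ord0 * q0 + U ord_max * q1) <= 2 * al * ((U ord0 + U ord_max) * Q).
    have := U0 ord0; have := U0 ord_max => ? ?.
    apply: ler_pM; [by []|by pos|by rewrite mulr_natl mulr2n lerD2l|].
    by rewrite mulrDl lerD// ler_wpM2l.
  have h4 : 2^-1 * (A + D) <= Q by clear -ADQ A0 D0; lra.
  by move: h1 h2 h3 h4; rewrite /K; clear; lra.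
have s2 : K * b * Q <= K * C1 * b * F.
  have -> : K * C1 * b * F = K * b * (C1 * F) by ring.
  by rewrite ler_wpM2l//; pos.
have s3 : (al + e) * F <= (al + e) * F0 + (al + e) * (b * (U ord0 * q0 + U ord_max * q1)).
  by rewrite -mulrDr ler_wpM2l.
have s4 : e * F0 <= d / 2 * Q.
  apply: le_trans (ler_wpM2l (ltW e0) F00) _.
  by rewrite mulrA ler_wpM2r.
have s5 : eta ^+ 2 / (2 * d) = 2^-1 * (d^-1 * eta ^+ 2) by field; exact: lt0r_neq0.
have s6 : 0 <= d^-1 * b * F.
  have : 0 <= C1 * F by exact: le_trans QF.
  have F0' : 0 <= F.
    rewrite /F; have := energy_node_ge ord0 (B 0) (th 0); have := energy_node_ge ord_max (B 1) (th 1).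
    have p0 : 0 <= k ord0 * th 0 ^+ 2 + g ord0 / 3 * th 0 ^+ 4.
      by have := g0 ord0; have := k0 ord0; have := t4 (th 0) => *; pos.
    have p1 : 0 <= k ord_max * th 1 ^+ 2 + g ord_max / 3 * th 1 ^+ 4.
      by have := g0 ord_max; have := k0 ord_max; have := t4 (th 1) => *; pos.
    move=> h1 h0; rewrite /energy; apply: addr_ge0; first by rewrite addr_ge0// mulr_ge0// ltW.
    rewrite mulr_ge0 ?(ltW m0)//; apply: addr_ge0; [exact: le_trans h0|exact: le_trans h1].
  by move=> _; rewrite !mulr_ge0// ltW// invr_gt0.
have s7 : 0 <= K * C1 * eta ^+ 2 by pos.
rewrite s5 in dF; rewrite -/F.
clear -dF G' s1 s2 s3 s4 s6 s7.
move: dF; move: (denergy _ _ _ _ _ _) (nu * D + _ + _) G' => dd X G' dF.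
lra.
Qed.

End Energy.

(** * Space regularity and residuals at a fixed time *)

Section StationaryBounds.
Context {R : realType}.
Implicit Types (f g h : R -> R) (a b x y : R).

Lemma sqr_le_norm (x k : R) : 0 <= k -> x ^+ 2 <= k ^+ 2 -> `|x| <= k.
Proof. by move=> k0 h; rewrite -ler_sqr ?nnegrE// real_normK ?num_real. Qed.

Lemma ip_norm_le f g (p r : R) : L2 f -> L2 g -> 0 <= p -> 0 <= r ->
  ip f f <= p ^+ 2 -> ip g g <= r ^+ 2 -> `|ip f g| <= p * r.
Proof.
move=> Lf Lg p0 r0 fp gr; apply: sqr_le_norm; first exact: mulr_ge0.
apply: (le_trans (cauchy_schwarz_ip Lf Lg)).
by rewrite exprMn; apply: ler_pM => //; exact: ip_ge0.
Qed.

Lemma ip_dramp1 a b : 0 <= a -> a < b -> b <= 1 -> ip (fun=> 1) (dramp a b) = 1.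
Proof.
move=> a0 ab b1; rewrite (ip_dramp (@H1_id R))// divff//.
by rewrite subr_eq0 gt_eqF.
Qed.

Lemma average_bound f a b (k d : R) : L2 f -> 0 <= a -> a < b -> b <= 1 ->
  (forall x, a <= x <= b -> `|f x - k| <= d) -> `|ip f (dramp a b) - k| <= d.
Proof.
move=> Lf a0 ab b1 fk.
have d0 : 0 <= d by apply: le_trans (fk a _); rewrite // lexx ltW.
have ba : 0 < b - a by rewrite subr_gt0.
have Lk := L2B Lf (L2_cst k).
have -> : ip f (dramp a b) - k = (b - a)^-1 * ip (fun x => ind a b x * (f x - k)) (ind a b).
  rewrite -ipZr//; last exact: L2M_ind.
  have -> : ip (fun x => ind a b x * (f x - k)) (fun x => (b - a)^-1 * ind a b x) =
      ip (fun x => f x - k) (dramp a b).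
    by apply: eq_Rintegral => x _; rewrite /dramp -[in RHS]indM; ring.
  rewrite ipBl//; [|exact: L2_cst|exact: L2_dramp].
  congr (_ - _); rewrite -[k in LHS]mulr1 -(ip_dramp1 a0 ab b1) -ipZl//.
  - by apply: eq_Rintegral => x _; rewrite mulr1.
  - exact: L2_cst.
  - exact: L2_dramp.
rewrite normrM gtr0_norm ?invr_gt0// ler_pdivrMl// mulrC.
have ii : ip (ind a b) (ind a b) = b - a.
  rewrite -(ip_ind a0 (ltW ab) b1).
  by apply: eq_Rintegral => z _; rewrite indM mul1r.
apply: sqr_le_norm; first by rewrite mulr_ge0// ltW.
apply: (le_trans (cauchy_schwarz_ip (L2M_ind a b Lk) (L2_ind a b))).
rewrite ii exprMn expr2 mulrA ler_wpM2r ?(ltW ba)// mulrC -ii mulrC.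
have h := @le_ip R (fun x => ind a b x * (f x - k)) (ind a b) d (L2M_ind a b Lk) (L2_ind a b).
apply: (le_trans (h _)) => //.
move=> x _; rewrite indE; case: ifP => [/andP[ax xb]|_]; last by rewrite mul0r normr0 mulr0.
by rewrite mul1r normr1 mulr1 fk// (ltW ax).
Qed.

(** [(b - a)] times the error at [x] of linear interpolation between [a] and [b]. *)
Definition ierr f a x b : R := (b - a) * f x - (b - x) * f a - (x - a) * f b.

(** The two ramps differ only between [a] and [b], and there by at most 1. *)
Lemma ramp_diff_bound f a x b (d : R) : L2 f -> 0 <= a -> a < x -> x < b -> b <= 1 ->
  (forall y, y \in `[0, 1] -> `|f y| <= d) ->
  `|ip f (fun y => ramp a x y - ramp x b y)| <= d * (b - a).
Proof.
move=> Lf a0 ax xb b1 fd.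
have ab : a < b by exact: lt_trans xb.
have ba : 0 < b - a by rewrite subr_gt0.
have x0 : 0 <= x by exact: le_trans (ltW ax).
have x1 : x <= 1 by exact: le_trans (ltW xb) b1.
have d0 : 0 <= d by exact: le_trans (fd _ I01_0).
pose h y := ramp a x y - ramp x b y.
have Lh : L2 h by apply: L2B; [exact: H1_L2 (H1_ramp a0 ax x1)|exact: H1_L2 (H1_ramp x0 xb b1)].
have hle y : `|h y| <= 1.
  have /andP[r1 r2] := ramp_itv a x y; have /andP[r3 r4] := ramp_itv x b y.
  by rewrite ler_norml; apply/andP; split; rewrite /h; lra.
have hE y : h y = ind a b y * h y.
  rewrite indE; have [ay|ya] := ltP a y; last first.
    by rewrite /h !ramp_le// ?subrr ?mulr0// (le_trans ya)// ltW.
  have [yb|yb] := leP y b; first by rewrite mul1r.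
  by rewrite /h !ramp_ge// ?subrr ?mulr0// ltW// (lt_trans xb).
have -> : ip f (fun y => ramp a x y - ramp x b y) = ip (fun y => ind a b y * f y) h.
  by apply: eq_Rintegral => y _; rewrite -/(h y) {1}hE; ring.
have ii : ip (ind a b) (ind a b) = b - a.
  rewrite -(ip_ind a0 (ltW ab) b1).
  by apply: eq_Rintegral => z _; rewrite indM mul1r.
have e1 : ip (fun y => ind a b y * f y) (fun y => ind a b y * f y) <= d ^+ 2 * (b - a).
  rewrite -ii; apply: le_ip => //; first exact: L2M_ind.
  by move=> y yI; rewrite normrM mulrC ler_wpM2r// fd.
have e2 : ip h h <= 1 ^+ 2 * (b - a).
  rewrite -ii; apply: le_ip => // y yI.
  by rewrite hE normrM mulrC ler_wpM2r.
apply: sqr_le_norm; first by rewrite mulr_ge0// ltW.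
apply: (le_trans (cauchy_schwarz_ip (L2M_ind a b Lf) Lh)).
have -> : (d * (b - a)) ^+ 2 = d ^+ 2 * (b - a) * (1 ^+ 2 * (b - a)) by ring.
by apply: ler_pM => //; exact: ip_ge0.
Qed.

Variables (mu nu wd : R) (c : 'I_2 -> R).
Hypotheses (mu_gt0 : 0 < mu) (nu_gt0 : 0 < nu) (wd_ge0 : 0 <= wd).
Hypothesis c_gt0 : forall i, 0 < c i.

Let m := mu / nu.
Let k i := 1 + c i + wd.
Let g i := (9 * c i)^-1.

Lemma boundary_term_bound i (M : R) : 0 <= M -> exists2 K, 0 <= K &
  forall u ut d : R, `|u| <= d -> `|ut| <= d -> d <= M ->
  `|boundary_term mu nu wd c i u ut| <= K * d.
Proof.
move=> M0; have wd0 := wd_ge0; have c0 := c_gt0 i; have m0 : 0 < m by exact: divr_gt0.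
have k0 : 0 < k i by rewrite /k; lra.
have g0 : 0 < g i by rewrite invr_gt0 mulr_gt0.
exists (k i + 2 * g i * M ^+ 2 + m * (k i + 6 * g i * M ^+ 2)); first by pos.
move=> u ut d ud utd dM; have d0 : 0 <= d by exact: le_trans ud.
have uM : `|u| <= M by exact: le_trans dM.
have h2 : `|u ^+ 2 * ut| <= M ^+ 2 * d.
  by apply: normM_le => //; rewrite normrX lerXn2r ?nnegrE.
have h3 : `|u ^+ 3| <= M ^+ 2 * d.
  by rewrite exprSr; apply: normM_le => //; rewrite normrX lerXn2r ?nnegrE.
have e1 : `|k i * u| <= k i * d by apply: normM_le => //; rewrite gtr0_norm.
have e2 : `|2 * g i * u ^+ 3| <= 2 * g i * (M ^+ 2 * d).
  by apply: normM_le => //; rewrite ger0_norm//; pos.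
have e3 : `|m * (k i * ut + 6 * g i * (u ^+ 2 * ut))| <= m * (k i * d + 6 * g i * (M ^+ 2 * d)).
  apply: normM_le; first by rewrite gtr0_norm.
  apply: (le_trans (ler_normD _ _)); apply: lerD; apply: normM_le => //.
    by rewrite gtr0_norm.
  by rewrite ger0_norm//; pos.
rewrite /boundary_term -/(k i) -/(g i) -/m.
have n1 := ler_normD (k i * u + 2 * g i * u ^+ 3) (m * (k i * ut + 6 * g i * (u ^+ 2 * ut))).
have n2 := ler_normD (k i * u) (2 * g i * u ^+ 3).
clear -e1 e2 e3 n1 n2; lra.
Qed.

(** The ramp vanishes at 0 and equals 1 at 1, so only the boundary term at 1 survives; pairings with
    [dramp a b] are averages over [a, b]. *)
Lemma slope_identity u ux ut uxt a b : H1 u ux -> H1 ut uxt -> 0 <= a -> a < b -> b <= 1 ->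
  (forall chi chix, H1 chi chix -> weak_form mu nu wd c u ux ut uxt chi chix = 0) ->
  mu * ((ut b - ut a) / (b - a)) + nu * ((u b - u a) / (b - a)) =
  - ip ut (ramp a b) - (1 + wd) * (u 1 - ip u (dramp a b))
  - 2^-1 * (u 1 ^+ 2 - ip (fun x => u x ^+ 2) (dramp a b))
  - boundary_term mu nu wd c ord_max (u 1) (ut 1).
Proof.
move=> Hu Hut a0 ab b1 w; have Hr := H1_ramp a0 ab b1.
have := w _ _ Hr; rewrite (weak_formE_parts mu wd nu_gt0 c_gt0 _ _ Hu Hr).
rewrite (ip_dramp Hut)// (ip_dramp Hu)// (ramp_le ab a0) (ramp_ge ab b1).
clear; move: (ip _ _) (ip _ _) (ip _ _) (boundary_term _ _ _ _ _ _ _) (boundary_term _ _ _ _ _ _ _).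
move=> *; lra.
Qed.

Lemma residual_interp u ux ut uxt s z (e M : R) : H1 u ux -> H1 ut uxt -> itv_partition 0 1 s ->
  (forall chi chix, H1 chi chix -> weak_form mu nu wd c u ux ut uxt chi chix = 0) ->
  (forall x, x \in `[0, 1] -> `|u x| <= M) ->
  (forall x, x \in `[0, 1] -> `|interp s u x| <= M) ->
  (forall x, x \in `[0, 1] -> `|interp s u x - u x| <= e) ->
  (forall x, x \in `[0, 1] -> `|interp s ut x - ut x| <= e) ->
  (weak_form mu nu wd c (interp s u) (dinterp s u) (interp s ut) (dinterp s ut)
     (interp s z) (dinterp s z)) ^+ 2
  <= (2 * (2 + wd + M) * e) ^+ 2 * (ip (interp s z) (interp s z) + ip (dinterp s z) (dinterp s z)).
Proof.
move=> Hu Hut sP w uM iuM ue ute; have wd0 := wd_ge0.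
have Hz := H1_interp sP z; have HW := H1_interp sP u; have HWt := H1_interp sP ut.
have e0 : 0 <= e by exact: le_trans (ue _ I01_0).
have M0 : 0 <= M by exact: le_trans (uM _ I01_0).
have := w _ _ Hz.
rewrite (weak_formE_parts mu wd nu_gt0 c_gt0 _ _ Hu Hz) (weak_formE_parts mu wd nu_gt0 c_gt0 _ _ HW Hz).
rewrite !(interp0 sP) !(interp1 sP).
rewrite (ip_dinterp_interp sP z Hu) (ip_dinterp_interp sP z Hut).
set X := interp s z; set Y := dinterp s z.
have [LX LY] : L2 X /\ L2 Y by split; [exact: L2_interp|exact: L2_dinterp].
have [Lu Lut] : L2 u /\ L2 ut by split; [exact: H1_L2 Hu|exact: H1_L2 Hut].
have [LW LWt] : L2 (interp s u) /\ L2 (interp s ut) by split; exact: L2_interp.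
have Lu2 : L2 (fun x => u x ^+ 2) := H1_mulL2 Hu Lu.
have LW2 : L2 (fun x => interp s u x ^+ 2) := H1_mulL2 HW LW.
pose f x := interp s ut x - ut x.
pose h x := - (1 + wd) * (interp s u x - u x) - 2^-1 * (interp s u x ^+ 2 - u x ^+ 2).
have Lf : L2 f by exact: L2B.
have Lh1 : L2 (fun x => - (1 + wd) * (interp s u x - u x)) by apply: L2Z; exact: L2B.
have Lh2 : L2 (fun x => 2^-1 * (interp s u x ^+ 2 - u x ^+ 2)) by apply: L2Z; exact: L2B.
have Lh : L2 h by exact: L2B.
have fX : ip f X = ip (interp s ut) X - ip ut X by rewrite ipBl.
have hY : ip h Y = - (1 + wd) * (ip (interp s u) Y - ip u Y)
    - 2^-1 * (ip (fun x => interp s u x ^+ 2) Y - ip (fun x => u x ^+ 2) Y).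
  by rewrite ipBl// !ipZl//; [rewrite !ipBl|exact: L2B|exact: L2B].
have ff : ip f f <= e ^+ 2 by exact: ip_sup.
have hh : ip h h <= ((1 + wd + M) * e) ^+ 2.
  apply: ip_sup => // x xI.
  have -> : h x = - ((1 + wd + 2^-1 * (interp s u x + u x)) * (interp s u x - u x)).
    by rewrite /h; field.
  rewrite normrN; apply: normM_le; last exact: ue.
  apply: (le_trans (ler_normD _ _)); apply: lerD; first by rewrite ger0_norm//; lra.
  rewrite normrM ger0_norm//; have := ler_normD (interp s u x) (u x).
  have := uM x xI; have := iuM x xI; lra.
move=> E; set r := _ + _ + _.
have -> : r = ip f X + ip h Y.
  rewrite /r fX hY; move: E; clear.
  move: (ip ut X) (ip _ X) (ip _ Y) (ip _ Y) (ip _ Y) (ip _ Y) (ip _ Y) (ip _ Y).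
  move: (boundary_term _ _ _ _ _ _ _) (boundary_term _ _ _ _ _ _ _) => *; lra.
have c1 := cauchy_schwarz_ip Lf LX; have c2 := cauchy_schwarz_ip Lh LY.
have X0 := ip_ge0 X; have Y0 := ip_ge0 Y.
have c1' := le_trans c1 (ler_wpM2r X0 ff); have c2' := le_trans c2 (ler_wpM2r Y0 hh).
have sq := sqr_ge0 (ip f X - ip h Y).
apply: (@le_trans _ _ (2 * (e ^+ 2 * ip X X) + 2 * (((1 + wd + M) * e) ^+ 2 * ip Y Y))).
  by clear -c1' c2' sq; lra.
rewrite mulrDr; apply: lerD; rewrite mulrA ler_wpM2r//.
  have : e ^+ 2 <= ((2 + wd + M) * e) ^+ 2.
    rewrite lerXn2r ?nnegrE ?mulr_ge0//; first by pos.
    by rewrite ler_peMl//; lra.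
  have := sqr_ge0 ((2 + wd + M) * e); clear E c1 c2 c1' c2' sq ff hh fX hY; lra.
have : ((1 + wd + M) * e) ^+ 2 <= ((2 + wd + M) * e) ^+ 2.
  by rewrite lerXn2r ?nnegrE ?mulr_ge0//; [pos|pos|rewrite ler_wpM2r//; lra].
have := sqr_ge0 ((2 + wd + M) * e); clear E c1 c2 c1' c2' sq ff hh fX hY; lra.
Qed.

(** The restriction [d <= M] makes every nonlinear term linear in [d], so decay of the solution is
    inherited by the Lipschitz constant in space. *)
Lemma slope_bound (M : R) : 0 <= M -> exists2 K, 0 <= K &
  forall u ux ut uxt, H1 u ux -> H1 ut uxt ->
  (forall chi chix, H1 chi chix -> weak_form mu nu wd c u ux ut uxt chi chix = 0) ->
  forall d : R, d <= M -> (forall x, x \in `[0, 1] -> `|u x| <= d) ->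
  (forall x, x \in `[0, 1] -> `|ut x| <= d) ->
  forall a b, 0 <= a -> a <= b -> b <= 1 ->
  `|mu * (ut b - ut a) + nu * (u b - u a)| <= K * d * (b - a).
Proof.
move=> M0; have [K1 K10 HK] := boundary_term_bound ord_max M0; have wd0 := wd_ge0.
exists (1 + (1 + wd) * 2 + M + K1); first by pos.
move=> u ux ut uxt Hu Hut w d dM ud utd a b a0; rewrite le_eqVlt => /predU1P[-> _|ab b1].
  by rewrite !subrr !mulr0 addr0 normr0.
have ba : 0 < b - a by rewrite subr_gt0.
have d0 : 0 <= d by exact: le_trans (ud _ I01_0).
have -> : mu * (ut b - ut a) + nu * (u b - u a) =
   (mu * ((ut b - ut a) / (b - a)) + nu * ((u b - u a) / (b - a))) * (b - a).
  by field; rewrite lt0r_neq0.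
rewrite normrM (gtr0_norm ba) ler_wpM2r ?(ltW ba)//.
rewrite (slope_identity Hu Hut a0 ab b1 w).
have Hr := H1_ramp a0 ab b1.
have Lu := H1_L2 Hu; have Lut := H1_L2 Hut.
have Lu2 : L2 (fun x => u x ^+ 2) := H1_mulL2 Hu Lu.
have aI x : a <= x <= b -> x \in `[0, 1].
  by move=> /andP[ax xb]; rewrite in_itv/= (le_trans a0 ax) (le_trans xb b1).
have e1 : `|ip ut (ramp a b)| <= d * 1.
  apply: ip_norm_le => //; [exact: H1_L2 Hr|exact: ip_sup|].
  apply: ip_sup; first exact: H1_L2 Hr.
  by move=> x _; have /andP[r0 r1] := ramp_itv a b x; rewrite ger0_norm.
have e2 : `|ip u (dramp a b) - 0| <= d.
  by apply: average_bound => // x /aI xI; rewrite subr0 ud.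
have e3 : `|ip (fun x => u x ^+ 2) (dramp a b) - 0| <= d * M.
  apply: average_bound => // x /aI xI; rewrite subr0 expr2; apply: normM_le; first exact: ud.
  exact: le_trans (ud x xI) dM.
have e4 := HK _ _ _ (ud _ I01_1) (utd _ I01_1) dM.
have e5 := ud _ I01_1.
have e6 : `|u 1 ^+ 2| <= d * M by rewrite expr2; apply: normM_le => //; exact: le_trans e5 dM.
rewrite subr0 in e2; rewrite subr0 in e3.
have e7 : `|(1 + wd) * (u 1 - ip u (dramp a b))| <= (1 + wd) * (2 * d).
  apply: normM_le; first by rewrite ger0_norm//; lra.
  by have := ler_normB (u 1) (ip u (dramp a b)); lra.
have e8 : `|2^-1 * (u 1 ^+ 2 - ip (fun x => u x ^+ 2) (dramp a b))| <= 2^-1 * (2 * (d * M)).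
  apply: normM_le; first by rewrite ger0_norm.
  by have := ler_normB (u 1 ^+ 2) (ip (fun x => u x ^+ 2) (dramp a b)); lra.
move: e1 e7 e8 e4; clear.
move: (ip ut _) ((1 + wd) * (u 1 - _)) (2^-1 * (_ - _)) (boundary_term _ _ _ _ _ _ _) => p1 p2 p3 p4 e1 e2 e3 e4.
have := ler_normB (- p1 - p2 - p3) p4; have := ler_normB (- p1 - p2) p3.
have := ler_normB (- p1) p2; rewrite normrN; lra.
Qed.

(** The interpolation error is [(x - a) * (b - x)] times a difference of slopes over [a, x] and
    [x, b]. Subtracting the two slope identities cancels all terms at 1; averages of [u] and of
    [u ^+ 2] over the adjacent intervals differ by O(l * (b - a)), and the two ramps are handled by
    [ramp_diff_bound]. *)
Lemma ierr_bound u ux ut uxt (M d l : R) : H1 u ux -> H1 ut uxt ->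
  (forall chi chix, H1 chi chix -> weak_form mu nu wd c u ux ut uxt chi chix = 0) ->
  (forall x, x \in `[0, 1] -> `|u x| <= M) ->
  (forall x, x \in `[0, 1] -> `|ut x| <= d) ->
  (forall a b, 0 <= a -> a <= b -> b <= 1 -> `|u b - u a| <= l * (b - a)) ->
  forall a x b, 0 <= a -> a <= x -> x <= b -> b <= 1 ->
  `|mu * ierr ut a x b + nu * ierr u a x b| <= (d + 2 * (1 + wd + M) * l) * (b - a) ^+ 3.
Proof.
move=> Hu Hut w uM utd ul a x b a0; have wd0 := wd_ge0.
have M0 : 0 <= M by exact: le_trans (uM _ I01_0).
have d0 : 0 <= d by exact: le_trans (utd _ I01_0).
have l0 : 0 <= l.
  by have := le_trans (normr_ge0 _) (ul 0 1 (lexx _) ler01 (lexx _)); rewrite subr0 mulr1.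
set K := d + _; have K0 : 0 <= K by rewrite /K; pos.
have K3 p : 0 <= p -> 0 <= K * p ^+ 3 by move=> p0; pos.
rewrite le_eqVlt => /predU1P[<-{x} xb _|ax].
  have -> : mu * ierr ut a a b + nu * ierr u a a b = 0 by rewrite /ierr; ring.
  by rewrite normr0 K3// subr_ge0.
rewrite le_eqVlt => /predU1P[<-{b} _|xb b1].
  have -> : mu * ierr ut a x x + nu * ierr u a x x = 0 by rewrite /ierr; ring.
  by rewrite normr0 K3// subr_ge0 ltW.
have x0 : 0 <= x by exact: le_trans (ltW ax).
have x1 : x <= 1 by exact: le_trans (ltW xb) b1.
have xa0 : 0 < x - a by rewrite subr_gt0.
have bx0 : 0 < b - x by rewrite subr_gt0.
have S1 := slope_identity Hu Hut a0 ax x1 w.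
have S2 := slope_identity Hu Hut x0 xb b1 w.
have -> : mu * ierr ut a x b + nu * ierr u a x b = (x - a) * (b - x) *
   ((mu * ((ut x - ut a) / (x - a)) + nu * ((u x - u a) / (x - a)))
    - (mu * ((ut b - ut x) / (b - x)) + nu * ((u b - u x) / (b - x)))).
  by rewrite /ierr; field; rewrite !lt0r_neq0.
rewrite S1 S2.
have Lu := H1_L2 Hu; have Lut := H1_L2 Hut.
have Lu2 : L2 (fun x => u x ^+ 2) := H1_mulL2 Hu Lu.
have uxl y : a <= y <= b -> `|u y - u x| <= l * (b - a).
  move=> /andP[ay yb]; have [yx|/ltW xy] := leP y x.
    by rewrite distrC (le_trans (ul _ _ _ yx x1)) ?(le_trans a0)// ler_wpM2l//; lra.
  by rewrite (le_trans (ul _ _ x0 xy _)) ?(le_trans yb)// ler_wpM2l//; lra.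
have u2xl y : a <= y <= b -> `|u y ^+ 2 - u x ^+ 2| <= 2 * M * (l * (b - a)).
  move=> yab; have -> : u y ^+ 2 - u x ^+ 2 = (u y + u x) * (u y - u x) by ring.
  apply: normM_le; last exact: uxl.
  have yI : y \in `[0, 1] by case/andP: yab => ? ?; rewrite in_itv/= (le_trans a0)// (le_trans _ b1).
  have xI : x \in `[0, 1] by rewrite in_itv/= x0.
  by have := ler_normD (u y) (u x); have := uM y yI; have := uM x xI; lra.
have le1 y : a <= y <= x -> a <= y <= b by move=> /andP[-> yx]; rewrite (le_trans yx)// ltW.
have le2 y : x <= y <= b -> a <= y <= b by move=> /andP[xy ->]; rewrite (le_trans _ xy)// ltW.
have A1 : `|ip u (dramp a x) - u x| <= l * (b - a) by apply: average_bound => // y /le1; exact: uxl.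
have A2 : `|ip u (dramp x b) - u x| <= l * (b - a) by apply: average_bound => // y /le2; exact: uxl.
have A3 : `|ip (fun y => u y ^+ 2) (dramp a x) - u x ^+ 2| <= 2 * M * (l * (b - a)).
  by apply: average_bound => // y /le1; exact: u2xl.
have A4 : `|ip (fun y => u y ^+ 2) (dramp x b) - u x ^+ 2| <= 2 * M * (l * (b - a)).
  by apply: average_bound => // y /le2; exact: u2xl.
have A5 := ramp_diff_bound Lut a0 ax xb b1 utd.
have Hr1 := H1_ramp a0 ax x1; have Hr2 := H1_ramp x0 xb b1.
rewrite ipBr// in A5; [|exact: H1_L2 Hr1|exact: H1_L2 Hr2].
have -> : K * (b - a) ^+ 3 = (b - a) ^+ 2 * (K * (b - a)) by ring.
apply: normM_le.
  rewrite ger0_norm; last by rewrite mulr_ge0 ?ltW.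
  rewrite expr2; apply: ler_pM; [exact: ltW|exact: ltW|by rewrite lerD2r ltW|].
  by rewrite lerD2l lerN2 ltW.
set S := (X in `|X|).
have -> : S = - (ip ut (ramp a x) - ip ut (ramp x b))
    + (1 + wd) * ((ip u (dramp a x) - u x) - (ip u (dramp x b) - u x))
    + 2^-1 * ((ip (fun y => u y ^+ 2) (dramp a x) - u x ^+ 2)
              - (ip (fun y => u y ^+ 2) (dramp x b) - u x ^+ 2)).
  by rewrite /S; field.
move: A1 A2 A3 A4 A5; rewrite /K.
set p1 := ip u (dramp a x) - u x; set p2 := ip u (dramp x b) - u x.
set p3 := ip _ (dramp a x) - u x ^+ 2; set p4 := ip _ (dramp x b) - u x ^+ 2.
move: (ip ut _ - _) p1 p2 p3 p4 => p5 p1 p2 p3 p4 e1 e2 e3 e4 e5; clear -wd0 e1 e2 e3 e4 e5.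
have h1 : `|(1 + wd) * (p1 - p2)| <= (1 + wd) * (2 * (l * (b - a))).
  apply: normM_le; first by rewrite ger0_norm//; lra.
  by have := ler_normB p1 p2; lra.
have h2 : `|2^-1 * (p3 - p4)| <= 2^-1 * (2 * (2 * M * (l * (b - a)))).
  apply: normM_le; first by rewrite ger0_norm.
  by have := ler_normB p3 p4; lra.
have := ler_normD (- p5 + (1 + wd) * (p1 - p2)) (2^-1 * (p3 - p4)).
have := ler_normD (- p5) ((1 + wd) * (p1 - p2)); rewrite normrN.
move: ((1 + wd) * (p1 - p2)) (2^-1 * (p3 - p4)) h1 h2 => q1 q2 h1 h2 *; lra.
Qed.

End StationaryBounds.

(** * Regularity in time *)

Section TimeRegularity.
Context {R : realType}.
Implicit Types (f g h : R -> R) (a b x y t : R).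
Local Notation leb := (@lebesgue_measure R).

Lemma ae_positive_dense (Q : R -> Prop) :
  {ae leb, forall t, 0 < t -> Q t} ->
  forall a b, 0 <= a -> a < b -> exists t, [/\ a < t, t < b & Q t].
Proof.
move=> [N [mN N0 sub]] a b a0 ab; apply: contrapT => H.
have subN : (`]a, b[%classic : set R) `<=` N.
  move=> t /=; rewrite in_itv/= => /andP[at1 tb]; apply: sub => /= Qt.
  by apply: H; exists t; split=> //; apply: Qt; exact: le_lt_trans at1.
have := le_measure leb _ _ subN; rewrite !inE => /(_ (measurable_itv _) mN).
move=> hle; have : (leb (`]a, b[%classic : set R) <= 0)%E by rewrite -N0.
rewrite leNgt => /negP; apply.
by rewrite /= lebesgue_measure_itv/= lte_fin ab -EFinB lte_fin subr_gt0.
Qed.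

Lemma Rintegral_ae_eq f h t : measurable_fun (`[0, t]%classic : set R) f ->
  measurable_fun (`[0, t]%classic : set R) h ->
  {ae leb, forall x, 0 < x -> f x = h x} ->
  \int[leb]_(x in `[0, t]) f x = \int[leb]_(x in `[0, t]) h x.
Proof.
move=> mf mh fh; rewrite /Rintegral; congr fine.
have sub : (`]0, t]%classic : set R) `<=` `[0, t].
  by move=> x /=; rewrite !in_itv/= => /andP[/ltW -> ->].
have mo (u : R -> R) : measurable_fun (`[0, t]%classic : set R) u ->
    measurable_fun (`]0, t]%classic : set R) (EFin \o u).
  by move=> mu; apply/measurable_EFinP; apply: measurable_funS sub mu; exact: measurable_itv.
rewrite -!integral_itv_obnd_cbnd; [|exact: mo..].
apply: ae_eq_integral; [exact: measurable_itv|exact: mo|exact: mo|].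
have FF := ae_filter_ringOfSetsType leb.
apply: filterS fh => x h0 /=; rewrite in_itv/= => /andP[x0 _].
by rewrite h0.
Qed.

Lemma spacetime_measurable_section (u : R -> R -> R) x t : spacetime_measurable u ->
  x \in `[0, 1] -> measurable_fun (`[0, t]%classic : set R) (fun s => u s x).
Proof.
move=> mu xI.
apply: (@measurable_comp _ _ _ _ _ _ ((`[0, +oo[ : set R) `*` (`[0, 1] : set R))
  (fun p : R * R => u p.1 p.2) _ (fun s => (s, x))) => //.
- by apply: measurableX; exact: measurable_itv.
- by move=> _ [s /= + <-] /=; rewrite !in_itv/= => /andP[-> _].
- by apply: measurable_funTS; exact: pair2_measurable.
Qed.

Lemma integrable_bounded_itv (h : R -> R) (M a b : R) : measurable_fun (`[a, b]%classic : set R) h ->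
  (forall x, `|h x| <= M) -> leb.-integrable `[a, b] (EFin \o h).
Proof.
move=> mh hM; apply: measurable_bounded_integrable => //.
- by rewrite /= lebesgue_measure_itv/=; case: ifP => _; rewrite ?ltry// -EFinB ltry.
- by exists M; split; [rewrite num_real|move=> K MK x _ /=; exact: le_trans (hM x) (ltW MK)].
Qed.

Lemma Rintegral_lipschitz (h : R -> R) (M s t : R) : 0 <= s -> s <= t ->
  measurable_fun (`[0, t]%classic : set R) h -> (forall x, `|h x| <= M) ->
  `|\int[leb]_(x in `[0, t]) h x - \int[leb]_(x in `[0, s]) h x| <= M * (t - s).
Proof.
move=> s0 st mh hM; have ih := integrable_bounded_itv mh hM.
rewrite Rintegral_itvB//.
have sub : (`]s, t]%classic : set R) `<=` `[0, t].
  by move=> x /=; rewrite !in_itv/= => /andP[/ltW sx ->]; rewrite (le_trans s0).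
have ih' : leb.-integrable `]s, t] (EFin \o h).
  by apply: (@integrableS _ _ R leb (`[0, t]%classic) (`]s, t]%classic) _ _ _ sub ih); exact: measurable_itv.
have ic : leb.-integrable `]s, t] (EFin \o cst M).
  have ic := @integrable_bounded_itv (cst M) `|M| 0 t (measurable_cst _) (fun=> lexx _).
  by apply: (@integrableS _ _ R leb (`[0, t]%classic) (`]s, t]%classic) _ _ _ sub ic); exact: measurable_itv.
apply: (le_trans (le_normr_Rintegral _ ih')) => //.
apply: (@le_trans _ _ (\int[leb]_(x in `]s, t]) (cst M x))).
  apply: le_Rintegral => //; exact: integrable_norm.
rewrite Rintegral_cst//= lebesgue_measure_itv/= lte_fin.
have M0 : 0 <= M by exact: le_trans (hM 0).
case: ltP => st' /=; rewrite ?mulr0//.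
by rewrite mulr_ge0// subr_ge0.
Qed.

(** McShane's extension: the supremum of the downward cones with slope [L] whose tips lie on the
    graph of [f] over [S]. *)
Lemma lipschitz_extension f (S : set R) (L : R) : 0 <= L -> S !=set0 ->
  (forall s t, S s -> S t -> `|f t - f s| <= L * `|t - s|) ->
  exists g : R -> R, (forall t, S t -> g t = f t) /\
    forall s t, `|g t - g s| <= L * `|t - s|.
Proof.
move=> L0 [s0 Ss0] fL.
pose E t := [set f s - L * `|t - s| | s in S].
have E0 t : E t !=set0 by exists (f s0 - L * `|t - s0|); exists s0.
have Eub t : has_ubound (E t).
  exists (f s0 + L * `|t - s0|) => _ [s Ss <-].
  have := fL s0 s Ss0 Ss; rewrite ler_norml => /andP[_ h].
  have := ler_wpM2l L0 (ler_distD t s s0); rewrite (distrC s t); lra.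
pose g t := sup (E t).
have gL s t : g t - g s <= L * `|t - s|.
  rewrite lerBlDr; apply: ge_sup => // _ [r Sr <-].
  have : f r - L * `|s - r| <= g s by apply: ub_le_sup; [exact: Eub|exists r].
  have := ler_wpM2l L0 (ler_distD t s r); rewrite (distrC s t); lra.
exists g; split=> [t St|s t].
  apply/eqP; rewrite eq_le; apply/andP; split.
    apply: ge_sup => // _ [r Sr <-].
    by have := fL t r St Sr; rewrite ler_norml distrC => /andP[_ h]; lra.
  by apply: ub_le_sup; [exact: Eub|exists t => //; rewrite subrr normr0 mulr0 subr0].
rewrite ler_norml; apply/andP; split; last exact: gL.
by have := gL t s; rewrite distrC; lra.
Qed.

Lemma sqL2_le f (C : R) : L2 f -> (sqL2 f <= C%:E)%E -> ip f f <= C.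
Proof.
move=> Lf; have -> : sqL2 f = (ip f f)%:E; last by rewrite lee_fin.
have Lge0 : (0 <= Lpnorm 2%:E f)%E by exact: Lnorm_ge0.
have -> : sqL2 f = (Lpnorm 2%:E f `^ 2)%E.
  rewrite /sqL2; case: (Lpnorm 2 f) Lge0 => [r|//|//] h /=.
    by rewrite -EFinM (@powR_mulrn R _ 2)// expr2.
  by rewrite mulyy ifF// pnatr_eq0.
rewrite sqnorm_integral /ip /Rintegral fineK//.
by apply: integrable_fin_num => //; exact: L2_mul_integrable.
Qed.

Lemma eq_weak_form mu nu wd c u ux ut ut' uxt chi chix :
  (forall x, x \in `[0, 1] -> ut x = ut' x) ->
  @weak_form R mu nu wd c u ux ut uxt chi chix = weak_form mu nu wd c u ux ut' uxt chi chix.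
Proof.
move=> E; rewrite /weak_form; congr (_ + _); last first.
  congr (_ * _); apply: eq_bigr => i _.
  have -> : ut i%:R = ut' i%:R by apply: E; rewrite in_itv/= ler0n lern1; case: i => -[|[]].
  by [].
do 5 congr (_ + _); apply: eq_ip => // x xI; apply: E.
by move: xI; rewrite inE.
Qed.

Lemma mul_le_fin (k : R) (x : \bar R) (C : R) : 0 < k -> (0 <= x)%E -> (k%:E * x <= C%:E)%E ->
  (x <= (C / k)%:E)%E.
Proof.
move=> k0 x0; case: x x0 => [r|//|//].
  by move=> _; rewrite -EFinM !lee_fin ler_pdivlMr// mulrC.
by rewrite gt0_muley ?lte_fin// leye_eq.
Qed.

Lemma le_adde6 (a b x d e y s : \bar R) : (0 <= a -> 0 <= b -> 0 <= x -> 0 <= d -> 0 <= e ->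
  0 <= y -> a + b + x + d + e + y <= s -> [/\ a <= s, b <= s, d <= s & e <= s])%E.
Proof.
move=> a0 b0 x0 d0 e0 y0; rewrite -!addeA => h.
have hb : (b + (x + (d + (e + y))) <= s)%E by apply: le_trans h; rewrite leeDr.
have hd : (d + (e + y) <= s)%E.
  by apply: le_trans hb; apply: (@le_trans _ _ (x + (d + (e + y)))%E); rewrite leeDr.
split.
- by apply: le_trans h; rewrite leeDl// !adde_ge0.
- by apply: le_trans hb; rewrite leeDl// !adde_ge0.
- by apply: le_trans hd; rewrite leeDl// !adde_ge0.
- by apply: le_trans hd; apply: (@le_trans _ _ (e + y)%E); rewrite ?leeDl// leeDr.
Qed.

Variables (mu nu wd : R) (c : 'I_2 -> R).
Hypotheses (mu_gt0 : 0 < mu) (nu_gt0 : 0 < nu) (wd_ge0 : 0 <= wd).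
Hypothesis c_gt0 : forall i, 0 < c i.

(** Zero serves as a comparison state: stability against it bounds [w_t] by [w], and the energy
    about it gives decay. *)
Lemma weak_form0 chi chix : H1 chi chix ->
  weak_form mu nu wd c (fun=> 0) (fun=> 0) (fun=> 0) (fun=> 0) chi chix = 0.
Proof.
move=> H; rewrite (weak_formE_parts mu wd nu_gt0 c_gt0 _ _ (H1_cst 0) H).
have z0 h : L2 h -> ip (fun=> 0 : R) h = 0.
  move=> Lh; rewrite -[RHS](mul0r (ip h h)) -ipZl//.
  by congr ip; apply/funext => y; rewrite mul0r.
have -> : ip (fun=> 0 ^+ 2 : R) chix = 0.
  by rewrite (_ : (fun=> _) = (fun=> 0)) ?z0//; [exact: H1_L2d H|apply/funext => y; rewrite expr0n].
by rewrite !z0; [rewrite /boundary_term; ring|exact: H1_L2d H|exact: H1_L2 H].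
Qed.

(** The equation constrains [wt] only up to a null set of times. Let [S] be the dense set of times
    at which the equation and all bounds hold. There [wt] is bounded, so [w] is Lipschitz in time,
    and [stationary_stability] makes [wt] Lipschitz on [S]; [G] is its extension. As [G] equals [wt]
    almost everywhere, [w] is the primitive of a continuous function and has the classical
    derivative [G]. *)
Lemma closed_loop_regularity (w0 : R -> R) (w : R -> R -> R) :
  closed_loop_solution mu nu wd c w0 w ->
  exists (G : R -> R -> R) (S : set R) (M C : R),
  [/\ 0 <= M /\ 0 <= C,
      forall a b, 0 <= a -> a < b -> exists t, [/\ a < t, t < b & S t],
      forall t, S t -> 0 < t /\ exists ux uxt, [/\ H1 (w t) ux, H1 (G t) uxt &
        forall chi chix, H1 chi chix -> weak_form mu nu wd c (w t) ux (G t) uxt chi chix = 0] &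
   [/\ forall t x, 0 <= t -> x \in `[0, 1] -> `|w t x| <= M,
      forall s t x, 0 <= s -> 0 <= t -> x \in `[0, 1] -> `|w t x - w s x| <= M * `|t - s|,
      forall s t x, x \in `[0, 1] -> `|G t x - G s x| <= C * `|t - s|,
      forall t x, 0 < t -> x \in `[0, 1] -> is_derive t 1 (fun t => w t x) (G t x) &
      forall t (d : R), 0 < t -> (forall x, x \in `[0, 1] -> `|w t x| <= d) ->
        forall x, x \in `[0, 1] -> `|G t x| <= C * d]].
Proof.
have mu0 := mu_gt0.
move=> [wx [wxx [wt [wxt [wxxt [[Hw [mwt _ Hwt _] wE weak] [_ _ _ [B0 bnd]]]]]]]].
pose Q t := [/\ H1 (wt t) (wxt t),
   forall chi chix, H1 chi chix ->
           weak_form mu nu wd c (w t) (wx t) (wt t) (wxt t) chi chix = 0 &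
   [/\ (sqL2 (w t) <= B0%:E)%E, (sqL2 (wx t) <= B0%:E)%E,
       (sqL2 (wt t) <= B0%:E)%E & (sqL2 (wxt t) <= (B0 / mu)%:E)%E]].
have aeQ : {ae leb, forall t, 0 < t -> Q t}.
  have sq0 f : (0 <= sqL2 f)%E by exact: sqre_ge0.
  have FF := ae_filter_ringOfSetsType leb.
  apply: filterS3 Hwt weak bnd => t h1 h2 h3 t0; split; [exact: h1|exact: h2|].
  have I0 : (0 <= \int[leb]_(s in `[0%R, t]) (sqL2 (wt s) + sqL2 (wxt s) + mu%:E * sqL2 (wxxt s)))%E.
    by apply: integral_ge0 => s _; rewrite !adde_ge0// mule_ge0// lee_fin ltW.
  have mx0 : (0 <= mu%:E * sqL2 (wxt t))%E by rewrite mule_ge0// lee_fin ltW.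
  have [b1 b2 b3 b4] := le_adde6 (sq0 _) (sq0 _) (sq0 _) (sq0 _) mx0 I0 (h3 t0).
  by split=> //; exact: mul_le_fin.
have dense := ae_positive_dense aeQ.
pose S := [set t | 0 < t /\ Q t].
have Sdense a b : 0 <= a -> a < b -> exists t, [/\ a < t, t < b & S t].
  move=> a0 ab; have [t [at1 tb Qt]] := dense a b a0 ab.
  by exists t; split=> //; split=> //; exact: le_lt_trans at1.
have [t0 [t00 _ [_ Qt0]]] := Sdense 0 1 (lexx _) ltr01.
have B00 : 0 <= B0.
  have [H _ [_ _ b3 _]] := Qt0; apply: le_trans (ip_ge0 _) (sqL2_le (H1_L2 H) b3).
have Bmu0 : 0 <= B0 / mu by pos.
(* The final 1 ensures [M <= M ^+ 2], so a bound [M] on the square in the Sobolev inequality is also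
   a bound on the absolute value. *)
pose M := 4 * (2 * B0 + B0 / mu) + 1.
have M0 : 0 <= M by rewrite /M; lra.
have sob f f' (C : R) x : H1 f f' -> x \in `[0, 1] -> ip f f + ip f' f' <= C ->
    4 * C + 1 <= M -> `|f x| <= M.
  move=> H xI fC CM; apply: sqr_le_norm => //; apply: (le_trans (sobolev H xI)).
  have C0 : 0 <= C by apply: le_trans fC; rewrite addr_ge0// ip_ge0.
  by apply: (@le_trans _ _ M); [lra|rewrite expr2 ler_peMl//; lra].
have SwM t x : S t -> x \in `[0, 1] -> `|w t x| <= M.
  move=> [tp [_ _ [b1 b2 _ _]]] xI; have Ht := Hw t (ltW tp).
  apply: (sob _ _ (2 * B0) x Ht) => //; last by rewrite /M; lra.
  by have := sqL2_le (H1_L2 Ht) b1; have := sqL2_le (H1_L2d Ht) b2; lra.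
have SwtM t x : S t -> x \in `[0, 1] -> `|wt t x| <= M.
  move=> [tp [Ht _ [_ _ b3 b4]]] xI.
  apply: (sob _ _ (B0 + B0 / mu) x Ht) => //; last by rewrite /M; lra.
  by have := sqL2_le (H1_L2 Ht) b3; have := sqL2_le (H1_L2d Ht) b4; lra.
have FF := ae_filter_ringOfSetsType leb.
have wE' (h : R -> R) x t : 0 <= t -> x \in `[0, 1] ->
    measurable_fun (`[0, t]%classic : set R) h ->
    (forall s, S s -> wt s x = h s) -> w t x = w0 x + \int[leb]_(s in `[0, t]) h s.
  move=> tp xI mh E; rewrite wE//; congr (_ + _).
  apply: Rintegral_ae_eq => //; first exact: spacetime_measurable_section mwt xI.
  by apply: filterS aeQ => s Qs s0; apply: E; split=> //; exact: Qs.
have wlip' s t x : 0 <= s -> s <= t -> x \in `[0, 1] -> `|w t x - w s x| <= M * (t - s).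
  move=> s0 st xI; have tp := le_trans s0 st.
  (* Truncation changes nothing on [S] and gives the bound at every time that [Rintegral_lipschitz]
     asks for. *)
  pose h r := Num.max (- M) (Num.min M (wt r x)).
  have hM r : `|h r| <= M.
    rewrite ler_norml /h le_max lexx/= ge_max ge_min lexx andbT; lra.
  have mh r : measurable_fun (`[0, r]%classic : set R) h.
    apply: measurable_maxr; first exact: measurable_cst.
    apply: measurable_minr; first exact: measurable_cst.
    exact: spacetime_measurable_section mwt xI.
  have hE r : S r -> wt r x = h r.
    move=> /SwtM /(_ xI); rewrite ler_norml => /andP[h1 h2].
    by rewrite /h (min_idPr h2) (max_idPr h1).
  rewrite (wE' h)// (wE' h x s)// opprD addrACA subrr add0r.
  exact: Rintegral_lipschitz.
have wlip s t x : 0 <= s -> 0 <= t -> x \in `[0, 1] -> `|w t x - w s x| <= M * `|t - s|.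
  move=> s0 tp xI; have [st|/ltW ts] := leP s t.
    by rewrite (ger0_norm (_ : 0 <= t - s)) ?subr_ge0//; exact: wlip'.
  rewrite distrC (distrC t) (ger0_norm (_ : 0 <= s - t)) ?subr_ge0//; exact: wlip'.
have wM t x : 0 <= t -> x \in `[0, 1] -> `|w t x| <= M.
  move=> tp xI; apply/ler_addgt0Pr => e e0.
  have Mp : 0 < M + 1 by lra.
  have [s [ts se Ss]] := Sdense t (t + e / (M + 1)) tp (ltr_pwDr (divr_gt0 e0 Mp) (lexx t)).
  have h1 := SwM s x Ss xI; have h2 := wlip' t s x tp (ltW ts) xI.
  have : M * (s - t) <= e.
    have : s - t <= e / (M + 1) by lra.
    by rewrite ler_pdivlMr//; lra.
  have := ler_distD (w s x) (w t x) 0; rewrite !subr0 (distrC (w t x)); lra.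
have [C1 C10 stab] := stationary_stability mu_gt0 nu_gt0 wd_ge0 c_gt0 M.
pose L := C1 * M; have L0 : 0 <= L by rewrite mulr_ge0.
have Slip s t x : x \in `[0, 1] -> S s -> S t -> `|wt t x - wt s x| <= L * `|t - s|.
  move=> xI Ss St; have [sp [Hs ws _]] := Ss; have [tp [Ht wkt _]] := St.
  have := stab _ _ _ _ _ _ _ _ (Hw t (ltW tp)) Ht (Hw s (ltW sp)) Hs wkt ws
    (fun x => SwM t x St) (fun x => SwM s x Ss) (fun x => SwtM s x Ss) (M * `|t - s|)
    (fun x => wlip s t x (ltW sp) (ltW tp)) x xI.
  by rewrite /L mulrA.
have SS0 : S !=set0 by exists t0; split=> //.
have ext x : exists g : R -> R, x \in `[0, 1] -> (forall t, S t -> g t = wt t x) /\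
    forall s t, `|g t - g s| <= L * `|t - s|.
  have [xI|xI] := boolP (x \in `[0, 1]); last by exists (fun=> 0).
  have [g hg] := lipschitz_extension L0 SS0 (fun s t => @Slip s t x xI).
  by exists g.
have [G' hG] := choice ext; pose G t x := G' x t.
have GS t x : S t -> x \in `[0, 1] -> G t x = wt t x by move=> St xI; exact: (hG x xI).1.
have Glip s t x : x \in `[0, 1] -> `|G t x - G s x| <= L * `|t - s| by move=> xI; exact: (hG x xI).2.
have Gcont x : x \in `[0, 1] -> continuous (fun t => G t x).
  move=> xI t; apply/cvgrPdist_lt => e e0 /=.
  have Lp : 0 < L + 1 by lra.
  apply/nbhs_ballP; exists (e / (L + 1)); first exact: divr_gt0.
  move=> s; rewrite /ball/= ltr_pdivlMr// => h.
  apply: le_lt_trans (Glip s t x xI) _; have := normr_ge0 (t - s); nra.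
have st0 t (d : R) : S t -> (forall x, x \in `[0, 1] -> `|w t x| <= d) ->
    forall x, x \in `[0, 1] -> `|G t x| <= C1 * d.
  move=> St wd' x xI; rewrite GS//; have [tp [Ht wkt _]] := St.
  have z y : y \in `[0, 1] -> `|0 : R| <= M by move=> _; rewrite normr0.
  have := stab _ _ _ _ _ _ _ _ (Hw t (ltW tp)) Ht (H1_cst 0) (H1_cst 0) wkt _
    (fun x => SwM t x St) z z d _ x xI.
  rewrite subr0; apply.
    by move=> chi chix; exact: weak_form0.
  by move=> y yI; rewrite subr0 wd'.
exists G, S, M, (L + C1); split.
- by split=> //; rewrite addr_ge0.
- exact: Sdense.
- move=> t St; have [tp [Ht wkt _]] := St; split=> //.
  exists (wx t), (wxt t); split.
  + exact: Hw (ltW tp).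
  + by apply: eq_H1 Ht => x; rewrite inE => xI; rewrite GS.
  + move=> chi chix H; rewrite -(wkt chi chix H); apply: eq_weak_form => x xI.
    exact: GS.
- split=> //.
  + move=> s t x xI; apply: (le_trans (Glip s t x xI)).
    by rewrite ler_wpM2r//; lra.
  + move=> t x tp xI.
    have mG r : measurable_fun (`[0, r]%classic : set R) (fun t => G t x).
      by apply: measurable_funTS; apply: continuous_measurable_fun; exact: Gcont.
    have Gint : leb.-integrable `[0, t + 1] (EFin \o (fun t => G t x)).
      apply: continuous_compact_integrable; first exact: segment_compact.
      by apply: continuous_subspaceT; exact: Gcont.
    (* The interval of integration ends at [t + 1] to have [t] in its interior. *)
    have [] := @continuous_FTC1_closed R (fun t => G t x) 0 t (t + 1) _ Gint tp (Gcont x xI t).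
      by rewrite ltrDl.
    move=> D E.
    have near0 : \forall r \near t, 0 <= r.
      apply/nbhs_ballP; exists t => // r; rewrite /ball/= => h.
      by have := ler_norm (t - r); lra.
    have D' : is_derive t 1 (fun r => w0 x + \int[leb]_(s in `[0, r]) G s x) (G t x).
      have := @is_deriveD _ _ _ (fun=> w0 x) _ t 1 _ _ (is_derive_cst _ _ _) (DeriveDef D erefl).
      by rewrite -derive1E E add0r.
    apply: DeriveDef.
      have [d _] := D'.
      apply: near_eq_derivable d => //.
      near=> r; rewrite (wE' (fun t => G t x))//.
      + by near: r; exact: near0.
      + by move=> s Ss; rewrite GS.
    have [_ <-] := D'; apply: near_eq_derive => //.
    near=> r; rewrite (wE' (fun t => G t x))//.
    + by near: r; exact: near0.
    + by move=> s Ss; rewrite GS.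
  + move=> t d tp wd' x xI; apply: (@le_trans _ _ (C1 * d)); last first.
      have d0 : 0 <= d by exact: le_trans (wd' x xI).
      by rewrite ler_wpM2r//; lra.
    apply/ler_addgt0Pr => e e0.
    have CM0 := mulr_ge0 C10 M0.
    have Kp : 0 < C1 * M + L + 1 by lra.
    have [s [ts se Ss]] := Sdense t (t + e / (C1 * M + L + 1)) (ltW tp) (ltr_pwDr (divr_gt0 e0 Kp) (lexx t)).
    have ws y : y \in `[0, 1] -> `|w s y| <= d + M * (s - t).
      move=> yI; have := wlip' t s y (ltW tp) (ltW ts) yI; have := wd' y yI.
      have := ler_distD (w t y) (w s y) 0; rewrite !subr0; lra.
    have h1 := st0 s _ Ss ws x xI.
    have h2 := Glip t s x xI; rewrite (gtr0_norm (_ : 0 < s - t)) ?subr_gt0// in h2.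
    have h3 : (C1 * M + L) * (s - t) <= e.
      have : s - t <= e / (C1 * M + L + 1) by lra.
      by rewrite ler_pdivlMr//; lra.
    have := ler_distD (G s x) (G t x) 0; rewrite !subr0 (distrC (G t x)) => h4.
    have h5 : C1 * (d + M * (s - t)) = C1 * d + C1 * M * (s - t) by ring.
    by rewrite h5 in h1; rewrite mulrDl in h3; lra.
Unshelve. all: end_near.
Qed.

End TimeRegularity.

(** * Functions with essentially bounded derivatives *)

Section SupNorm.
Context {R : realType}.
Implicit Types (f : R -> R) (a b x k : R).
Local Notation leb := (@lebesgue_measure R).

Lemma Lpnorm_infty_le f k : 0 <= k -> (forall x, x \in `[0, 1] -> `|f x| <= k) ->
  (Lpnorm +oo%E f <= k%:E)%E.
Proof.
move=> k0 fk; rewrite /Lpnorm unlock; case: ifP => _; last by rewrite lee_fin.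
apply/ess_supP; apply: nearW => x /=; rewrite lee_fin patchE.
by case: ifPn => [xI|_]; rewrite ?normr0//; apply: fk; move: xI; rewrite inE.
Qed.

Lemma memLp_infty_bounded f : memLp +oo%E f ->
  exists2 k, 0 <= k & {ae leb, forall x, x \in `[0, 1] -> `|f x| <= k}.
Proof.
move=> [_]; rewrite /Lpnorm unlock ifT => [fin|]; last first.
  by apply: lt_le_trans (le_measure leb _ _ (@subsetT _ (`[0, 1]%classic))); rewrite ?inE//= lebesgue_measure_itv/= lte_fin ltr01 -EFinB lte_fin subr0.
have [k k0 kk] : exists2 k : R, 0 <= k & (ess_sup leb (abse \o (EFin \o f \_ `[0%R, 1%R])) <= k%:E)%E.
  case: (ess_sup _ _) fin => [r|//|] _; last by exists 0; rewrite ?leNye.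
  by exists `|r|; rewrite // lee_fin ler_norm.
exists k => //; have FF := ae_filter_ringOfSetsType leb.
move/ess_supP: kk; apply: filterS => x /= + xI; rewrite lee_fin patchE ifT//.
by rewrite inE.
Qed.

(** The derivative is bounded only almost everywhere; truncating it leaves its integrals unchanged
    and makes the bound hold everywhere. *)
Lemma W1p_infty_lipschitz f f' : W1p +oo%E f f' -> exists2 k, 0 <= k &
  forall a b, 0 <= a -> a <= b -> b <= 1 -> `|f b - f a| <= k * (b - a).
Proof.
move=> [Lf' fE]; have [k k0 fk] := memLp_infty_bounded Lf'; exists k => // a b a0 ab b1.
have sub t : t <= 1 -> measurable_fun (`[0, t]%classic : set R) f'.
  move=> t1; apply: measurable_funS Lf'.1 => // x /=; rewrite !in_itv/= => /andP[-> xt].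
  exact: le_trans xt t1.
pose h r := if r <= 1 then Num.max (- k) (Num.min k (f' r)) else 0.
pose h' r := Num.max (- k) (Num.min k (f' r)).
have hk r : `|h r| <= k.
  rewrite /h; case: ifP => _; rewrite ?normr0//.
  by rewrite ler_norml le_max lexx/= ge_max ge_min lexx andbT; lra.
have mh t : t <= 1 -> measurable_fun (`[0, t]%classic : set R) h.
  move=> t1; apply: (@eq_measurable_fun _ _ _ _ _ h').
    move=> x; rewrite inE/= in_itv/= => /andP[_ xt].
    by rewrite /h ifT//; exact: le_trans xt t1.
  apply: measurable_maxr; first exact: measurable_cst.
  by apply: measurable_minr; [exact: measurable_cst|exact: sub].
have E t : 0 <= t -> t <= 1 -> f t = f 0 + \int[leb]_(y in `[0, t]) h y.
  move=> t0 t1; rewrite fE; last by rewrite in_itv/= t0.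
  congr (_ + _).
  rewrite /Rintegral; congr fine; apply: ae_eq_integral => //.
  - by apply/measurable_EFinP; exact: sub.
  - by apply/measurable_EFinP; exact: mh.
  have FF := ae_filter_ringOfSetsType leb.
  apply: filterS fk => x hx /=; rewrite in_itv/= => /andP[x0 xt].
  have x1 : x <= 1 by exact: le_trans xt t1.
  have := hx; rewrite in_itv/= x0 x1 => /(_ isT); rewrite ler_norml => /andP[h1 h2].
  by rewrite /h x1 (min_idPr h2) (max_idPr h1).
rewrite (E b)// ?(le_trans a0)// (E a)// ?(le_trans ab)// opprD addrACA subrr add0r.
by apply: Rintegral_lipschitz => //; exact: mh.
Qed.

(** Divided differences over [a, x] and [x, b] are averages of the Lipschitz function [f'], hence
    both within O(b - a) of [f' x]. *)
Lemma W2p_infty_ierr f f' f'' : W2p +oo%E f f' f'' -> exists2 k, 0 <= k &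
  forall a x b, 0 <= a -> a <= x -> x <= b -> b <= 1 -> `|ierr f a x b| <= k * (b - a) ^+ 3.
Proof.
move=> [Wf Wf']; have [k k0 fk] := W1p_infty_lipschitz Wf'.
have H : H1 f f'.
  split; last exact: Wf.2.
  apply/memLp2P/(@L2_bounded _ _ (`|f' 0| + k)); first exact: Wf.1.1.
  move=> x; rewrite in_itv/= => /andP[x0 x1].
  have := fk 0 x (lexx _) x0 x1; rewrite subr0 => h.
  have : k * x <= k by rewrite ler_piMr.
  by have := ler_distD (f' 0) (f' x) 0; rewrite !subr0; lra.
exists (2 * k); first lra.
have k3 p : 0 <= p -> 0 <= 2 * k * p ^+ 3 by move=> p0; pos.
move=> a x b a0.
rewrite le_eqVlt => /predU1P[<-{x} xb _|ax].
  by rewrite (_ : ierr f a a b = 0) ?normr0 ?k3 ?subr_ge0//; rewrite /ierr; ring.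
rewrite le_eqVlt => /predU1P[<-{b} _|xb b1].
  by rewrite (_ : ierr f a x x = 0) ?normr0 ?k3 ?subr_ge0 ?(ltW ax)//; rewrite /ierr; ring.
have xa0 : 0 < x - a by rewrite subr_gt0.
have bx0 : 0 < b - x by rewrite subr_gt0.
have x0 : 0 <= x by exact: le_trans (ltW ax).
have x1 : x <= 1 by exact: le_trans (ltW xb) b1.
have L := H1_L2d H.
have fl y : a <= y <= b -> `|f' y - f' x| <= k * (b - a).
  move=> /andP[ay yb]; have [yx|/ltW xy] := leP y x.
    by rewrite distrC (le_trans (fk _ _ _ yx x1)) ?(le_trans a0)// ler_wpM2l//; lra.
  by rewrite (le_trans (fk _ _ x0 xy _)) ?(le_trans yb)// ler_wpM2l//; lra.
have A1 : `|ip f' (dramp a x) - f' x| <= k * (b - a).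
  by apply: average_bound => // y /andP[ay yx]; apply: fl; rewrite ay (le_trans yx)// ltW.
have A2 : `|ip f' (dramp x b) - f' x| <= k * (b - a).
  by apply: average_bound => // y /andP[ay yx]; apply: fl; rewrite yx (le_trans (ltW ax)).
rewrite (ip_dramp H)// in A1; rewrite (ip_dramp H)// in A2.
have -> : ierr f a x b = (x - a) * (b - x) *
   (((f x - f a) / (x - a) - f' x) - ((f b - f x) / (b - x) - f' x)).
  by rewrite /ierr; field; rewrite !lt0r_neq0.
have -> : 2 * k * (b - a) ^+ 3 = (b - a) ^+ 2 * (2 * (k * (b - a))) by ring.
apply: normM_le; last first.
  by have := ler_normB ((f x - f a) / (x - a) - f' x) ((f b - f x) / (b - x) - f' x); lra.
rewrite ger0_norm; last by rewrite mulr_ge0 ?ltW.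
rewrite expr2; apply: ler_pM; [exact: ltW|exact: ltW|by rewrite lerD2r ltW|].
by rewrite lerD2l lerN2 ltW.
Qed.

End SupNorm.

(** * Differential inequalities *)

Section Gronwall.
Context {R : realType}.
Implicit Types (F p q : R -> R).

Lemma lin_derive (a t : R) : is_derive t 1 (fun t => a * t) a.
Proof. by have := is_deriveZ a (is_derive_id t (1 : R)); rewrite /GRing.scale/= mulr1. Qed.

Lemma lin_continuous (a : R) : continuous (fun t => a * t).
Proof. by move=> t; apply: cvgMr; exact: cvg_id. Qed.

Lemma expR_derive (p : R -> R) (p' t : R) : is_derive t 1 p p' ->
  is_derive t 1 (fun t => expR (p t)) (expR (p t) * p').
Proof.
move=> dp; have := is_derive1_comp (is_derive_expR (p t)) dp; by rewrite /GRing.scale.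
Qed.

(** The function [F * expR p - q] is nonincreasing. A general exponent [p] covers decaying
    coefficients as well as constant rates; at time 0 only continuity is available. *)
Lemma gronwall F p q (F' p' q' : R -> R) :
  {within `[0, +oo[, continuous F} -> continuous p -> continuous q ->
  (forall t : R, 0 < t -> is_derive t 1 F (F' t)) ->
  (forall t : R, 0 < t -> is_derive t 1 p (p' t)) ->
  (forall t : R, 0 < t -> is_derive t 1 q (q' t)) ->
  (forall t : R, 0 < t -> (F' t + p' t * F t) * expR (p t) <= q' t) ->
  forall s t : R, 0 <= s -> s <= t ->
    F t * expR (p t) - q t <= F s * expR (p s) - q s.
Proof.
move=> cF cp cq dF dp dq H s t s0 st.
pose f t := F t * expR (p t) - q t.
have df (r : R) : 0 < r -> is_derive r 1 f ((F' r + p' r * F r) * expR (p r) - q' r).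
  move=> r0; have h1 := dF r r0; have h2 := dp r r0; have h3 := dq r r0.
  apply: is_deriveB => //.
  have h4 := expR_derive h2.
  have := is_deriveM h1 h4; rewrite /GRing.scale/= => h5.
  by apply: is_derive_eq h5 _; ring.
apply: (@ler0_derive1_nincry R f 0) => // [r|r|].
- by rewrite in_itv/= andbT => /df[].
- rewrite in_itv/= andbT => r0; have [_ D] := df r r0.
  by rewrite derive1E D subr_le0; exact: H.
- move=> x; apply: cvgB; last exact/continuous_subspaceT.
  apply: cvgM; first exact: cF.
  by apply: continuous_subspaceT => y; apply: continuous_comp; [exact: cp|exact: continuous_expR].
Qed.

(** After multiplication by [expR (g * t)] with [g = nu / mu], the source grows like [expR (d * t)]
    with [d = g - beta > 0], and [q] is a primitive of its bound. Monotonicity for both [y] and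
    [- y] is used from 0 to 1, to bound [y 0] by [y 1], and then from 0 to [t]. *)
Lemma ode_bound (mu nu beta : R) : 0 < mu -> 0 < nu -> 0 <= beta -> beta * mu < nu ->
  exists2 K0, 0 <= K0 & forall (y y' : R -> R) (K r : R), 0 <= K -> 0 <= r ->
  {within `[0, +oo[, continuous y} ->
  (forall t : R, 0 < t -> is_derive t 1 y (y' t)) ->
  (forall t : R, 0 < t -> `|mu * y' t + nu * y t| <= K * expR (- beta * t)) ->
  `|y 1| <= r -> forall t : R, 0 <= t -> `|y t| <= K0 * (K + r) * expR (- beta * t).
Proof.
move=> mu0 nu0 b0 bn.
pose g := nu / mu; pose d := g - beta; have d0 : 0 < d by rewrite subr_gt0 ltr_pdivlMr.
have g0 : 0 < g by exact: divr_gt0.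
pose k := (mu * d)^-1; have k0 : 0 < k by rewrite invr_gt0 mulr_gt0.
exists (k * (1 + expR d) + expR g).
  by have := expR_gt0 d; have := expR_gt0 g => h1 h2; pos.
move=> y y' K r K0 r0 cy dy H y1.
pose q (t : R) := K * k * expR (d * t).
have q0 t : 0 <= q t by rewrite /q; have := expR_gt0 (d * t) => h; pos.
have dq (t : R) : 0 < t -> is_derive t 1 q (K / mu * expR (d * t)).
  move=> t0; have h := is_deriveZ (K * k) (expR_derive (lin_derive d t)).
  apply: is_derive_eq h _; rewrite /GRing.scale/= /k; field.
  by rewrite !lt0r_neq0.
have cq : continuous q.
  by move=> t; apply: cvgMr; apply: continuous_comp; [exact: lin_continuous|exact: continuous_expR].
have A (z z' : R -> R) : {within `[0, +oo[, continuous z} ->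
    (forall t : R, 0 < t -> is_derive t 1 z (z' t)) ->
    (forall t : R, 0 < t -> mu * z' t + nu * z t <= K * expR (- beta * t)) ->
    forall s t : R, 0 <= s -> s <= t ->
    z t * expR (g * t) - q t <= z s * expR (g * s) - q s.
  move=> cz dz Hz; apply: (gronwall cz (@lin_continuous g) cq dz (fun t _ => lin_derive g t) dq) => t t0.
  have -> : z' t + g * z t = (mu * z' t + nu * z t) / mu by rewrite /g; field; rewrite lt0r_neq0.
  have -> : K / mu * expR (d * t) = K * expR (- beta * t) / mu * expR (g * t).
    have -> : d * t = - beta * t + g * t by rewrite /d; ring.
    by rewrite (expRD (- beta * t)); ring.
  by rewrite ler_wpM2r ?expR_ge0// ler_wpM2r ?invr_ge0 ?(ltW mu0)// Hz.
have Ap := A y y' cy dy (fun t t0 => le_trans (ler_norm _) (H t t0)).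
have Am : forall s t : R, 0 <= s -> s <= t ->
    - y t * expR (g * t) - q t <= - y s * expR (g * s) - q s.
  apply: (A (fun t => - y t) (fun t => - y' t)).
  - by move=> x; apply: cvgN; exact: cy.
  - by move=> t t0; have h := dy t t0; exact: is_deriveN.
  - move=> t t0; apply: le_trans (H t t0); rewrite -normrN.
    by apply: (le_trans _ (ler_norm _)); lra.
have yk : `|y 0| <= q 1 + r * expR g.
  have := Ap 0 1 (lexx _) ler01; have := Am 0 1 (lexx _) ler01.
  rewrite !mulr0 !mulr1 expR0 !mulr1 => h1 h2; have h3 := q0 0.
  have : `|y 1 * expR g| <= r * expR g.
    by rewrite normrM (ger0_norm (expR_ge0 _)) ler_wpM2r ?expR_ge0.
  by rewrite ler_norml => /andP[h4 h5]; rewrite ler_norml; apply/andP; split; lra.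
move=> t t0.
have yt : `|y t| * expR (g * t) <= q t + `|y 0|.
  have := Ap 0 t (lexx _) t0; have := Am 0 t (lexx _) t0.
  rewrite !mulr0 expR0 !mulr1 => h1 h2; have h3 := q0 0.
  have := ler_norm (y 0); have := ler_norm (- y 0); rewrite normrN.
  by case: (ger0P (y t)) => _; lra.
rewrite -(ler_pM2r (expR_gt0 (g * t))); apply: (le_trans yt).
have -> : (k * (1 + expR d) + expR g) * (K + r) * expR (- beta * t) * expR (g * t)
   = (k * (1 + expR d) + expR g) * (K + r) * expR (d * t).
  have -> : d * t = - beta * t + g * t by rewrite /d; ring.
  by rewrite (expRD (- beta * t)); ring.
have E1 : 1 <= expR (d * t) by rewrite -expR0 ler_expR; pos.
have y0E : `|y 0| <= (q 1 + r * expR g) * expR (d * t).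
  by apply: (le_trans yk); rewrite ler_peMr// addr_ge0// mulr_ge0// expR_ge0.
apply: (le_trans (lerD (lexx (q t)) y0E)); rewrite /q mulr1 -mulrDl.
rewrite ler_wpM2r ?expR_ge0//.
have p1 : 0 <= K * expR g by rewrite mulr_ge0// expR_ge0.
have p2 : 0 <= k * (1 + expR d) * r by have := expR_gt0 d => h; pos.
by lra.
Qed.

Lemma le_of_dense (S : set R) (f g : R -> R) (t : R) :
  (forall a b : R, 0 <= a -> a < b -> exists s, [/\ a < s, s < b & S s]) ->
  (forall s, S s -> f s <= g s) -> 0 <= t ->
  f @ t --> f t -> g @ t --> g t -> f t <= g t.
Proof.
move=> dense fg t0 cf cg; rewrite leNgt; apply/negP => gf.
pose e := (f t - g t) / 2; have e0 : 0 < e by rewrite divr_gt0// subr_gt0.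
have /cvgrPdist_lt /(_ e e0) := cf; have /cvgrPdist_lt /(_ e e0) := cg.
move=> h1 h2; have /nbhs_ballP[d d0 hd] : nbhs t (fun r => `|f t - f r| < e /\ `|g t - g r| < e).
  exact: filterI h2 h1.
have [s [ts st Ss]] := dense t (t + d) t0 (ltr_pwDr d0 (lexx t)).
have [] := hd s; first by rewrite /ball/= distrC gtr0_norm ?subr_gt0//; lra.
rewrite /= !ltr_norml /e => /andP[p1 p2] /andP[p3 p4].
by have := fg s Ss; lra.
Qed.

Lemma is_derive_cvg (f : R -> R) (t l : R) : is_derive t 1 f l -> f @ t --> f t.
Proof. by case=> /derivable1_diffP/differentiable_continuous. Qed.

Lemma lipschitz_cvg (f : R -> R) (k t : R) : (forall s, `|f t - f s| <= k * `|t - s|) ->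
  f @ t --> f t.
Proof.
move=> fk; apply/cvgrPdist_lt => e e0 /=; pose k' := `|k| + 1.
have k0 : 0 < k' by rewrite ltr_pwDr.
apply/nbhs_ballP; exists (e / k'); first exact: divr_gt0.
move=> s; rewrite /ball/= ltr_pdivlMr// => h.
apply: le_lt_trans (fk s) (le_lt_trans _ h); rewrite mulrC ler_wpM2l//.
by rewrite /k'; have := ler_norm k; lra.
Qed.

End Gronwall.

(** * Interpolation errors, energy in time and discrete initial data *)

Section DiscreteTime.
Context {R : realType}.
Implicit Types (f g h z : R -> R) (s : seq R).

Lemma interp_bound s f k : itv_partition 0 1 s -> (forall x, x \in `[0, 1] -> `|f x| <= k) ->
  forall x, x \in `[0, 1] -> `|interp s f x| <= k.
Proof.
move=> sP fk x xI; have [j js jx] := node_locate sP xI.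
have [a0 ab b1] := node_bounds sP js; rewrite (interp_local sP f js jx).
have fa := fk _ (node_I01 sP (ltnW js)); have fb := fk _ (node_I01 sP js).
move: jx a0 ab b1 fa fb; move: (node s j) (node s j.+1) => a b /andP[ax xb] a0 ab b1 fa fb.
have ba : 0 < b - a by rewrite subr_gt0.
set r := (x - a) / (b - a).
have r0 : 0 <= r by rewrite divr_ge0// ?subr_ge0// ltW.
have r1 : r <= 1 by rewrite ler_pdivrMr// mul1r lerB.
have -> : f a + (f b - f a) * r = (1 - r) * f a + r * f b by ring.
have -> : k = (1 - r) * k + r * k by ring.
apply: (le_trans (ler_normD _ _)); apply: lerD; apply: normM_le => //.
  by rewrite ger0_norm// subr_ge0.
by rewrite ger0_norm.
Qed.

Lemma interp_error s f k : itv_partition 0 1 s -> 0 <= k ->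
  (forall a x b, 0 <= a -> a <= x -> x <= b -> b <= 1 -> `|ierr f a x b| <= k * (b - a) ^+ 3) ->
  forall x, x \in `[0, 1] -> `|interp s f x - f x| <= k * mesh_size s ^+ 2.
Proof.
move=> sP k0 fk x xI; have [j js jx] := node_locate sP xI.
have [a0 ab b1] := node_bounds sP js; rewrite (interp_local sP f js jx).
have ba : 0 < node s j.+1 - node s j by rewrite subr_gt0.
have /andP[ax xb] := jx.
have -> : f (node s j) + (f (node s j.+1) - f (node s j)) * ((x - node s j) / (node s j.+1 - node s j))
   - f x = - ierr f (node s j) x (node s j.+1) / (node s j.+1 - node s j).
  by rewrite /ierr; field; rewrite lt0r_neq0.
rewrite normrM normfV (gtr0_norm ba) ler_pdivrMr// normrN.
apply: (le_trans (fk _ _ _ a0 ax xb b1)).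
rewrite exprSr mulrA ler_wpM2r ?(ltW ba)// ler_wpM2l// lerXn2r ?nnegrE ?(ltW ba)//.
  exact: mesh_ge0.
exact: mesh_ge.
Qed.

Lemma dinterp_le s f f' : itv_partition 0 1 s -> H1 f f' ->
  ip (dinterp s f) (dinterp s f) <= ip f' f' :> R.
Proof.
move=> sP H; have Lf := H1_L2d H; have Ld := L2_dinterp sP f.
have := ip_ge0 (fun x => f' x - dinterp s f x).
rewrite ipBl//; last exact: L2B.
rewrite !ipBr// (ipC (dinterp s f) f') (ip_dinterp_interp sP _ H).
lra.
Qed.

Lemma eq_interp (s : seq R) f g : itv_partition 0 1 s -> (forall x, x \in `[0, 1] -> f x = g x) ->
  interp s f = interp s g /\ dinterp s f = dinterp s g :> (R -> R).
Proof.
move=> sP fg.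
have E j : (j <= size s)%N -> f (node s j) = g (node s j) by move=> js; apply: fg; exact: node_I01.
split; apply/funext => x.
  rewrite /interp fg ?I01_0//; congr (_ + _); apply: eq_bigr => j _.
  by rewrite !E// ltnW.
by apply: eq_bigr => j _; rewrite !E// ltnW.
Qed.

Lemma exists_partition (n : nat) : exists s : seq R, itv_partition 0 1 s /\
  mesh_size s <= n.+1%:R^-1.
Proof.
pose s : seq R := mkseq (fun i => i.+1%:R / n.+1%:R) n.+1.
have n0 : 0 < n.+1%:R :> R by [].
have nodeE j : (j <= n.+1)%N -> node s j = j%:R / n.+1%:R.
  case: j => [|j] jn; first by rewrite /node/= mul0r.
  by rewrite /node -[nth _ _ _]/(nth 0 s j) nth_mkseq.
exists s; split.
  split; last first.
    by apply/eqP; rewrite -nth_last size_mkseq/= -[nth _ _ _]/(nth 0 s n) nth_mkseq//= divff.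
  apply/(pathP 0) => j; rewrite size_mkseq => jn.
  rewrite -[nth 0 (0 :: s) j]/(node s j) nodeE ?(ltnW jn)// nth_mkseq//.
  by rewrite ltr_pM2r ?invr_gt0// ltr_nat.
rewrite /mesh_size; apply: bigmax_le; first by rewrite invr_ge0.
have sz : size s = n.+1 by rewrite size_mkseq.
move=> j _; have := ltn_ord j; rewrite [X in (_ < X)%N -> _]sz; move: (nat_of_ord j) => {}j js.
rewrite -/(node s j) -/(node s j.+1) !nodeE//; last exact: ltnW.
by rewrite -mulrBl -natr1 addrAC subrr add0r mul1r.
Qed.

Lemma interp_derive s (z : R -> R -> R) (z' : R -> R) (t x : R) : itv_partition 0 1 s ->
  (forall j, (j <= size s)%N -> is_derive t 1 (fun t => z t (node s j)) (z' (node s j))) ->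
  is_derive t 1 (fun t => interp s (z t) x) (interp s z' x).
Proof.
move=> sP; apply: (@nodal_linear_derive _ _ (fun f => interp s f x)).
exists 1, (fun j => ramp (node s j) (node s j.+1) x) => f.
by rewrite mulr1.
Qed.

(** Near a positive time the function coincides with its interpolant, which is differentiated
    through its nodal values. *)
Lemma Vh_time_derive s (z : R -> R -> R) (z' : R -> R) (t : R) : itv_partition 0 1 s -> 0 < t ->
  (forall t : R, 0 <= t -> Vh s (z t)) ->
  (forall x : R, x \in `[0, 1] -> is_derive t 1 (fun t => z t x) (z' x)) ->
  forall x, x \in `[0, 1] -> z' x = interp s z' x.
Proof.
move=> sP t0 Vz dz x xI.
have D1 := dz x xI.
have D2 : is_derive t 1 (fun t => interp s (z t) x) (interp s z' x).
  by apply: interp_derive => // j js; apply: dz; exact: node_I01.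
have [_ <-] := D1; have [_ <-] := D2; apply: near_eq_derive => //.
apply/nbhs_ballP; exists t => // r; rewrite /ball/= => h.
apply: Vh_interpE => //; apply: Vz.
by have := ler_norm (t - r); lra.
Qed.

Variables (mu nu wd : R) (c : 'I_2 -> R).
Hypotheses (mu_gt0 : 0 < mu) (nu_gt0 : 0 < nu) (wd_ge0 : 0 <= wd).
Hypothesis c_gt0 : forall i, 0 < c i.

Lemma weak_form_interp_cvg s (u ut : R -> R -> R) z (t : R) : itv_partition 0 1 s ->
  (forall x, x \in `[0, 1] -> u r x @[r --> t] --> u t x) ->
  (forall x, x \in `[0, 1] -> ut r x @[r --> t] --> ut t x) ->
  weak_form mu nu wd c (interp s (u r)) (dinterp s (u r)) (interp s (ut r)) (dinterp s (ut r))
    (interp s z) (dinterp s z) @[r --> t] -->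
  weak_form mu nu wd c (interp s (u t)) (dinterp s (u t)) (interp s (ut t)) (dinterp s (ut t))
    (interp s z) (dinterp s z).
Proof.
move=> sP cu cut.
have Hz := H1_interp sP z.
have nu' j : (j <= size s)%N -> u r (node s j) @[r --> t] --> u t (node s j).
  by move=> js; apply: cu; exact: node_I01.
have nut j : (j <= size s)%N -> ut r (node s j) @[r --> t] --> ut t (node s j).
  by move=> js; apply: cut; exact: node_I01.
under eq_fun do rewrite (weak_formE mu wd nu_gt0 c_gt0) !interp0// !interp1//.
rewrite (weak_formE mu wd nu_gt0 c_gt0) !interp0// !interp1//.
have L1 := nodal_linear_interp sP (H1_L2 Hz).
have L2 := nodal_linear_dinterp s (H1_L2d Hz).
have L3 := nodal_linear_dinterp s (H1_L2 Hz).
have B := nodal_bilinear_convection sP Hz.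
have c1 := nodal_linear_cvg (FF := nbhs_filter t) L1 nut.
have c2 := nodal_linear_cvg (FF := nbhs_filter t) L2 nut.
have c3 := nodal_linear_cvg (FF := nbhs_filter t) L2 nu'.
have c4 := nodal_linear_cvg (FF := nbhs_filter t) L3 nu'.
have c5 := nodal_bilinear_cvg (FF := nbhs_filter t) B nu' nu'.
have bt i x : x \in `[0, 1] -> boundary_term mu nu wd c i (u r x) (ut r x) @[r --> t] -->
    boundary_term mu nu wd c i (u t x) (ut t x).
  move=> xI; have h1 := cu x xI; have h2 := cut x xI.
  have sq : u r x ^+ 2 @[r --> t] --> u t x ^+ 2 by rewrite expr2; under eq_fun do rewrite expr2; exact: cvgM.
  have cb : u r x ^+ 3 @[r --> t] --> u t x ^+ 3.
    by rewrite exprS; under eq_fun do rewrite exprS; exact: cvgM.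
  rewrite /boundary_term; apply: cvgD; first by apply: cvgD; exact: cvgMr.
  by apply: cvgMr; apply: cvgD; apply: cvgMr => //; exact: cvgM.
apply: cvgD; last by apply: cvgMl; apply: bt; exact: I01_1.
apply: cvgD; last by apply: cvgMl; apply: bt; exact: I01_0.
apply: cvgD => //; apply: cvgD; last exact: cvgMr.
apply: cvgD; last exact: cvgMr.
by apply: cvgD; [|exact: cvgMr].
Qed.

Lemma energy_derive s (B z : R -> R -> R) (B' z' : R -> R) (t : R) : itv_partition 0 1 s ->
  (forall x, x \in `[0, 1] -> is_derive t 1 (fun t => B t x) (B' x)) ->
  (forall x, x \in `[0, 1] -> is_derive t 1 (fun t => z t x) (z' x)) ->
  is_derive t 1 (fun t => energy mu nu wd c (B t) (interp s (z t)) (dinterp s (z t)))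
    (denergy mu nu wd c (B t) B' (interp s (z t)) (dinterp s (z t)) (interp s z') (dinterp s z')).
Proof.
move=> sP dB dz.
have nz j : (j <= size s)%N -> is_derive t 1 (fun t => z t (node s j)) (z' (node s j)).
  by move=> js; apply: dz; exact: node_I01.
have d1 := nodal_bilinear_derive (nodal_bilinear_interp sP) nz nz.
have d2 := nodal_bilinear_derive (nodal_bilinear_dinterp sP) nz nz.
have dn i x : x \in `[0, 1] -> is_derive t 1 (fun t => energy_node wd c i (B t x) (z t x))
    (denergy_node wd c i (B t x) (B' x) (z t x) (z' x)).
  move=> xI; have h1 := dB x xI; have h2 := dz x xI.
  have h22 := is_derive_mul h2 h2; have h23 := is_derive_mul h2 h22.
  have h24 := is_derive_mul h2 h23; have h11 := is_derive_mul h1 h1.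
  have h123 := is_derive_mul h1 h23; have h1122 := is_derive_mul h11 h22.
  have := is_deriveD (is_deriveZ (1 + c i + wd) h22) (is_deriveZ (9 * c i)^-1 (is_deriveD
    (is_deriveD (is_deriveZ 3 h24) (is_deriveZ 8 h123)) (is_deriveZ 6 h1122))).
  rewrite /GRing.scale/= => D.
  have -> : (fun t => energy_node wd c i (B t x) (z t x)) = (fun t => (1 + c i + wd) * (z t x * z t x) + (9 * c i)^-1 *
     (3 * (z t x * (z t x * (z t x * z t x))) + 8 * (B t x * (z t x * (z t x * z t x)))
     + 6 * ((B t x * B t x) * (z t x * z t x)))).
    by apply/funext => r; rewrite /energy_node; ring.
  by apply: is_derive_eq D _; rewrite /denergy_node; ring.
have D := is_deriveD (is_deriveD d1 (is_deriveZ mu d2))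
  (is_deriveZ (mu / nu) (is_deriveD (dn ord0 0 I01_0) (dn ord_max 1 I01_1))).
rewrite /energy/=; under eq_fun do rewrite interp0// interp1//.
apply: is_derive_eq D _; rewrite /denergy /GRing.scale/= !interp0// !interp1//.
by rewrite (ipC (interp s z')) (ipC (dinterp s z')); ring.
Qed.

(** The filter is arbitrary so that continuity relative to the closed half-line of times, including
    time 0, is covered. *)
Lemma energy_cvg s (T : Type) (F : set_system T) {FF : Filter F} (B z : T -> R -> R) (B0 z0 : R -> R) :
  itv_partition 0 1 s ->
  (forall x, x \in `[0, 1] -> B r x @[r --> F] --> B0 x) ->
  (forall x, x \in `[0, 1] -> z r x @[r --> F] --> z0 x) ->
  energy mu nu wd c (B r) (interp s (z r)) (dinterp s (z r)) @[r --> F] -->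
  energy mu nu wd c B0 (interp s z0) (dinterp s z0).
Proof.
move=> sP cB cz.
have nz j : (j <= size s)%N -> z r (node s j) @[r --> F] --> z0 (node s j).
  by move=> js; apply: cz; exact: node_I01.
have d1 := nodal_bilinear_cvg (FF := FF) (nodal_bilinear_interp sP) nz nz.
have d2 := nodal_bilinear_cvg (FF := FF) (nodal_bilinear_dinterp sP) nz nz.
have dn i x : x \in `[0, 1] -> energy_node wd c i (B r x) (z r x) @[r --> F] -->
    energy_node wd c i (B0 x) (z0 x).
  move=> xI; have h1 := cB x xI; have h2 := cz x xI.
  have X n (u : T -> R) (l : R) : u r @[r --> F] --> l -> u r ^+ n @[r --> F] --> l ^+ n.
    move=> ul; elim: n => [|n IH]; first by rewrite expr0; under eq_fun do rewrite expr0; exact: cvg_cst.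
    by rewrite exprS; under eq_fun do rewrite exprS; exact: cvgM.
  rewrite /energy_node; apply: cvgD; first by apply: cvgMr; exact: X.
  apply: cvgMr; apply: cvgD; first apply: cvgD.
  - by apply: cvgMr; exact: X.
  - by apply: cvgM; [exact: cvgMr|exact: X].
  - by apply: cvgM; [apply: cvgMr; exact: X|exact: X].
rewrite /energy; under eq_fun do rewrite interp0// interp1//; rewrite interp0// interp1//.
apply: cvgD; first by apply: cvgD => //; exact: cvgMr.
by apply: cvgMr; apply: cvgD; apply: dn; rewrite ?I01_0 ?I01_1.
Qed.

(** On [V_h] the derivative of a finite element function may be replaced by the
    canonical step function, since both represent it. *)
Lemma semidiscrete_weak_form s u ux ut uxt z : itv_partition 0 1 s ->
  (forall x, x \in `[0, 1] -> u x = interp s u x) ->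
  (forall x, x \in `[0, 1] -> ut x = interp s ut x) ->
  H1 u ux -> H1 ut uxt ->
  weak_form mu nu wd c u ux ut uxt (interp s z) (dinterp s z) =
  weak_form mu nu wd c (interp s u) (dinterp s u) (interp s ut) (dinterp s ut)
    (interp s z) (dinterp s z).
Proof.
move=> sP uE utE Hu Hut; have Hz := H1_interp sP z.
have Hi := H1_interp sP u.
rewrite (weak_formE_parts mu wd nu_gt0 c_gt0 _ _ Hu Hz) (weak_formE_parts mu wd nu_gt0 c_gt0 _ _ Hi Hz).
rewrite (ip_dinterp_interp sP _ Hu) (ip_dinterp_interp sP _ Hut) !interp0// !interp1//.
have -> : ip ut (interp s z) = ip (interp s ut) (interp s z).
  by apply: eq_ip => // x; rewrite inE => /utE.
have -> : ip u (dinterp s z) = ip (interp s u) (dinterp s z).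
  by apply: eq_ip => // x; rewrite inE => /uE.
by have -> : ip (fun x => u x ^+ 2) (dinterp s z) = ip (fun x => interp s u x ^+ 2) (dinterp s z)
  by apply: eq_ip => // x; rewrite inE => /uE ->.
Qed.

(** The test function is [w0h] minus the interpolant of [w0]. Its derivative is orthogonal to that
    of the interpolation error, so only an L^2 pairing with this error remains, and the projection
    is O(e) close to the interpolant in the full H^1 norm. *)
Lemma projection_bound (lambda e : R) s w0 w0h : 0 < lambda -> itv_partition 0 1 s ->
  H1_projection lambda s w0 w0h ->
  (forall x, x \in `[0, 1] -> `|interp s w0 x - w0 x| <= e) ->
  ip (interp s (fun x => w0h x - w0 x)) (interp s (fun x => w0h x - w0 x))
  + ip (dinterp s (fun x => w0h x - w0 x)) (dinterp s (fun x => w0h x - w0 x)) <= (1 + lambda / 2) * e ^+ 2.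
Proof.
move=> l0 sP [Vw [ux [uhx [Hu Huh orth]]]] ze; set z := (fun x => w0h x - w0 x).
have Hz := H1_interp sP z.
have := orth _ _ (Vh_interp sP z) Hz.
rewrite ipBl; [|exact: H1_L2d Hu|exact: H1_L2d Huh|exact: H1_L2d Hz].
rewrite (ip_dinterp_interp sP _ Hu) (ip_dinterp_interp sP _ Huh).
rewrite -ipBl; [|exact: L2_dinterp|exact: L2_dinterp|exact: L2_dinterp].
have -> : ip (fun x => dinterp s w0 x - dinterp s w0h x) (dinterp s z) = - ip (dinterp s z) (dinterp s z).
  rewrite -ipNl; [|exact: L2_dinterp|exact: L2_dinterp].
  by apply: eq_ip => // x _; rewrite dinterpB opprB.
pose rho x := interp s w0 x - w0 x.
have Lr : L2 rho by apply: L2B; [exact: L2_interp|exact: H1_L2 Hu].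
have -> : ip (fun x => w0 x - w0h x) (interp s z) = - ip (interp s z) (interp s z) - ip rho (interp s z).
  have Lz := H1_L2 Hz.
  rewrite -ipNl// -ipBl//; last exact: L2N.
  apply: eq_ip => // x; rewrite inE => xI; rewrite /rho interpB.
  by rewrite -(Vh_interpE sP Vw xI); ring.
have := young_ip (-1) Lr (H1_L2 Hz).
have rb := ip_sup Lr ze.
move: (ip_ge0 (interp s z)) (ip_ge0 (dinterp s z)) rb.
set A := ip (interp s z) _; set D := ip (dinterp s z) _; set Q := ip rho rho.
move: A D Q (ip rho (interp s z)) => A D Q P A0 D0 Qe yg E.
have h1 : 0 <= lambda * (Q + A + 2 * P) by apply: mulr_ge0; [exact: ltW|lra].
have h2 : lambda * Q <= lambda * e ^+ 2 by rewrite ler_wpM2l// ltW.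
have h3 : lambda * A <= lambda * e ^+ 2.
  have : D + lambda / 2 * A <= lambda / 2 * e ^+ 2 by lra.
  lra.
have h4 : A <= e ^+ 2 by rewrite -(ler_pM2l l0).
by have := mulr_ge0 (ltW l0) A0; lra.
Qed.

End DiscreteTime.

(** * Decay and error estimate *)

Section ClosedLoop.
Context {R : realType}.
Variables (mu nu wd : R) (c : 'I_2 -> R).
Hypotheses (mu_gt0 : 0 < mu) (nu_gt0 : 0 < nu) (wd_ge0 : 0 <= wd).
Hypothesis c_gt0 : forall i, 0 < c i.
Variables (w G : R -> R -> R) (S : set R) (M C : R).
Hypotheses (M_ge0 : 0 <= M) (C_ge0 : 0 <= C).
Hypothesis S_dense : forall a b : R, 0 <= a -> a < b -> exists t, [/\ a < t, t < b & S t].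
Hypothesis S_weak : forall t, S t -> 0 < t /\ exists ux uxt,
  [/\ H1 (w t) ux, H1 (G t) uxt & forall chi chix, H1 chi chix ->
        weak_form mu nu wd c (w t) ux (G t) uxt chi chix = 0].
Hypothesis w_lip : forall s t x, 0 <= s -> 0 <= t -> x \in `[0, 1] ->
  `|w t x - w s x| <= M * `|t - s|.
Hypothesis G_lip : forall s t x, x \in `[0, 1] -> `|G t x - G s x| <= C * `|t - s|.
Hypothesis w_derive : forall t x : R, 0 < t -> x \in `[0, 1] ->
  is_derive t 1 (fun t => w t x) (G t x).
Hypothesis G_bound : forall t d : R, 0 < t -> (forall x, x \in `[0, 1] -> `|w t x| <= d) ->
  forall x, x \in `[0, 1] -> `|G t x| <= C * d.

Lemma w_cvg (t x : R) : 0 < t -> x \in `[0, 1] -> w r x @[r --> t] --> w t x.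
Proof. by move=> t0 xI; apply: is_derive_cvg (w_derive t0 xI). Qed.

Lemma G_cvg (t x : R) : x \in `[0, 1] -> G r x @[r --> t] --> G t x.
Proof.
by move=> xI; apply: (@lipschitz_cvg _ (G^~ x) C t) => s; exact: G_lip.
Qed.

Lemma w_continuous (x : R) : x \in `[0, 1] ->
  {within `[0, +oo[, continuous (fun t => w t x)}.
Proof.
move=> xI; apply/within_continuousP => t /=; rewrite in_itv/= andbT => t0 e e0.
have M1 : 0 < M + 1 by have h := M_ge0; lra.
exists (e / (M + 1)); first exact: divr_gt0.
move=> s; rewrite in_itv/= andbT => s0; rewrite ltr_pdivlMr// => h.
by apply: le_lt_trans (w_lip s0 t0 xI) (le_lt_trans _ h); rewrite mulrC ler_wpM2l//; lra.
Qed.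

(* The weak form tested with ramps controls [mu G + nu w], hence [w] through an
   ordinary differential equation in [t].  Its initial value is bounded backwards
   from time [1], because [w0] itself is only known to be in H^2. *)
Lemma space_regularity (beta d : R) f' f'' : W2p +oo%E (w 1) f' f'' ->
  0 <= beta -> beta * mu < nu ->
  (forall t x : R, 0 <= t -> x \in `[0, 1] -> `|w t x| <= d * expR (- beta * t)) ->
  exists2 K, 0 <= K & [/\ forall t x, 0 < t -> x \in `[0, 1] -> `|G t x| <= K * expR (- beta * t),
   (forall t a x b : R, 0 <= t -> 0 <= a -> a <= x -> x <= b -> b <= 1 ->
     `|ierr (w t) a x b| <= K * expR (- beta * t) * (b - a) ^+ 3) &
   (forall t a x b : R, 0 < t -> 0 <= a -> a <= x -> x <= b -> b <= 1 ->
     `|ierr (G t) a x b| <= K * expR (- beta * t) * (b - a) ^+ 3)].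
Proof.
move=> W1 b0 bmu wd'; have mu0 := mu_gt0; have nu0 := nu_gt0; have C0 := C_ge0; have wd0 := wd_ge0.
pose E (t : R) := expR (- beta * t); have E0 t : 0 < E t by exact: expR_gt0.
have d0 : 0 <= d.
  by have := le_trans (normr_ge0 _) (wd' 0 0 (lexx _) I01_0); rewrite mulr0 expR0 mulr1.
have GE (t x : R) : 0 < t -> x \in `[0, 1] -> `|G t x| <= C * d * E t.
  by move=> t0 xI; rewrite -mulrA; apply: G_bound => // y yI; exact: wd' (ltW t0) yI.
pose D := d + C * d; have D0 : 0 <= D by rewrite /D; pos.
have wD (t x : R) : 0 <= t -> x \in `[0, 1] -> `|w t x| <= D * E t.
  move=> t0 xI; apply: (le_trans (wd' t x t0 xI)); rewrite ler_wpM2r ?(ltW (E0 t))//.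
  by rewrite lerDl mulr_ge0.
have GD (t x : R) : 0 < t -> x \in `[0, 1] -> `|G t x| <= D * E t.
  move=> t0 xI; apply: (le_trans (GE t x t0 xI)); rewrite ler_wpM2r ?(ltW (E0 t))//.
  by rewrite lerDr.
have E1 (t : R) : 0 <= t -> E t <= 1.
  by move=> t0; rewrite -expR0 ler_expR mulNr oppr_le0 mulr_ge0.
have ED (t : R) : 0 <= t -> D * E t <= D by move=> t0; rewrite ler_piMr// E1.
have Ecvg (k t : R) : k * E r @[r --> t] --> k * E t.
  apply: cvgMr; apply: (@continuous_comp _ _ _ (fun r => - beta * r) expR).
    by apply: cvgMr; exact: cvg_id.
  exact: continuous_expR.
have Icc (a b x : R) : 0 <= a -> a <= x -> x <= b -> b <= 1 -> x \in `[0, 1].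
  by move=> a0 ax xb b1; rewrite in_itv/= (le_trans a0)//= (le_trans xb).
have [K0 K00 ode] := ode_bound mu0 nu0 b0 bmu.
have [K1 K10 slope] := slope_bound mu_gt0 nu_gt0 wd_ge0 c_gt0 D0.
have [l1 l10 hl1] := W1p_infty_lipschitz W1.1.
have [r1 r10 hr1] := W2p_infty_ierr W1.
(* [K1 * D] bounds the source and [l1] the Lipschitz constant at time 1; [ode] is applied to the
   difference [w t b - w t a], with both multiplied by [b - a]. *)
pose l := K0 * (K1 * D + l1); have l0 : 0 <= l by rewrite /l; pos.
have wl (t a b : R) : 0 <= t -> 0 <= a -> a <= b -> b <= 1 -> `|w t b - w t a| <= l * E t * (b - a).
  move=> t0 a0 ab b1; have aI := Icc a b a a0 (lexx _) ab b1; have bI := Icc a b b a0 ab (lexx _) b1.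
  have ba : 0 <= b - a by rewrite subr_ge0.
  have -> : l * E t * (b - a) = K0 * (K1 * D * (b - a) + l1 * (b - a)) * E t by rewrite /l; ring.
  apply: (ode (fun t => w t b - w t a) (fun t => G t b - G t a)) => //; [by pos|by pos|..].
  - by move=> x; apply: cvgB; exact: w_continuous.
  - by move=> s s0; have h1 := w_derive s0 aI; have h2 := w_derive s0 bI; exact: is_deriveB.
  - move=> s s0.
    apply: (@le_of_dense _ S (fun s => `|mu * (G s b - G s a) + nu * (w s b - w s a)|)
       (fun s => K1 * D * (b - a) * E s)); [exact: S_dense| |exact: ltW| |exact: Ecvg].
      move=> r /S_weak[r0 [ux [uxt [Hu Ht wk]]]].
      have -> : K1 * D * (b - a) * E r = K1 * (D * E r) * (b - a) by ring.
      apply: (slope _ _ _ _ Hu Ht wk) => //; first exact: ED (ltW r0).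
      + by move=> x; exact: wD (ltW r0).
      + by move=> x; exact: GD.
    apply: cvg_norm; apply: cvgD; apply: cvgMr; apply: cvgB.
    + exact: G_cvg.
    + exact: G_cvg.
    + exact: w_cvg.
    + exact: w_cvg.
  - exact: hl1.
pose k := D + 2 * (1 + wd + D) * l; have k0 : 0 <= k by rewrite /k; pos.
have qE (t a x b : R) : 0 < t -> 0 <= a -> a <= x -> x <= b -> b <= 1 ->
    `|mu * ierr (G t) a x b + nu * ierr (w t) a x b| <= k * (b - a) ^+ 3 * E t.
  move=> t0 a0 ax xb b1; have ab := le_trans ax xb.
  have aI := Icc a b a a0 (lexx _) ab b1; have bI := Icc a b b a0 ab (lexx _) b1.
  have xI := Icc a b x a0 ax xb b1.
  apply: (@le_of_dense _ S (fun t => `|mu * ierr (G t) a x b + nu * ierr (w t) a x b|)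
     (fun s => k * (b - a) ^+ 3 * E s)); [exact: S_dense| |exact: ltW| |exact: Ecvg].
    move=> r /S_weak[r0 [ux [uxt [Hu Ht wk]]]].
    have -> : k * (b - a) ^+ 3 * E r = (D * E r + 2 * (1 + wd + D) * (l * E r)) * (b - a) ^+ 3.
      by rewrite /k; ring.
    apply: (ierr_bound (M := D) (d := D * E r) (l := l * E r) nu_gt0 wd_ge0 c_gt0 Hu Ht wk) => //.
    + by move=> y yI; apply: le_trans (wD r y (ltW r0) yI) (ED _ (ltW r0)).
    + by move=> y; exact: GD.
    + by move=> a' b' a0' ab' b1'; exact: wl (ltW r0) a0' ab' b1'.
  rewrite /ierr; apply: cvg_norm; apply: cvgD; apply: cvgMr; apply: cvgB;
    try (apply: cvgB); apply: cvgMr; by [exact: G_cvg|exact: w_cvg].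
(* The summands bound [G], the interpolation error of [w] obtained from [ode], and that of [G],
   recovered from the combination in [qE] by subtracting [nu * ierr (w t) a x b] and dividing by
   [mu]. *)
pose K := C * d + K0 * (k + r1) + (k + nu * (K0 * (k + r1))) / mu.
have p1 : 0 <= K0 * (k + r1) by pos.
have p2 : 0 <= (k + nu * (K0 * (k + r1))) / mu by pos.
have p3 : 0 <= C * d by pos.
have ew (t a x b : R) : 0 <= t -> 0 <= a -> a <= x -> x <= b -> b <= 1 ->
    `|ierr (w t) a x b| <= K0 * (k + r1) * (b - a) ^+ 3 * E t.
  move=> t0 a0 ax xb b1; have ab := le_trans ax xb.
  have aI := Icc a b a a0 (lexx _) ab b1; have bI := Icc a b b a0 ab (lexx _) b1.
  have xI := Icc a b x a0 ax xb b1.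
  have b3 : 0 <= (b - a) ^+ 3 by rewrite exprn_ge0// subr_ge0.
  have -> : K0 * (k + r1) * (b - a) ^+ 3 = K0 * (k * (b - a) ^+ 3 + r1 * (b - a) ^+ 3) by ring.
  apply: (ode (fun t => ierr (w t) a x b) (fun t => ierr (G t) a x b));
    [by pos|by pos| | | | |exact: t0].
  - move=> y; rewrite /ierr; apply: cvgB; first apply: cvgB; apply: cvgMr; exact: w_continuous.
  - move=> s s0; have h1 := w_derive s0 aI; have h2 := w_derive s0 bI; have h3 := w_derive s0 xI.
    by rewrite /ierr; apply: is_deriveB.
  - by move=> s s0; exact: qE.
  - exact: hr1.
exists K; first by rewrite /K; lra.
have KE (t p q : R) : 0 <= p -> q <= K -> q * E t * p <= K * E t * p.
  by move=> p0 qK; rewrite ler_wpM2r// ler_wpM2r// ltW.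
split.
- move=> t x t0 xI; apply: (le_trans (GE t x t0 xI)); rewrite ler_wpM2r ?(ltW (E0 t))//.
  by rewrite /K; lra.
- move=> t a x b t0 a0 ax xb b1; apply: (le_trans (ew t a x b t0 a0 ax xb b1)).
  rewrite mulrAC; apply: KE; last by rewrite /K; lra.
  by rewrite exprn_ge0// subr_ge0 (le_trans ax).
- move=> t a x b t0 a0 ax xb b1.
  have b3 : 0 <= (b - a) ^+ 3 by rewrite exprn_ge0// subr_ge0 (le_trans ax).
  have h1 := ew t a x b (ltW t0) a0 ax xb b1; have h2 := qE t a x b t0 a0 ax xb b1.
  apply: (@le_trans _ _ ((k + nu * (K0 * (k + r1))) / mu * E t * (b - a) ^+ 3)); last first.
    by apply: KE; rewrite // /K; lra.
  have -> : (k + nu * (K0 * (k + r1))) / mu * E t * (b - a) ^+ 3 =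
     (k * (b - a) ^+ 3 * E t + nu * (K0 * (k + r1) * (b - a) ^+ 3 * E t)) / mu by ring.
  rewrite ler_pdivlMr// -[X in _ * X](gtr0_norm mu0) -normrM.
  have -> : ierr (G t) a x b * mu = (mu * ierr (G t) a x b + nu * ierr (w t) a x b) - nu * ierr (w t) a x b.
    by ring.
  apply: (le_trans (ler_normB _ _)); apply: lerD => //.
  by apply: normM_le => //; rewrite gtr0_norm.
Qed.

Hypothesis w_bound : forall t x : R, 0 <= t -> x \in `[0, 1] -> `|w t x| <= M.

(** The equation is available on [S] only; both sides are continuous in time, the left one because
    it depends on nodal values. *)
Lemma residual_bound (beta K : R) s (t : R) z : itv_partition 0 1 s -> 0 <= K -> 0 < t ->
  (forall t a x b : R, 0 <= t -> 0 <= a -> a <= x -> x <= b -> b <= 1 ->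
     `|ierr (w t) a x b| <= K * expR (- beta * t) * (b - a) ^+ 3) ->
  (forall t a x b : R, 0 < t -> 0 <= a -> a <= x -> x <= b -> b <= 1 ->
     `|ierr (G t) a x b| <= K * expR (- beta * t) * (b - a) ^+ 3) ->
  weak_form mu nu wd c (interp s (w t)) (dinterp s (w t)) (interp s (G t)) (dinterp s (G t))
    (interp s z) (dinterp s z) ^+ 2 <=
  (2 * (2 + wd + M) * (K * expR (- beta * t) * mesh_size s ^+ 2)) ^+ 2
  * (ip (interp s z) (interp s z) + ip (dinterp s z) (dinterp s z)).
Proof.
move=> sP K0 t0 eW eG.
pose wf r := weak_form mu nu wd c (interp s (w r)) (dinterp s (w r)) (interp s (G r)) (dinterp s (G r))
    (interp s z) (dinterp s z).
apply: (@le_of_dense _ S (fun t => wf t ^+ 2)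
  (fun t => (2 * (2 + wd + M) * (K * expR (- beta * t) * mesh_size s ^+ 2)) ^+ 2
  * (ip (interp s z) (interp s z) + ip (dinterp s z) (dinterp s z)))).
- exact: S_dense.
- move=> r /S_weak[r0 [ux [uxt [Hu Ht wk]]]].
  have Kr : 0 <= K * expR (- beta * r) by rewrite mulr_ge0// expR_ge0.
  apply: (residual_interp (e := K * expR (- beta * r) * mesh_size s ^+ 2) (M := M) nu_gt0 wd_ge0 c_gt0 z Hu Ht sP wk).
  + by move=> x; exact: w_bound (ltW r0).
  + by apply: interp_bound => // x; exact: w_bound (ltW r0).
  + by apply: interp_error => // a x b; exact: eW (ltW r0).
  + by apply: interp_error => // a x b; exact: eG.
- exact: ltW.
- have h : wf r @[r --> t] --> wf t.
    by apply: weak_form_interp_cvg => // x xI; [exact: w_cvg|exact: G_cvg].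
  by rewrite expr2; under eq_fun do rewrite expr2; exact: cvgM.
- apply: cvgMl; rewrite expr2; under eq_fun do rewrite expr2.
  have h : 2 * (2 + wd + M) * (K * expR (- beta * r) * mesh_size s ^+ 2) @[r --> t] -->
     2 * (2 + wd + M) * (K * expR (- beta * t) * mesh_size s ^+ 2).
    apply: cvgMr; apply: cvgMl; apply: cvgMr.
    apply: (@continuous_comp _ _ _ (fun r => - beta * r) expR); last exact: continuous_expR.
    by apply: cvgMr; exact: cvg_id.
  exact: cvgM.
Qed.

(** The energy of the interpolant about zero satisfies Gronwall's inequality with a squared residual
    O(h^4) that does not decay; refining the partition removes it. To have interpolation errors
    before decay is known, [space_regularity] is used with [beta = 0] and the bound [M]. *)
Lemma decay (a : R) f' f'' w0x : 0 < a -> dissipation_rate mu nu wd c a -> W2p +oo%E (w 1) f' f'' ->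
  H1 (w 0) w0x -> exists2 d, 0 <= d &
  forall t x : R, 0 <= t -> x \in `[0, 1] -> `|w t x| <= d * expR (- a * t).
Proof.
move=> a0 diss W1 H0; have mu0 := mu_gt0; have nu0 := nu_gt0; have M0 := M_ge0; have wd0 := wd_ge0.
have e0 (t : R) : expR (- 0 * t) = 1 by rewrite oppr0 mul0r expR0.
have [||K K0 [_ eW eG]] := space_regularity W1 (lexx 0) (d := M).
- by rewrite mul0r.
- by move=> t x t0 xI; rewrite e0 mulr1; exact: w_bound.
have [C1 C10 D] := diss M M0.
have [C2 C20 nle] := energy_norm_le mu_gt0 nu_gt0 wd_ge0 c_gt0.
have [C3 C30 up] := energy_upper mu_gt0 nu_gt0 wd_ge0 c_gt0 M0.
pose eta s := 2 * (2 + wd + M) * (K * mesh_size s ^+ 2).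
pose F s t := energy mu nu wd c (fun=> 0) (interp s (w t)) (dinterp s (w t)).
pose F0 := M ^+ 2 + ip w0x w0x + 2 * (M ^+ 2 + M ^+ 4).
have F00 : 0 <= F0.
  by rewrite /F0; have := ip_ge0 w0x => ip0; pos.
have Fini s : itv_partition 0 1 s -> F s 0 <= C3 * F0.
  move=> sP; apply: (le_trans (up _ _ _ _ _)); rewrite ?normr0//.
  rewrite ler_wpM2l// /energy_norm interp0// interp1//.
  have wb x : x \in `[0, 1] -> `|w 0 x| <= M by exact: w_bound.
  have h1 := ip_sup (L2_interp sP (w 0)) (interp_bound sP wb).
  have h2 := dinterp_le sP H0.
  have h3 x : x \in `[0, 1] -> w 0 x ^+ 2 + w 0 x ^+ 4 <= M ^+ 2 + M ^+ 4.
    move=> /wb wx; have h : w 0 x ^+ 2 <= M ^+ 2.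
      by rewrite -(real_normK (num_real _)) lerXn2r// nnegrE.
    have -> : w 0 x ^+ 4 = (w 0 x ^+ 2) ^+ 2 by ring.
    have -> : M ^+ 4 = (M ^+ 2) ^+ 2 by ring.
    by apply: lerD => //; rewrite lerXn2r// nnegrE ?sqr_ge0.
  by have := h3 0 I01_0; have := h3 1 I01_1; rewrite /F0; lra.
have Fle s t : itv_partition 0 1 s -> 0 <= t ->
    F s t <= C3 * F0 * expR (- (2 * a) * t) + C1 * eta s ^+ 2 / (2 * a).
  move=> sP t0.
  have a20 : 0 < 2 * a by exact: mulr_gt0.
  have := @gronwall _ (F s) (fun t => 2 * a * t) (fun t => C1 * eta s ^+ 2 / (2 * a) * expR (2 * a * t))
    (fun t => denergy mu nu wd c (fun=> 0) (fun=> 0) (interp s (w t)) (dinterp s (w t)) (interp s (G t)) (dinterp s (G t)))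
    (fun=> 2 * a) (fun t => C1 * eta s ^+ 2 * expR (2 * a * t)) _ _ _ _ _ _ _ 0 t (lexx _) t0.
  rewrite mulr0 expR0 !mulr1 => gr.
  have {gr} : F s t * expR (2 * a * t) - C1 * eta s ^+ 2 / (2 * a) * expR (2 * a * t) <=
     F s 0 - C1 * eta s ^+ 2 / (2 * a).
    apply: gr.
    - move=> x; apply: energy_cvg => // y yI; [exact: cvg_cst|exact: (w_continuous yI)].
    - exact: lin_continuous.
    - move=> x; apply: cvgMr; apply: (@continuous_comp _ _ _ (fun r => 2 * a * r) expR).
        exact: lin_continuous.
      exact: continuous_expR.
    - move=> r r0; apply: (@energy_derive _ _ _ _ _ _ (fun=> fun=> 0) w) => // x xI.
        exact: is_derive_cst.
      exact: w_derive.
    - by move=> r _; exact: lin_derive.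
    - move=> r _; have h := is_deriveZ (C1 * eta s ^+ 2 / (2 * a)) (expR_derive (lin_derive (2 * a) r)).
      by apply: is_derive_eq h _; rewrite /GRing.scale/=; field; rewrite lt0r_neq0.
    move=> r r0; rewrite ler_wpM2r ?expR_ge0//.
    have z0 (x : R) : x \in `[0, 1] -> `|0 : R| <= 0 by rewrite normr0.
    have := D _ _ _ _ _ _ _ _ 0 (eta s) (H1_cst 0) (H1_cst 0) (H1_interp sP (w r)) (H1_interp sP (G r))
      M0 z0 (z0 _ I01_0) (z0 _ I01_1).
    rewrite (weak_form0 mu wd nu_gt0 c_gt0 (H1_interp sP (w r))) subr0.
    under eq_fun do rewrite add0r.
    under [fun x => 0 + dinterp s (w r) x]eq_fun do rewrite add0r.
    under [fun x => 0 + interp s (G r) x]eq_fun do rewrite add0r.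
    under [fun x => 0 + dinterp s (G r) x]eq_fun do rewrite add0r.
    rewrite mulr0 mul0r addr0 -/(F s r) => h.
    have := residual_bound (w r) sP K0 r0 eW eG; rewrite e0 mulr1 => /h; lra.
  move=> gr.
  have F1 := Fini s sP.
  have q0 : 0 <= C1 * eta s ^+ 2 / (2 * a) by rewrite divr_ge0 ?(ltW a20)// mulr_ge0// sqr_ge0.
  have Ee : expR (- (2 * a) * t) * expR (2 * a * t) = 1.
    by rewrite -expRD (_ : _ + _ = 0) ?expR0//; ring.
  rewrite -(ler_pM2r (expR_gt0 (2 * a * t))) [leRHS]mulrDl -(mulrA _ (expR (- _ * t))) Ee.
  by lra.
(* Since the mesh size is at most 1, its fourth power is replaced by the mesh size itself, which a
   uniform partition makes arbitrarily small. *)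
have we s t x : itv_partition 0 1 s -> 0 <= t -> x \in `[0, 1] ->
    w t x ^+ 2 <= 8 * C2 * C3 * F0 * expR (- (2 * a) * t)
      + (8 * C2 * C1 * (2 * (2 + wd + M) * K) ^+ 2 / (2 * a) + 2 * K ^+ 2) * mesh_size s.
  move=> sP t0 xI; set W := interp s (w t) x.
  have h1 : `|W - w t x| <= K * mesh_size s ^+ 2.
    apply: interp_error => // b y b' b0 bb' bb b1.
    by have := eW t b y b' t0 b0 bb' bb b1; rewrite e0 mulr1.
  have h2 : W ^+ 2 <= 4 * (C2 * F s t).
    apply: (le_trans (sobolev (H1_interp sP (w t)) xI)); rewrite ler_pM2l//.
    apply: le_trans (nle (fun=> 0) _ _); rewrite /energy_norm.
    have t4 (y : R) : 0 <= y ^+ 2 + y ^+ 4.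
      by rewrite addr_ge0 ?exprn_even_ge0.
    by rewrite -addrA lerDl addr_ge0.
  have h3 : (W - w t x) ^+ 2 <= (K * mesh_size s ^+ 2) ^+ 2.
    by rewrite -(real_normK (num_real _)) lerXn2r// nnegrE// (le_trans _ h1).
  have h0 := mesh_ge0 s; have hl1 := mesh_le1 sP.
  have h4 : mesh_size s ^+ 4 <= mesh_size s by rewrite -[leRHS]expr1 ler_wiXn2l.
  have h5 := Fle s t sP t0.
  have h6 : w t x ^+ 2 <= 2 * W ^+ 2 + 2 * (W - w t x) ^+ 2.
    by rewrite -subr_ge0; have := sqr_ge0 (2 * W - w t x); congr (0 <= _); ring.
  have h7 := ler_wpM2l C20 h5.
  have p1 : 0 <= 8 * C2 * C1 * (2 * (2 + wd + M) * K) ^+ 2 / (2 * a) + 2 * K ^+ 2 by pos.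
  have h8 := ler_wpM2l p1 h4.
  have -> : 8 * C2 * C3 * F0 * expR (- (2 * a) * t) = 8 * (C2 * (C3 * F0 * expR (- (2 * a) * t))) by ring.
  apply: (le_trans _ (lerD (lexx _) h8)).
  have E : (8 * C2 * C1 * (2 * (2 + wd + M) * K) ^+ 2 / (2 * a) + 2 * K ^+ 2) * mesh_size s ^+ 4
     = 8 * (C2 * (C1 * eta s ^+ 2 / (2 * a))) + 2 * (K * mesh_size s ^+ 2) ^+ 2 by rewrite /eta; ring.
  rewrite (mulrDr C2 (C3 * _ * _)) in h7; rewrite E; move: h7 h6 h3 h2; clear.
  move: (C2 * (C3 * _ * _)) (C2 * (C1 * _ / _)) (C2 * F s t) (W ^+ 2) ((W - w t x) ^+ 2) => *; lra.
pose A := 8 * C2 * C3 * F0; have A0 : 0 <= A by rewrite /A; pos.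
exists (A + 1); first by rewrite addr_ge0.
move=> t x t0 xI; apply: sqr_le_norm; first by rewrite mulr_ge0 ?expR_ge0// addr_ge0.
pose B := 8 * C2 * C1 * (2 * (2 + wd + M) * K) ^+ 2 / (2 * a) + 2 * K ^+ 2.
have B0 : 0 <= B by rewrite /B; pos.
have h : w t x ^+ 2 <= A * expR (- (2 * a) * t).
  apply/ler_addgt0Pr => e ep.
  have [n hn] : exists n : nat, B / e <= n.+1%:R.
    exists (Num.truncn (B / e)); apply: ltW; exact: truncnS_gt.
  have [s [sP sn]] := exists_partition (R := R) n.
  apply: (le_trans (we s t x sP t0 xI)); rewrite lerD2l -/B.
  apply: (le_trans (ler_wpM2l B0 sn)); rewrite ler_pdivrMr// mulrC -ler_pdivrMr//.
apply: (le_trans h); rewrite exprMn -expRM_natl.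
have -> : - (2 * a) * t = 2%:R * (- a * t) by ring.
by rewrite ler_wpM2r ?expR_ge0// le_sqr1D.
Qed.

(** On [0, 1], [interp s (z t)] is [wh t] minus the interpolant of [w t]. The extra coefficient in
    its energy inequality is integrable in time, so it costs a bounded factor; the loss in the rate
    comes from the residual alone. *)
Lemma error_bound (alpha a d K lambda : R) w0 w0x : 0 <= alpha -> alpha < a -> dissipation_rate mu nu wd c a ->
  0 <= d -> 0 <= K -> 0 < lambda -> H1 w0 w0x -> (forall x, x \in `[0, 1] -> w 0 x = w0 x) ->
  (forall t x : R, 0 <= t -> x \in `[0, 1] -> `|w t x| <= d * expR (- a * t)) ->
  (forall t x : R, 0 < t -> x \in `[0, 1] -> `|G t x| <= K * expR (- a * t)) ->
  (forall t a' x b : R, 0 <= t -> 0 <= a' -> a' <= x -> x <= b -> b <= 1 ->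
     `|ierr (w t) a' x b| <= K * expR (- a * t) * (b - a') ^+ 3) ->
  (forall t a' x b : R, 0 < t -> 0 <= a' -> a' <= x -> x <= b -> b <= 1 ->
     `|ierr (G t) a' x b| <= K * expR (- a * t) * (b - a') ^+ 3) ->
  exists2 C', 0 <= C' & forall s w0h wh, itv_partition 0 1 s ->
    H1_projection lambda s w0 w0h -> semidiscrete_solution mu nu wd c s w0h wh ->
    forall t x : R, 0 <= t -> x \in `[0, 1] ->
      `|w t x - wh t x| <= C' * (mesh_size s ^+ 2 * expR (- alpha * t)).
Proof.
move=> al0 ala diss d0 K0 l0 H0 wE wd' GK eW eG.
have mu0 := mu_gt0; have nu0 := nu_gt0; have M0 := M_ge0; have wd0 := wd_ge0.
have a0 : 0 < a by exact: le_lt_trans ala.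
have dK0 : 0 <= d + K by rewrite addr_ge0.
have [C1 C10 D] := diss (d + K) dK0.
have [C2 C20 nle] := energy_norm_le mu_gt0 nu_gt0 wd_ge0 c_gt0.
have [C3 C30 up] := energy_upper mu_gt0 nu_gt0 wd_ge0 c_gt0 M0.
pose E (t : R) := expR (- a * t).
have E0 t : 0 < E t by exact: expR_gt0.
have E1 (t : R) : 0 <= t -> E t <= 1.
  by move=> t0; rewrite -expR0 ler_expR mulNr oppr_le0 mulr_ge0// ltW.
pose e1 := 2 * (2 + wd + M) * K; have e10 : 0 <= e1 by rewrite /e1; pos.
(* [kp * E t] is the integral of [C1 * (d + K) * E] from [t] to infinity. Adding it to the exponent
   cancels this coefficient at the price of a factor at most [expR kp]. *)
pose kp := C1 * (d + K) / a; have kp0 : 0 <= kp by rewrite /kp; pos.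
pose Q := C1 * e1 ^+ 2 * expR kp; have Q0 : 0 <= Q by rewrite /Q; have := expR_gt0 kp => ek0; pos.
pose X1 := (1 + lambda / 2) * K ^+ 2; have X10 : 0 <= X1 by rewrite /X1; pos.
(* The squared H^1 norm of the initial difference is at most [X1 * h ^+ 4]. By the Sobolev
   inequality each squared end value adds 4 times this, and each fourth power adds
   [16 * X1 ^+ 2 * h ^+ 8], where [h <= 1] allows [h ^+ 4] instead. *)
pose F0 := C3 * (9 * X1 + 32 * X1 ^+ 2); have F00 : 0 <= F0 by rewrite /F0; pos.
pose g := a - alpha; have g0 : 0 < g by rewrite subr_gt0.
pose B1 := F0 * expR kp + Q / (2 * g).
have B10 : 0 <= B1 by rewrite /B1; have := expR_gt0 kp => ek0; pos.
pose B2 := 4 * (C2 * B1); have B20 : 0 <= B2 by rewrite /B2; pos.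
exists (K + (B2 + 1)); first by rewrite !addr_ge0.
move=> s w0h wh sP Pr [Vwh whi whc [whx [wht [whxt sol]]]].
have hm0 := mesh_ge0 s; have hm1 := mesh_le1 sP.
set h := mesh_size s in hm0 hm1 *.
pose z t x := wh t x - w t x.
pose z' t x := wht t x - G t x.
pose F t := energy mu nu wd c (w t) (interp s (z t)) (dinterp s (z t)).
have whI (t x : R) : 0 <= t -> x \in `[0, 1] -> wh t x = interp s (wh t) x.
  by move=> t0 xI; apply: Vh_interpE => //; exact: Vwh.
have dz (r x : R) : 0 < r -> x \in `[0, 1] -> is_derive r 1 (fun t => z t x) (z' r x).
  move=> r0 xI; have [dwh _ _ _] := sol r r0.
  have p1 := dwh x xI; have p2 := w_derive r0 xI; exact: is_deriveB.
have Fder (r : R) : 0 < r -> is_derive r 1 F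
   (denergy mu nu wd c (w r) (G r) (interp s (z r)) (dinterp s (z r)) (interp s (z' r)) (dinterp s (z' r))).
  move=> r0; apply: energy_derive => // x xI; [exact: w_derive|exact: dz].
have Fineq (r : R) : 0 < r ->
    denergy mu nu wd c (w r) (G r) (interp s (z r)) (dinterp s (z r)) (interp s (z' r)) (dinterp s (z' r))
    <= - 2 * a * F r + C1 * ((d + K) * E r) * F r + C1 * (e1 * (E r * h ^+ 2)) ^+ 2.
  move=> r0; have [dwh Hh Hht wk] := sol r r0.
  have htI : forall x, x \in `[0, 1] -> wht r x = interp s (wht r) x.
    exact: (Vh_time_derive sP r0 Vwh dwh).
  have endB f th thx : energy mu nu wd c (interp s f) (interp s th) thx =
      energy mu nu wd c f (interp s th) thx by rewrite /energy !interp0// !interp1.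
  have dendB f ft th thx tht thtx : denergy mu nu wd c (interp s f) (interp s ft) (interp s th) thx (interp s tht) thtx =
      denergy mu nu wd c f ft (interp s th) thx (interp s tht) thtx by rewrite /denergy !interp0// !interp1.
  rewrite -dendB /F -endB.
  have HI f := H1_interp sP f.
  have bE : (d + K) * E r <= d + K by rewrite ler_piMr// E1// ltW.
  have lK (p q : R) : 0 <= p -> 0 <= q -> p * E r <= (p + q) * E r /\ q * E r <= (p + q) * E r.
    by move=> p0 q0; split; rewrite ler_wpM2r ?(ltW (E0 _))// ?lerDl ?lerDr.
  have [lK1 lK2] := lK d K d0 K0.
  apply: (D _ _ _ _ _ _ _ _ _ _ (HI (w r)) (HI (G r)) (HI (z r)) (HI (z' r)) bE).
  - by apply: interp_bound => // x xI; apply: le_trans lK1; exact: wd' (ltW r0) xI.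
  - by rewrite interp0//; apply: le_trans lK2; exact: GK I01_0.
  - by rewrite interp1//; apply: le_trans lK2; exact: GK I01_1.
  have -> : (fun x => interp s (w r) x + interp s (z r) x) = interp s (wh r).
    by apply/funext => x; rewrite interpB subrKC.
  have -> : (fun x => dinterp s (w r) x + dinterp s (z r) x) = dinterp s (wh r).
    by apply/funext => x; rewrite dinterpB subrKC.
  have -> : (fun x => interp s (G r) x + interp s (z' r) x) = interp s (wht r).
    by apply/funext => x; rewrite interpB subrKC.
  have -> : (fun x => dinterp s (G r) x + dinterp s (z' r) x) = dinterp s (wht r).
    by apply/funext => x; rewrite dinterpB subrKC.
  rewrite -(semidiscrete_weak_form mu wd nu_gt0 c_gt0 (z r) sP (whI r ^~ (ltW r0)) htI Hh Hht).
  rewrite (wk _ _ (Vh_interp sP (z r)) (HI (z r))) sub0r sqrrN.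
  have := residual_bound (z r) sP K0 r0 eW eG.
  by rewrite -/(E r) -/h /e1 !mulrA.
have Fcont : {within `[0, +oo[, continuous F}.
  move=> x; apply: energy_cvg => // y yI; first exact: (w_continuous yI).
  by apply: cvgB; [exact: whc|exact: (w_continuous yI)].
pose p t := 2 * a * t + kp * E t.
have pder (t : R) : is_derive t 1 p (2 * a - C1 * (d + K) * E t).
  have h1 := is_deriveD (lin_derive (2 * a) t) (is_deriveZ kp (expR_derive (lin_derive (- a) t))).
  apply: is_derive_eq h1 _; rewrite /GRing.scale/= /kp -/(E t); field.
  by rewrite lt0r_neq0.
have pcont : continuous p by move=> t; apply: is_derive_cvg (pder t).
have Fgr (t : R) : 0 <= t -> F t * expR (p t) <= F 0 * expR kp + Q * h ^+ 4 * t.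
  move=> t0.
  have := gronwall Fcont pcont (@lin_continuous R (Q * h ^+ 4)) Fder (fun t _ => pder t)
    (fun t _ => lin_derive (Q * h ^+ 4) t) _ (lexx 0) t0.
  have -> : p 0 = kp by rewrite /p /E !mulr0 expR0 add0r mulr1.
  move=> gr.
  have {gr} : F t * expR (p t) - Q * h ^+ 4 * t <= F 0 * expR kp - Q * h ^+ 4 * 0.
    apply: gr => r r0; have h1 := Fineq r r0.
    have h2 : denergy mu nu wd c (w r) (G r) (interp s (z r)) (dinterp s (z r)) (interp s (z' r)) (dinterp s (z' r)) + (2 * a - C1 * (d + K) * E r) * F r <= C1 * (e1 * (E r * h ^+ 2)) ^+ 2.
      by move: h1; move: (denergy _ _ _ _ _ _ _ _ _ _) (F r) => x y h1; lra.
    apply: (le_trans (ler_wpM2r (expR_ge0 _) h2)).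
    rewrite /p; have -> : C1 * (e1 * (E r * h ^+ 2)) ^+ 2 * expR (2 * a * r + kp * E r) =
       C1 * e1 ^+ 2 * h ^+ 4 * (E r * E r * expR (2 * a * r)) * expR (kp * E r).
      by rewrite (expRD (2 * a * r)); ring.
    have -> : E r * E r * expR (2 * a * r) = 1.
      by rewrite /E -!expRD (_ : _ + _ = 0) ?expR0//; ring.
    have -> : Q * h ^+ 4 = C1 * e1 ^+ 2 * h ^+ 4 * 1 * expR kp by rewrite /Q; ring.
    rewrite ler_wpM2l ?ler_expR ?ler_piMr ?E1 ?(ltW r0)//.
    by rewrite mulr1; pos.
  lra.
have Fini : F 0 <= F0 * h ^+ 4.
  have zE : forall x, x \in `[0, 1] -> z 0 x = w0h x - w0 x by move=> x xI; rewrite /z whi// wE.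
  have [i1 i2] := eq_interp sP zE.
  rewrite /F i1 i2; apply: (le_trans (up _ _ _ (w_bound (lexx 0) I01_0) (w_bound (lexx 0) I01_1))).
  rewrite /F0 -mulrA ler_wpM2l//.
  have eb x : x \in `[0, 1] -> `|interp s w0 x - w0 x| <= K * h ^+ 2.
    move=> xI; have [<- _] := eq_interp sP wE; rewrite -wE//.
    apply: interp_error => // b y b' b0 bb' bb b1.
    by have := eW 0 b y b' (lexx _) b0 bb' bb b1; rewrite mulr0 expR0 mulr1.
  have X := projection_bound l0 sP Pr eb.
  set th := interp s _ in X *; set thx := dinterp s _ in X *.
  have Hth : H1 th thx by exact: H1_interp.
  have s0 := sobolev Hth I01_0; have s1 := sobolev Hth I01_1.
  rewrite /energy_norm; move: (ip_ge0 th) (ip_ge0 thx) X s0 s1.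
  have h40 : 0 <= h ^+ 4 by rewrite exprn_ge0.
  have h8 : (h ^+ 4) ^+ 2 <= h ^+ 4 by rewrite expr2 ler_piMr// exprn_ile1.
  have -> : (1 + lambda / 2) * (K * h ^+ 2) ^+ 2 = X1 * h ^+ 4 by rewrite /X1; ring.
  set A := ip th th; set A' := ip thx thx; move: A A' (th 0) (th 1) => A A' u v A0 A'0 X s0 s1.
  have q (y : R) : y ^+ 2 <= 4 * (A + A') -> y ^+ 4 <= 16 * (X1 ^+ 2 * h ^+ 4).
    move=> ys; have -> : y ^+ 4 = (y ^+ 2) ^+ 2 by ring.
    have ys' : y ^+ 2 <= 4 * (X1 * h ^+ 4) by lra.
    apply: (@le_trans _ _ ((4 * (X1 * h ^+ 4)) ^+ 2)).
      by rewrite lerXn2r// nnegrE ?sqr_ge0// (le_trans _ ys')// sqr_ge0.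
    have -> : (4 * (X1 * h ^+ 4)) ^+ 2 = 16 * (X1 ^+ 2 * (h ^+ 4) ^+ 2) by ring.
    by rewrite ler_pM2l// ler_wpM2l// sqr_ge0.
  by have := q u s0; have := q v s1; lra.
have Fdec (t : R) : 0 <= t -> F t <= B1 * h ^+ 4 * expR (- (2 * alpha) * t).
  move=> t0; have h40 : 0 <= h ^+ 4 by rewrite exprn_ge0.
  rewrite -(ler_pM2r (expR_gt0 (p t))).
  apply: (le_trans (Fgr t t0)).
  have h1 : F 0 * expR kp <= F0 * h ^+ 4 * expR kp by rewrite ler_wpM2r// expR_ge0.
  (* The squared residual decays exactly as fast as the weight grows, whence the linear factor [t];
     the gap [g] between [a] and [alpha] dominates it by an exponential. *)
  have h2 : Q * h ^+ 4 * t <= Q / (2 * g) * h ^+ 4 * expR (2 * g * t).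
    have h3 : t <= (2 * g)^-1 * expR (2 * g * t).
      have g20 : 0 < 2 * g by exact: mulr_gt0.
      rewrite mulrC ler_pdivlMr// mulrC.
      by apply: le_trans (expR_ge1Dx _); rewrite lerDr.
    have -> : Q / (2 * g) * h ^+ 4 * expR (2 * g * t) = Q * h ^+ 4 * ((2 * g)^-1 * expR (2 * g * t)) by ring.
    by rewrite ler_wpM2l// mulr_ge0.
  have h3 : 1 <= expR (2 * g * t) by rewrite -expR0 ler_expR; pos.
  apply: (@le_trans _ _ (B1 * h ^+ 4 * expR (2 * g * t))).
    have h4 : F0 * h ^+ 4 * expR kp <= F0 * h ^+ 4 * expR kp * expR (2 * g * t).
      by apply: ler_peMr => //; apply: mulr_ge0; [exact: mulr_ge0|exact: expR_ge0].
    by rewrite /B1; lra.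
  rewrite -[leRHS]mulrA -expRD ler_wpM2l ?mulr_ge0// ler_expR /p /g.
  by have := E0 t => Et; have := mulr_ge0 kp0 (ltW Et); lra.
move=> t x t0 xI.
pose Ea := expR (- alpha * t).
have Ea0 : 0 < Ea by exact: expR_gt0.
have EEa : E t <= Ea by rewrite ler_expR; apply: ler_wpM2r => //; rewrite lerN2 ltW.
have h1 : `|interp s (w t) x - w t x| <= K * (h ^+ 2 * Ea).
  apply: (le_trans (interp_error sP (mulr_ge0 K0 (ltW (E0 t))) _ xI)).
    by move=> b y b' b0 bb' bb b1; exact: eW.
  rewrite -/h -mulrA (mulrC (expR _)); apply: ler_wpM2l => //; apply: ler_wpM2l => //.
  exact: sqr_ge0.
have h2 : `|interp s (z t) x| <= (B2 + 1) * (h ^+ 2 * Ea).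
  apply: sqr_le_norm; first by rewrite !mulr_ge0 ?sqr_ge0 ?addr_ge0 ?(ltW Ea0).
  apply: (le_trans (sobolev (H1_interp sP (z t)) xI)).
  apply: (@le_trans _ _ (4 * (C2 * F t))).
    rewrite ler_pM2l//; apply: le_trans (nle (w t) _ _); rewrite /energy_norm.
    have t4 (y : R) : 0 <= y ^+ 2 + y ^+ 4.
      by rewrite addr_ge0 ?exprn_even_ge0.
    by rewrite -addrA lerDl addr_ge0.
  have h3 := ler_wpM2l C20 (Fdec t t0).
  have -> : ((B2 + 1) * (h ^+ 2 * Ea)) ^+ 2 = (B2 + 1) ^+ 2 * (h ^+ 4 * (Ea * Ea)) by ring.
  have EE : expR (- (2 * alpha) * t) = Ea * Ea by rewrite /Ea -expRD; congr expR; ring.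
  rewrite EE in h3.
  apply: (@le_trans _ _ (B2 * (h ^+ 4 * (Ea * Ea)))).
    by rewrite /B2; lra.
  rewrite ler_wpM2r//; first by rewrite !mulr_ge0 ?exprn_ge0 ?(ltW Ea0).
  exact: le_sqr1D.
have -> : w t x - wh t x = - (interp s (w t) x - w t x) - interp s (z t) x.
  by rewrite (whI t x t0 xI) interpB; ring.
rewrite mulrDl; apply: (le_trans (ler_normB _ _)); rewrite normrN.
exact: lerD.
Qed.

End ClosedLoop.

(** * Feedback laws and conclusion *)

Lemma K_lipschitz (R : realType) (nu wd : R) (c : 'I_2 -> R) (M : R) : 0 < nu -> 0 <= wd ->
  (forall i, 0 < c i) -> 0 <= M ->
  exists2 k, 0 <= k & forall i (y z : R), `|y| <= M -> `|z| <= M ->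
    `|K nu wd c i y - K nu wd c i z| <= k * `|y - z|.
Proof.
move=> nu0 wd0 c0 M0.
pose k i := nu^-1 * (c i + 1 + wd + 2 / (9 * c i) * (3 * M ^+ 2)).
have k0 i : 0 <= k i.
  have ci := c0 i; have n0 : 0 < nu^-1 by rewrite invr_gt0.
  have g0 : 0 < (9 * c i)^-1 by rewrite invr_gt0 mulr_gt0.
  by rewrite /k; pos.
exists (k ord0 + k ord_max); first by rewrite addr_ge0.
move=> i y z yM zM; apply: (@le_trans _ _ (k i * `|y - z|)); last first.
  rewrite ler_wpM2r//; have := k0 ord0; have := k0 ord_max.
  case: i => -[|[|//]] i2.
    by rewrite (_ : Ordinal i2 = ord0); [lra|exact/val_inj].
  by rewrite (_ : Ordinal i2 = ord_max); [lra|exact/val_inj].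
have ci := c0 i.
have -> : K nu wd c i y - K nu wd c i z = (-1) ^+ i * (nu^-1 * (c i + 1 + wd
    + 2 / (9 * c i) * (y ^+ 2 + y * z + z ^+ 2)) * (y - z)).
  by rewrite /K; field; rewrite !lt0r_neq0.
rewrite normrM normrX normrN1 expr1n mul1r; apply: normM_le => //.
rewrite normrM gtr0_norm ?invr_gt0// ler_pM2l ?invr_gt0//.
apply: (le_trans (ler_normD _ _)); rewrite ger0_norm; last by lra.
have c9 : 0 <= 2 / (9 * c i) by rewrite divr_ge0// mulr_ge0// ltW.
rewrite lerD2l normrM (ger0_norm c9) ler_wpM2l//.
apply: (le_trans (ler_normD _ _)); have h1 := ler_normD (y ^+ 2) (y * z).
have h2 : `|y ^+ 2| <= M ^+ 2 by rewrite normrX lerXn2r// nnegrE.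
have h3 : `|z ^+ 2| <= M ^+ 2 by rewrite normrX lerXn2r// nnegrE.
have h4 : `|y * z| <= M ^+ 2 by rewrite normrM expr2; exact: ler_pM.
lra.
Qed.

Theorem theorem3p2 (R : realType) (mu nu wd lambda alpha : R) (c : 'I_2 -> R)
    (w0 : R -> R) (w : R -> R -> R)
    (hmu : 0 < mu) (hnu : 0 < nu) (hwd : 0 <= wd) (hc : forall i, 0 < c i)
    (hlambda : 0 < lambda)
    (halpha0 : 0 <= alpha) (halpha : alpha <= alpha_max mu nu wd c)
    (hw0 : exists w0x w0xx : R -> R, H2 w0 w0x w0xx)
    (hw : closed_loop_solution mu nu wd c w0 w)
    (hwoo : forall t : R, 0 < t ->
       exists f' f'' : R -> R, W2p +oo%E (w t) f' f'') :
  exists C : R,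
    forall (s : seq R), itv_partition 0 1 s ->
    forall (w0h : R -> R) (wh : R -> R -> R),
      H1_projection lambda s w0 w0h ->
      semidiscrete_solution mu nu wd c s w0h wh ->
      forall t : R, 0 <= t ->
        (Lpnorm +oo%E (fun x => (w t x - wh t x)%R)
           <= (C * (mesh_size s ^+ 2 / Num.sqrt mu * expR (- alpha * t)))%:E)%E
        /\ forall i : 'I_2,
             `|K nu wd c i (w t i%:R) - K nu wd c i (wh t i%:R)|
             <= C * (mesh_size s ^+ 2 / Num.sqrt mu * expR (- alpha * t)).
Proof.
have [w0x [w0xx [H0 _]]] := hw0.
have [f' [f'' W1]] := hwoo 1 ltr01.
have w0E : forall x, x \in `[0, 1] -> w 0 x = w0 x.
  move=> x xI; have [? [? [? [? [? [[_ _ -> // _] _]]]]]] := hw.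
  by rewrite set_itv1 Rintegral_set1 addr0.
have [G [S [M [CG [[M0 CG0] dense weak [wM wlip Glip wder Gb]]]]]] := closed_loop_regularity hmu hnu hwd hc hw.
have [a [ala a2 diss]] := energy_dissipation hmu hnu hwd hc.
have [al0 al1 _ _] := alpha_max_spec hmu hnu hwd hc.
have a0 : 0 < a by exact: lt_trans ala.
have Hw0 : H1 (w 0) w0x.
  by apply: eq_H1 H0 => x; rewrite inE => /w0E.
have [d d0 wd'] := decay hmu hnu hwd hc M0 CG0 dense weak wlip Glip wder Gb wM a0 diss W1 Hw0.
(* This says that solutions of [mu * y' + nu * y = 0] decay faster than [expR (- a * t)], so
   [space_regularity] can be applied again, now with the decay rate [a]. *)
have amu : a * mu < nu.
  apply: (@le_lt_trans _ _ (2 * alpha_max mu nu wd c * mu)); first by rewrite ler_pM2r.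
  by move: al1; rewrite mulrDr mulr1; lra.
have [k k0 [GK eW eG]] := space_regularity hmu hnu hwd hc M0 CG0 dense weak wlip Glip wder Gb W1 (ltW a0) amu wd'.
have [C C0 err] := error_bound hmu hnu hwd hc M0 dense weak wlip Glip wder wM
  halpha0 (le_lt_trans halpha ala) diss d0 k0 hlambda H0 w0E wd' GK eW eG.
have MC0 : 0 <= M + C by rewrite addr_ge0.
(* The discrete end values stay within [M + C], because the error bound [C * e] is at most [C]. *)
have [L L0 KL] := K_lipschitz hnu hwd hc MC0.
have sq0 : 0 < Num.sqrt mu by rewrite sqrtr_gt0.
(* With [mu] fixed, the factor [Num.sqrt mu] cancels the one in the denominator of the rate; [1 + L]
   serves the state and the controls at once. *)
exists ((1 + L) * C * Num.sqrt mu) => s sP w0h wh Pr Sol t t0.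
have h0 := mesh_ge0 s; have h1 := mesh_le1 sP.
have E1 : expR (- alpha * t) <= 1.
  by rewrite -expR0 ler_expR mulNr oppr_le0 mulr_ge0.
set e := mesh_size s ^+ 2 * expR (- alpha * t).
have e0 : 0 <= e by rewrite mulr_ge0 ?expR_ge0// sqr_ge0.
have e1 : e <= 1 by rewrite mulr_ile1 ?expR_ge0 ?sqr_ge0// exprn_ile1.
have -> : (1 + L) * C * Num.sqrt mu * (mesh_size s ^+ 2 / Num.sqrt mu * expR (- alpha * t)) =
    (1 + L) * C * e.
  by rewrite /e; field; rewrite lt0r_neq0.
have werr x : x \in `[0, 1] -> `|w t x - wh t x| <= C * e by exact: err sP Pr Sol t x t0.
have Ce0 : 0 <= C * e by exact: mulr_ge0.
have LCe0 : 0 <= L * (C * e) by exact: mulr_ge0.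
split=> [|i].
  apply: Lpnorm_infty_le; first by rewrite -mulrA mulr_ge0// addr_ge0.
  by move=> x /werr h; apply: (le_trans h); rewrite -mulrA mulrDl mul1r lerDl.
have iI : i%:R \in `[0, 1 : R] by rewrite in_itv/= ler0n lern1; case: i => -[|[]].
have wi := wM t _ t0 iI; have ei := werr _ iI.
have Ce1 : C * e <= C by rewrite ler_piMr.
apply: (le_trans (KL i _ _ _ _)); first by rewrite (le_trans wi)// lerDl.
  have := ler_distD (w t i%:R) (wh t i%:R) 0; rewrite !subr0 (distrC (wh t _)); lra.
by apply: (le_trans (ler_wpM2l L0 ei)); rewrite -mulrA mulrDl mul1r lerDr.
Qed.
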